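(* Let $\lambda>0$ and let $\rho\sim E(m_0,\Sigma_0,g)$ and $\nu\sim E(m_1,\Sigma_1,g)$ be elliptic densities on $\mathbb{R}^d$ with the same generator $g$, where $\Sigma_0$ and $\Sigma_1$ are simultaneously diagonalizable. Assume that the Kalman–Wasserstein-dual geodesic from $\rho$ to $\nu$ generated by a quadratic potential is the unique such dual geodesic from $\rho$ to $\nu$ (so that $D^{\mathrm{KW}}(\rho\mid\nu)$ is its action). With $\Delta m=m_1-m_0$ and $\Delta\Sigma=\Sigma_1-\Sigma_0$, $$D^{\mathrm{KW}}(\rho\mid\nu)=\frac{\kappa_g}{4\lambda}\operatorname{tr}(\Xi)+\frac12\Delta m^\top\big(\Delta\Sigma^\perp\,\Sigma_{0,\lambda}^{-1}\,\Delta\Sigma^\perp\big)\Delta m+\frac1{4\lambda}\Delta m^\top P\,\Xi\,P\,\Big(\big(\sqrt{\Sigma_1}-\sqrt{\Sigma_0}\big)^\dagger\Big)^2\Delta m,$$ where $P=\Delta\Sigma(\Delta\Sigma)^\dagger$, $\Delta\Sigma^\perp=I-\Delta\Sigma(\Delta\Sigma)^\dagger$, $\Sigma_{\ell,\lambda}=\kappa_g\Sigma_\ell+\lambda I$ for $\ell\in\{0,1\}$, and $$\Xi=\Sigma_1\ln\big(\Sigma_1\Sigma_0^{-1}\big)+\frac1{\kappa_g}\Sigma_{1,\lambda}\ln\big(\Sigma_{0,\lambda}\Sigma_{1,\lambda}^{-1}\big).$$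
   Context: Elliptic densities: $\rho\sim E(m,\Sigma,g)$ means $\rho(x)=\det(\Sigma)^{-1/2}g((x-m)^\top\Sigma^{-1}(x-m))$ with $m\in\mathbb{R}^d$, $\Sigma$ symmetric positive definite, and $g\colon[0,\infty)\to(0,\infty)$ smooth, integrable with $\frac{\pi^{d/2}}{\Gamma(d/2)}\int_0^\infty r^{d/2-1}g(r)\,dr=1$, $\int_0^\infty r^{(d-1)/2}g(r)\,dr<\infty$, $\int_0^\infty r^{d/2}g(r)\,dr<\infty$. Set $\kappa_g=\frac1d\int_{\mathbb{R}^d}\|y\|^2g(\|y\|^2)\,dy$; the covariance matrix of $E(m,\Sigma,g)$ is $\kappa_g\Sigma$. $\dagger$ is the Moore–Penrose inverse; $\ln$ is the matrix logarithm. Kalman–Wasserstein geometry (with regularization $\lambda>0$) on smooth positive densities $P_+^\infty(\mathbb{R}^d)$: $\phi^{\mathrm{KW}}_\rho([f])=-\nabla\cdot\big(\rho\,(C(\rho)+\lambda I)\nabla f\big)$, where $C(\rho)$ is the covariance matrix of $\rho$ and $[f]$ is the class of $f\in C^\infty(\mathbb{R}^d)$ modulo constants. A KW-dual geodesic is a curve $\gamma\colon[0,1]\to P_+^\infty(\mathbb{R}^d)$ for which there is a fixed (time-independent) potential $f$ with $\dot\gamma(t)=\phi^{\mathrm{KW}}_{\gamma(t)}([f])$ for all $t$; along it $g^{\mathrm{KW}}_{\gamma(t)}(\dot\gamma(t),\dot\gamma(t))=\int_{\mathbb{R}^d}\nabla f^\top(C(\gamma(t))+\lambda I)\nabla f\,\gamma(t)\,dx$.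 The divergence is $$D^{\mathrm{KW}}(\rho\mid\nu)=\inf\Big\{\int_0^1t\,g^{\mathrm{KW}}_{\gamma(t)}(\dot\gamma(t),\dot\gamma(t))\,dt:\ \gamma\text{ KW-dual geodesic},\ \gamma(0)=\rho,\ \gamma(1)=\nu\Big\}.$$ A quadratic potential is $f(x)=\frac12x^\top Bx+b^\top x$ with $B$ symmetric and $b\in\mathbb{R}^d$. Standing assumption: the dual geodesic from $\rho$ to $\nu$ with quadratic potential is the unique dual geodesic joining them, so $D^{\mathrm{KW}}(\rho\mid\nu)$ is the value of the integral along it. *)

(* Defs.v *)
From HB Require Import structures.
From mathcomp Require Import all_boot all_order all_algebra.
From mathcomp Require Import all_classical all_reals all_analysis.

Set Implicit Arguments.
Unset Strict Implicit.
Unset Printing Implicit Defensive.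

Import Order.TTheory GRing.Theory Num.Theory.
Import numFieldNormedType.Exports.

Local Open Scope classical_set_scope.
Local Open Scope ring_scope.

(* R^d is 'cV[R]_d for linear algebra, differentiation and topology; the
   library's measurable structure on R^d is the one on d.-tuple R, so integrals
   over R^d are taken over tuples and transported by [vec]. *)

Definition vec (R : realType) (d : nat) (t : d.-tuple R) : 'cV[R]_d :=
  \col_(i < d) tnth t i.

Definition cons_pair (R : realType) (d : nat) (p : R * d.-tuple R) :
    d.+1.-tuple R :=
  [the d.+1.-tuple R of p.1 :: p.2].

Lemma measurable_cons_pair (R : realType) (d : nat) :
  measurable_fun [set: R * d.-tuple R] (@cons_pair R d).
Proof. exact: measurable_cons. Qed.

Definition uncons_pair (R : realType) (d : nat) (t : d.+1.-tuple R) :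
    R * d.-tuple R :=
  (thead t, [tuple of behead t]).

Lemma measurable_uncons_pair (R : realType) (d : nat) :
  measurable_fun [set: d.+1.-tuple R] (@uncons_pair R d).
Proof.
by apply: measurable_fun_pair; [exact: measurable_tnth|exact: measurable_behead].
Qed.

Lemma cons_pairK (R : realType) (d : nat) :
  cancel (@cons_pair R d) (@uncons_pair R d).
Proof. by case=> x t; congr pair; apply/val_inj. Qed.

Section cons_measure.
Local Open Scope ereal_scope.
Context (R : realType) (d : nat).
Variable mu : {sigma_finite_measure set (d.-tuple R) -> \bar R}.

Definition cons_measure : set (d.+1.-tuple R) -> \bar R :=
  pushforward (@lebesgue_measure R \x mu) (@cons_pair R d).

Let mcons := @measurable_cons_pair R d.

Let cons_measure0 : cons_measure set0 = 0.
Proof. by rewrite /cons_measure /pushforward preimage_set0 measure0. Qed.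

Let cons_measure_ge0 A : 0 <= cons_measure A.
Proof. exact: measure_ge0. Qed.

Let cons_measure_sigma_additive : semi_sigma_additive cons_measure.
Proof.
move=> F mF tF mUF; rewrite /cons_measure /pushforward preimage_bigcup.
apply: measure_semi_sigma_additive.
- by move=> n; rewrite -[X in measurable X]setTI; exact: mcons.
- apply/trivIsetP => /= i j _ _ ij; rewrite -preimage_setI.
  by move/trivIsetP : tF => /(_ _ _ _ _ ij) ->//; rewrite preimage_set0.
- by rewrite -preimage_bigcup -[X in measurable X]setTI; exact: mcons.
Qed.

HB.instance Definition _ := isMeasure.Build _ _ _ cons_measure
  cons_measure0 cons_measure_ge0 cons_measure_sigma_additive.

Let cons_measure_sigma_finite : sigma_finite setT cons_measure.
Proof.
have /sigma_finiteP[F [TF ndF Foo]] := sigma_finiteT (@lebesgue_measure R).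
have /sigma_finiteP[G [TG ndG Goo]] := sigma_finiteT mu.
exists (fun n => @uncons_pair R d @^-1` (F n `*` G n)).
  rewrite -preimage_bigcup [X in _ @^-1` X](_ : _ = setT) ?preimage_setT//.
  apply/seteqP; split=> // -[x y] _.
  have [n _ Fnx] : (\bigcup_n F n) x by rewrite -TF.
  have [k _ Gky] : (\bigcup_n G n) y by rewrite -TG.
  exists (maxn n k) => //; split => /=.
    by move: x Fnx; exact/subsetPset/ndF/leq_maxl.
  by move: y Gky; exact/subsetPset/ndG/leq_maxr.
move=> n; have [mFn Fnoo] := Foo n; have [mGn Gnoo] := Goo n; split.
  rewrite -[X in measurable X]setTI.
  by apply: measurable_uncons_pair => //; exact: measurableX.
rewrite /cons_measure /pushforward -comp_preimage.
rewrite (_ : _ \o _ = id); last by apply/funext => p /=; rewrite cons_pairK.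
by rewrite preimage_id product_measure1E// lte_mul_pinfty// ge0_fin_numE.
Qed.

HB.instance Definition _ := @Measure_isSigmaFinite.Build _ _ _ cons_measure
  cons_measure_sigma_finite.

End cons_measure.

Section lebesgue_tuple0.
Context (R : realType).

Definition lebesgue_tuple0 : set (0.-tuple R) -> \bar R := \d_ [tuple].

HB.instance Definition _ := Measure.on lebesgue_tuple0.

Let lebesgue_tuple0_sigma_finite : sigma_finite setT lebesgue_tuple0.
Proof. exact: sigma_finiteT. Qed.

HB.instance Definition _ := @Measure_isSigmaFinite.Build _ _ _ lebesgue_tuple0
  lebesgue_tuple0_sigma_finite.

End lebesgue_tuple0.

(* Lebesgue measure on R^d: the d-fold product of the one-dimensional one. *)
Fixpoint leb (R : realType) (d : nat) :
    {sigma_finite_measure set (d.-tuple R) -> \bar R} :=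
  match d with
  | 0 => @lebesgue_tuple0 R
  | d'.+1 => cons_measure (leb R d')
  end.

Definition int_Rd (R : realType) (d : nat) (F : 'cV[R]_d -> \bar R) : \bar R :=
  (\int[leb R d]_t F (vec t))%E.

Section matrices.
Context (R : realType) (d : nat).
Implicit Types A X : 'M[R]_d.

Definition sym_posdef A : Prop :=
  A^T = A /\ forall v : 'cV[R]_d, v != 0 -> 0 < (v^T *m A *m v) 0 0.

Definition sym_possemidef A : Prop :=
  A^T = A /\ forall v : 'cV[R]_d, 0 <= (v^T *m A *m v) 0 0.

(* [xget] picks the unique symmetric positive semidefinite square root. *)
Definition mxsqrt A : 'M[R]_d :=
  xget 0 [set X | sym_possemidef X /\ X *m X = A].

Definition mxexp X : 'M[R]_d :=
  limn (series (fun k : nat => k`!%:R^-1 *: X ^+ k)).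

(* The principal logarithm of a matrix that is diagonalizable over R with
   positive eigenvalues: its unique logarithm that is diagonalizable over R. *)
Definition mxln A : 'M[R]_d :=
  xget 0 [set X | diagonalizable X /\ mxexp X = A].

Definition moore_penrose A X : Prop :=
  [/\ A *m X *m A = A, X *m A *m X = X,
      (A *m X)^T = A *m X & (X *m A)^T = X *m A].

Definition mxpinv A : 'M[R]_d := xget 0 [set X | moore_penrose A X].

End matrices.

Section calculus.
Context (R : realType).

(* u is differentiable at t relatively to D, hence one-sidedly at the end points
   of an interval. *)
Definition is_derive_within (D : set R) (u : R -> R) (t l : R) : Prop :=
  (fun s => (s - t)^-1 * (u s - u t)) @ within D t^' --> l.

(* G n is the n-th derivative of g on [0, +oo[ (one-sided at 0). *)
Definition smooth_half_line (g : R -> R) : Prop :=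
  exists G : nat -> R -> R, (forall r, 0 <= r -> G 0%N r = g r) /\
    forall n r, 0 <= r -> is_derive_within `[0, +oo[ (G n) r (G n.+1 r).

Context (d : nat).
Implicit Types (f : 'cV[R]_d -> R) (V : 'cV[R]_d -> 'cV[R]_d).

Definition partial (i : 'I_d) f : 'cV[R]_d -> R :=
  fun x => 'D_(delta_mx i 0) f x.

(* C^oo: all iterated partial derivatives exist and are differentiable. *)
Definition smooth f : Prop :=
  forall (s : seq 'I_d) (x : 'cV[R]_d), differentiable (foldr partial f s) x.

Definition grad f (x : 'cV[R]_d) : 'cV[R]_d := \col_(i < d) partial i f x.

Definition divergence V (x : 'cV[R]_d) : R :=
  \sum_(i < d) partial i (fun y => V y i 0) x.

Definition sqnorm (x : 'cV[R]_d) : R := (x^T *m x) 0 0.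

Definition quad_potential (B : 'M[R]_d) (b : 'cV[R]_d) : 'cV[R]_d -> R :=
  fun x => 2^-1 * (x^T *m B *m x) 0 0 + (b^T *m x) 0 0.

End calculus.

Section elliptic.
Context (R : realType) (d : nat).

Definition Gamma (a : R) : \bar R :=
  (\int[@lebesgue_measure R]_(t in `]0%R, +oo[) (t `^ (a - 1) * expR (- t))%:E)%E.

Definition elliptic_generator (g : R -> R) : Prop :=
  [/\ smooth_half_line g,
      forall r, 0 <= r -> 0 < g r,
      (@lebesgue_measure R).-integrable `]0, +oo[ (EFin \o g),
      ((pi `^ (d%:R / 2) / fine (Gamma (d%:R / 2)))%:E *
        \int[@lebesgue_measure R]_(r in `]0%R, +oo[)
          (r `^ (d%:R / 2 - 1) * g r)%:E = 1)%E &
      (\int[@lebesgue_measure R]_(r in `]0%R, +oo[)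
          (r `^ ((d%:R - 1) / 2) * g r)%:E < +oo)%E /\
      (\int[@lebesgue_measure R]_(r in `]0%R, +oo[)
          (r `^ (d%:R / 2) * g r)%:E < +oo)%E].

Definition elliptic (rho : 'cV[R]_d -> R) (m : 'cV[R]_d) (S : 'M[R]_d)
    (g : R -> R) : Prop :=
  [/\ sym_posdef S, elliptic_generator g &
      forall x, rho x = (Num.sqrt (\det S))^-1 *
                        g (((x - m)^T *m invmx S *m (x - m)) 0 0)].

Definition kappa (g : R -> R) : R :=
  d%:R^-1 * fine (int_Rd (fun y : 'cV[R]_d => (sqnorm y * g (sqnorm y))%:E)).

End elliptic.

Section kalman_wasserstein.
Context (R : realType) (d : nat).
Implicit Types (rho nu f : 'cV[R]_d -> R) (gam : R -> 'cV[R]_d -> R).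

Definition smooth_positive_density rho : Prop :=
  [/\ smooth rho, forall x, 0 < rho x & int_Rd (fun x => (rho x)%:E) = 1%E].

(* Guarantees that the mean and the covariance matrix below are meaningful. *)
Definition finite_second_moment rho : Prop :=
  (int_Rd (fun x => (sqnorm x * rho x)%:E) < +oo)%E.

Definition mean rho : 'cV[R]_d :=
  \col_(i < d) fine (int_Rd (fun x => (x i 0 * rho x)%:E)).

Definition cov rho : 'M[R]_d :=
  \matrix_(i < d, j < d)
    fine (int_Rd (fun x =>
      ((x i 0 - mean rho i 0) * (x j 0 - mean rho j 0) * rho x)%:E)).

Definition phi_KW (lam : R) rho f : 'cV[R]_d -> R :=
  fun x => - divergence
    (fun y => rho y *: ((cov rho + lam%:M) *m grad f y)) x.

(* The squared KW norm at rho of the tangent vector phi_KW lam rho f. *)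
Definition sqnorm_KW (lam : R) rho f : \bar R :=
  int_Rd (fun x =>
    (((grad f x)^T *m (cov rho + lam%:M) *m grad f x) 0 0 * rho x)%:E).

(* Only the restriction of gam to [0, 1] matters; the time derivative is taken
   pointwise in x, one-sided at t = 0 and t = 1. *)
Definition KW_generates (lam : R) f gam : Prop :=
  [/\ smooth f,
      forall t, t \in `[0, 1] ->
        smooth_positive_density (gam t) /\ finite_second_moment (gam t) &
      forall t, t \in `[0, 1] -> forall x,
        is_derive_within `[0, 1] (gam ^~ x) t (phi_KW lam (gam t) f x)].

Definition KW_dual_geodesic (lam : R) gam : Prop :=
  exists f, KW_generates lam f gam.

Definition joins gam rho nu : Prop := gam 0 = rho /\ gam 1 = nu.

Definition KW_action (lam : R) f gam : \bar R :=
  (\int[@lebesgue_measure R]_(t in `[0%R, 1%R]) (t%:E * sqnorm_KW lam (gam t) f))%E.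

Definition D_KW (lam : R) rho nu : \bar R :=
  ereal_inf [set a | exists f gam,
    [/\ KW_generates lam f gam, joins gam rho nu & a = KW_action lam f gam]].

Definition unique_quad_dual_geodesic (lam : R) rho nu : Prop :=
  exists gam (B : 'M[R]_d) (b : 'cV[R]_d),
    [/\ B^T = B, KW_generates lam (quad_potential B b) gam, joins gam rho nu &
        forall gam', KW_dual_geodesic lam gam' -> joins gam' rho nu ->
          forall t, t \in `[0, 1] -> gam' t = gam t].

End kalman_wasserstein.

(* Main.v *)
Require Import Defs.
From HB Require Import structures.
From mathcomp Require Import all_boot all_order all_algebra ring lra.
From mathcomp Require Import all_classical all_reals all_analysis.
From mathcomp Require Import perm measurable_realfun.

(** Let [Q] diagonalize both scale matrices, with eigenvalues [a i] and [c i].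
    In these coordinates the problem becomes scalar.  The dual geodesic is sought
    as the law of [m t + exp (h t) (X - m0)], where [X] has density [rho], the
    matrix [exp (h t)] has eigenbasis [Q], and the potential is quadratic with
    Hessian [B] of eigenvalues [r i].  Since the covariance of an elliptic
    density is [kappa] times its scale matrix ([elliptic_cov]), the geodesic
    equation reads [h' = A r] and [m' = A (B m + b)] with
    [A = kappa a exp (2 h) + lam].  This is a Bernoulli equation: [lam / A]
    satisfies a linear one, hence [h], [A] and the value of [r] that reaches [c]
    at time 1 are elementary functions (section [eigenvalue_flow]).  That the
    resulting curve solves the geodesic equation is [geo_generates], and it
    joins [rho] to [nu].

    The uniqueness hypothesis then says that every dual geodesic from [rho] to
    [nu] is this curve.  It does not fix the potential, and the infimum that
    defines the divergence ranges over all potentials, so the quadratic one has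
    to be shown optimal.  If [f] generates the same tangent vector as the
    quadratic potential [f0] at a density [p], the flux
    [p (C(p) + lam I) (grad f - grad f0)] is divergence free, hence orthogonal to
    [grad f0] ([flux_orthogonal]), and Pythagoras' theorem gives that the norm
    of [f] is at least that of [f0] ([sqnorm_KW_min]).  The integration by parts
    takes place on the whole space: [f0] is multiplied by a cutoff, which
    dominated convergence removes because [p] has finite second moment and, the
    metric being bounded below by [lam], [grad f] is square integrable unless
    its norm is infinite.

    It remains to compute the action of the explicit curve.  The squared norm is
    a sum of [r^2 A (A - lam) = h'' / 2] and of a term for the mean, so that
    [(t h' - h) / 2] is a primitive of the covariance part of the integrand.
    When [a i != c i] the part of the mean is proportional to it, because [B m + b]
    is then proportional to [exp h]; when [a i = c i] it is a multiple of [t].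
    The values at the end points are the eigenvalues of the matrices in the
    formula ([spectral_value]).

    Moments of elliptic densities come from the affine change of variables in
    the iterated Lebesgue integral ([unitmx_scales]) and from the invariance of
    radial densities under reflections and transpositions ([radial_cov]).
    The square root, pseudo-inverse and logarithm are computed in the basis [Q],
    which need not be orthogonal. *)

Set Implicit Arguments.
Unset Strict Implicit.
Unset Printing Implicit Defensive.

Import Order.TTheory GRing.Theory Num.Theory.
Import numFieldNormedType.Exports.

Local Open Scope classical_set_scope.
Local Open Scope ring_scope.

(** * Functions of a diagonalizable matrix *)

(** The rows of [Q] are left eigenvectors.  They form a basis but are not assumed
    orthogonal: a common eigenbasis of two symmetric matrices may be skew inside
    a common eigenspace. *)
HB.lock Definition fc (R : realType) (d : nat) (Q : 'M[R]_d) (u : 'I_d -> R) : 'M[R]_d :=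
  invmx Q *m diag_mx (\row_i u i) *m Q.

Section functional_calculus.
Context (R : realType) (d : nat) (Q : 'M[R]_d).
Implicit Types u v : 'I_d -> R.

Local Notation fc := (fc Q).

Lemma fcE u : fc u = invmx Q *m diag_mx (\row_i u i) *m Q.
Proof. by rewrite fc.unlock. Qed.

Lemma eq_fc u v : u =1 v -> fc u = fc v.
Proof. by move=> /funext ->. Qed.

Lemma fc_entry u i j : fc u i j = \sum_k invmx Q i k * u k * Q k j.
Proof.
rewrite fcE -mulmxA mul_diag_mx mxE; apply: eq_bigr => k _.
by rewrite !mxE mulrA.
Qed.

Lemma fcD u v : fc u + fc v = fc (fun i => u i + v i).
Proof.
apply/matrixP => i j; rewrite mxE !fc_entry -big_split; apply: eq_bigr => k _ /=.
by ring.
Qed.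

Lemma fcZ c u : c *: fc u = fc (fun i => c * u i).
Proof.
apply/matrixP => i j; rewrite mxE !fc_entry mulr_sumr; apply: eq_bigr => k _ /=.
by ring.
Qed.

Lemma fcB u v : fc u - fc v = fc (fun i => u i - v i).
Proof.
rewrite -scaleN1r fcZ fcD; apply: eq_fc => i; ring.
Qed.

Lemma fc_form u (x : 'cV[R]_d) :
  (x^T *m fc u *m x) 0 0 =
  \sum_k (x^T *m invmx Q) 0 k * (Q *m x) k 0 * u k.
Proof.
rewrite fcE !mulmxA -mulmxA -[_ *m diag_mx _ *m _]mulmxA mul_diag_mx.
rewrite mxE; apply: eq_bigr => k _.
by rewrite !mxE; ring.
Qed.

Hypothesis uQ : Q \in unitmx.

Lemma fcM u v : fc u *m fc v = fc (fun i => u i * v i).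
Proof.
rewrite !fcE !mulmxA mulmxK// -[_ *m diag_mx _ *m diag_mx _]mulmxA mulmx_diag.
by congr (_ *m diag_mx _ *m _); apply/rowP => i; rewrite !mxE.
Qed.

Lemma fc_const c : fc (fun=> c) = c%:M.
Proof.
rewrite fcE (_ : \row_i c = const_mx c); last by apply/rowP => i; rewrite !mxE.
by rewrite diag_const_mx mul_mx_scalar -scalemxAl mulVmx// scalemx1.
Qed.

Lemma fcX u n : (fc u) ^+ n = fc (fun i => u i ^+ n).
Proof.
elim: n => [|n IHn].
  by rewrite expr0 (eq_fc (fun i => expr0 _)) fc_const.
by rewrite exprS IHn -mulmxE fcM; apply: eq_fc => i; rewrite exprS.
Qed.

Lemma det_fc u : \det (fc u) = \prod_i u i.
Proof.
rewrite fcE !det_mulmx det_inv det_diag mulrAC mulVr ?mul1r; last first.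
  by rewrite -unitmxE.
by apply: eq_bigr => i _; rewrite mxE.
Qed.

Lemma tr_fc u : \tr (fc u) = \sum_i u i.
Proof.
rewrite fcE mxtrace_mulC mulmxA mulmxV// mul1mx mxtrace_diag.
by apply: eq_bigr => i _; rewrite mxE.
Qed.

Lemma fc_unit u : (forall i, u i != 0) -> fc u \in unitmx.
Proof.
move=> u0; rewrite unitmxE det_fc unitfE.
by apply/prodf_neq0 => i _; exact: u0.
Qed.

Lemma fc_inv u : (forall i, u i != 0) -> invmx (fc u) = fc (fun i => (u i)^-1).
Proof.
move=> u0; have uu := fc_unit u0.
rewrite -[RHS](mulKmx uu) fcM -[LHS]mulmx1; congr (_ *m _).
by rewrite -fc_const; apply: eq_fc => i; rewrite divff.
Qed.

(** Symmetry of [fc Q u] only says that eigenvectors (rows of [Q]) of distinct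
    eigenvalues are orthogonal.  It is therefore inherited by every function of
    the spectrum, although [Q] itself need not be orthogonal. *)
Lemma fc_symP u : (fc u)^T = fc u <->
  forall i j, (Q *m Q^T) i j != 0 -> u i = u j.
Proof.
set M := Q *m Q^T.
have lE : forall i j, (diag_mx (\row_i u i) *m M) i j = u i * M i j.
  by move=> i j; rewrite mul_diag_mx mxE [X in X * _ = _]mxE.
have rE : forall i j, (M *m diag_mx (\row_i u i)) i j = M i j * u j.
  by move=> i j; rewrite mul_mx_diag mxE [X in _ * X = _]mxE.
have conj : Q *m fc u *m Q^T = diag_mx (\row_i u i) *m M.
  by rewrite fcE !mulmxA mulmxV// mul1mx.
have conjT : Q *m (fc u)^T *m Q^T = M *m diag_mx (\row_i u i).
  rewrite fcE /M !trmx_mul tr_diag_mx trmx_inv !mulmxA.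
  by rewrite mulmxKV ?unitmx_tr.
split=> [symu i j M0|uM].
  have /matrixP/(_ i j) := conjT; rewrite symu conj lE rE.
  by rewrite [RHS]mulrC => /(mulIf M0).
suff E : Q *m (fc u)^T *m Q^T = Q *m fc u *m Q^T.
  move: E => /(can_inj (mulmxK _)) E; move: (E (ltac:(by rewrite unitmx_tr))).
  by move=> /(can_inj (mulKmx uQ)).
rewrite conj conjT; apply/matrixP => i j; rewrite lE rE.
have [->|M0] := eqVneq (M i j) 0; first by rewrite mul0r mulr0.
by rewrite (uM _ _ M0) mulrC.
Qed.

Lemma fc_eigen u j : fc u *m col j (invmx Q) = u j *: col j (invmx Q).
Proof.
rewrite colE fcE -!mulmxA [Q *m (invmx Q *m _)]mulmxA mulmxV// mul1mx.
rewrite scalemxAr; congr (_ *m _); apply/colP => i; rewrite mul_diag_mx !mxE.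
by case: eqP => [->|]; rewrite ?mulr0.
Qed.

Lemma fc_posdef_gt0 u : sym_posdef (fc u) -> forall i, 0 < u i.
Proof.
move=> [_ posu] j; set v := col j (invmx Q).
have v0 : v != 0.
  apply/eqP => v0; have /matrixP/(_ j j) : Q *m invmx Q = 1%:M by rewrite mulmxV.
  rewrite mxE big1 => [|k _]; first by rewrite mxE eqxx => /esym/eqP; rewrite oner_eq0.
  by move/colP/(_ k): v0; rewrite !mxE => ->; rewrite mulr0.
have vv : 0 <= (v^T *m v) 0 0.
  by rewrite mxE; apply: sumr_ge0 => k _; rewrite !mxE -expr2 sqr_ge0.
have := posu _ v0; rewrite -mulmxA fc_eigen -scalemxAr mxE.
case: (ltP 0 (u j)) => // uj0.
by rewrite ltNge mulr_le0_ge0.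
Qed.

Lemma sqnorm_ge0 (x : 'cV[R]_d) : 0 <= sqnorm x.
Proof. by rewrite /sqnorm mxE; apply: sumr_ge0 => k _; rewrite !mxE -expr2 sqr_ge0. Qed.

Lemma sqnorm_eq0 (x : 'cV[R]_d) : sqnorm x = 0 -> x = 0.
Proof.
rewrite /sqnorm mxE => /eqP; rewrite psumr_eq0 => [/allP x0|k _]; last first.
  by rewrite !mxE -expr2 sqr_ge0.
apply/colP => i; move: (x0 i); rewrite mem_index_enum => /(_ isT).
by rewrite !mxE mulf_eq0 orbb => /eqP.
Qed.

Lemma fc_formE u (x : 'cV[R]_d) : (forall i, 0 <= u i) -> (fc u)^T = fc u ->
  (x^T *m fc u *m x) 0 0 = sqnorm (fc (fun i => Num.sqrt (u i)) *m x).
Proof.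
move=> u0 /fc_symP su; rewrite /sqnorm trmx_mul.
have -> : (fc (fun i => Num.sqrt (u i)))^T = fc (fun i => Num.sqrt (u i)).
  by apply/fc_symP => i j /su ->.
rewrite [fc u](_ : _ = fc (fun i => Num.sqrt (u i)) *m fc (fun i => Num.sqrt (u i))).
  by rewrite !mulmxA.
by rewrite fcM; apply: eq_fc => i; rewrite -expr2 sqr_sqrtr.
Qed.

Lemma fc_possemidef u : (forall i, 0 <= u i) -> (fc u)^T = fc u ->
  sym_possemidef (fc u).
Proof. by move=> u0 su; split => // x; rewrite fc_formE// sqnorm_ge0. Qed.

Lemma fc_posdef u : (forall i, 0 < u i) -> (fc u)^T = fc u -> sym_posdef (fc u).
Proof.
move=> u0 su; split => // x x0; rewrite fc_formE//; last by move=> i; exact/ltW.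
rewrite lt_def sqnorm_ge0 andbT; apply: contra_neq x0 => /sqnorm_eq0 /(congr1 (mulmx (invmx (fc (fun i => Num.sqrt (u i)))))).
rewrite mulKmx ?mulmx0//; apply: fc_unit => i.
by rewrite gt_eqF// sqrtr_gt0.
Qed.

End functional_calculus.

Section matrix_limits.
Context (R : realType).

Lemma cvg_sum_ord (T : Type) (F : set_system T) {FF : Filter F} n
    (f : 'I_n -> T -> R) (l : 'I_n -> R) :
  (forall i, f i x @[x --> F] --> l i) ->
  \sum_i f i x @[x --> F] --> \sum_i l i.
Proof. by move=> fl; apply: cvg_big => //; exact: add_continuous. Qed.

Lemma cvg_mx_entry (T : Type) (F : set_system T) {FF : Filter F} m n
    (M : T -> 'M[R]_(m, n)) (L : 'M[R]_(m, n)) :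
  (forall i j, M x i j @[x --> F] --> L i j) -> M x @[x --> F] --> L.
Proof.
move=> ML A [P PL PA].
have : \forall x \near F, forall i j, P i j (M x i j).
  by apply: filter_forall => i; apply: filter_forall => j; exact: ML (PL i j).
by apply: filterS => x; exact: PA.
Qed.

End matrix_limits.

Section matrix_functions.
Context (R : realType) (d : nat).
Implicit Types A X Y : 'M[R]_d.

(** If [X] and [Y] are two roots and [D = X - Y], then [X D = - D Y], so the
    traces of the semidefinite matrices [D Y D] and [D X D] are opposite; both
    vanish, and definiteness of [Y] gives [D = 0]. *)
Lemma possemidef_sqrt_uniq X Y : sym_possemidef X -> sym_posdef Y ->
  X *m X = Y *m Y -> X = Y.
Proof.
move=> [sX pX] [sY pY] XY; pose D := X - Y.
have sD : D^T = D by rewrite /D linearB /= sX sY.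
have sDij i j : D j i = D i j by rewrite -{1}sD mxE.
have XD : X *m D = - (D *m Y).
  by rewrite /D mulmxBr mulmxBl XY opprB.
have trE Z : \tr (D *m Z *m D) = \sum_i ((col i D)^T *m Z *m col i D) 0 0.
  apply: eq_bigr => i _; rewrite [LHS]mxE [RHS]mxE; apply: eq_bigr => k _.
  rewrite [X in _ = _ * X]mxE; congr (_ * _); rewrite [LHS]mxE [RHS]mxE.
  apply: eq_bigr => l _; congr (_ * _).
  by rewrite [RHS]mxE [RHS]mxE sDij.
have tYD : \tr (D *m Y *m D) = - \tr (D *m X *m D).
  rewrite -[D *m Y]opprK -XD mulNmx linearN /= -mulmxA mxtrace_mulC.
  by rewrite mulmxA.
have tX0 : 0 <= \tr (D *m X *m D) by rewrite trE; apply: sumr_ge0.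
have posY0 (v : 'cV[R]_d) : 0 <= (v^T *m Y *m v) 0 0.
  have [->|v0] := eqVneq v 0; first by rewrite mulmx0 mxE.
  exact/ltW/pY.
have tY0 : \tr (D *m Y *m D) = 0.
  by apply/eqP; rewrite eq_le {1}tYD oppr_le0 tX0 trE sumr_ge0.
apply/eqP; rewrite -subr_eq0 -/D; apply/eqP/matrixP => i j; rewrite [RHS]mxE.
move: tY0; rewrite trE => /eqP; rewrite psumr_eq0// => /allP /(_ j).
rewrite mem_index_enum => /(_ isT) /eqP /=.
have [cD _|cD0] := eqVneq (col j D) 0.
  by move/colP/(_ i): cD; rewrite [LHS]mxE [RHS]mxE.
by move=> /eqP; rewrite gt_eqF// pY.
Qed.

(** [A X] and [A Y] are both the orthogonal projection onto the range of [A], and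
    [X A] and [Y A] both that onto the range of its transpose. *)
Lemma moore_penrose_uniq A X Y : moore_penrose A X -> moore_penrose A Y -> X = Y.
Proof.
move=> [X1 X2 X3 X4] [Y1 Y2 Y3 Y4].
have AXY : A *m X = A *m Y.
  transitivity ((A *m X *m (A *m Y))^T).
    by rewrite trmx_mul X3 Y3 !mulmxA Y1.
  by rewrite mulmxA X1 Y3.
have XAY : X *m A = Y *m A.
  transitivity ((Y *m A *m (X *m A))^T).
    by rewrite trmx_mul X4 Y4 -!mulmxA [A *m (Y *m A)]mulmxA Y1.
  by rewrite -mulmxA [A *m (X *m A)]mulmxA X1 Y4.
by rewrite -X2 XAY -mulmxA AXY mulmxA Y2.
Qed.

Lemma mxpinvE A X : moore_penrose A X -> mxpinv A = X.
Proof.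
by move=> AX; apply: (@moore_penrose_uniq A) => //; rewrite /mxpinv; exact: xgetI AX.
Qed.

Variable Q : 'M[R]_d.
Hypothesis uQ : Q \in unitmx.

(** The convention [0^-1 = 0] in fields is what the pseudo-inverse does on the
    kernel. *)
Lemma mxpinv_fc u : (fc Q u)^T = fc Q u ->
  mxpinv (fc Q u) = fc Q (fun i => (u i)^-1).
Proof.
move=> /(fc_symP uQ) su; apply: mxpinvE; split; rewrite !fcM//.
- apply: eq_fc => i; have [->|u0] := eqVneq (u i) 0; first by rewrite mulr0.
  by rewrite divff// mul1r.
- apply: eq_fc => i; have [->|u0] := eqVneq (u i) 0; first by rewrite invr0 !mul0r.
  by rewrite mulVf// mul1r.
- by apply/fc_symP => // i j /su ->.
- by apply/fc_symP => // i j /su ->.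
Qed.

Lemma mxsqrt_fc u : sym_posdef (fc Q u) ->
  mxsqrt (fc Q u) = fc Q (fun i => Num.sqrt (u i)).
Proof.
move=> pu; have u0 := fc_posdef_gt0 uQ pu; have [/(fc_symP uQ) su _] := pu.
have ss : (fc Q (fun i => Num.sqrt (u i)))^T = fc Q (fun i => Num.sqrt (u i)).
  by apply/fc_symP => // i j /su ->.
have sq : fc Q (fun i => Num.sqrt (u i)) *m fc Q (fun i => Num.sqrt (u i)) = fc Q u.
  by rewrite fcM//; apply: eq_fc => i; rewrite -expr2 sqr_sqrtr// ltW.
have pp : sym_possemidef (fc Q (fun i => Num.sqrt (u i))).
  by apply: fc_possemidef => // i; rewrite sqrtr_ge0.
apply: xget_unique => //= X [pX XX].
apply: possemidef_sqrt_uniq => //; last by rewrite XX sq.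
by apply: fc_posdef => // i; rewrite sqrtr_gt0.
Qed.

(** Multiplied by [Q'] on the left and by [invmx Q] on the right, the equation
    becomes [w i * M i j = M i j * u j] with [M = Q' *m invmx Q], whose entries
    measure the overlap of the two eigenbases. *)
Lemma fc_eqP (Q' : 'M[R]_d) (w u : 'I_d -> R) : Q' \in unitmx ->
  fc Q' w = fc Q u <-> forall i j, (Q' *m invmx Q) i j != 0 -> w i = u j.
Proof.
move=> uQ'; set M := Q' *m invmx Q.
have lE : forall i j, (diag_mx (\row_i w i) *m M) i j = w i * M i j.
  by move=> i j; rewrite mul_diag_mx mxE [X in X * _ = _]mxE.
have rE : forall i j, (M *m diag_mx (\row_i u i)) i j = M i j * u j.
  by move=> i j; rewrite mul_mx_diag mxE [X in _ * X = _]mxE.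
have wE : Q' *m fc Q' w *m invmx Q = diag_mx (\row_i w i) *m M.
  by rewrite fcE !mulmxA mulmxV// mul1mx.
have uE : Q' *m fc Q u *m invmx Q = M *m diag_mx (\row_i u i).
  by rewrite fcE !mulmxA mulmxK.
split=> [wu i j M0|wu].
  have /matrixP/(_ i j) := uE; rewrite -wu wE lE rE.
  by rewrite [RHS]mulrC => /(mulIf M0).
have E : Q' *m fc Q' w *m invmx Q = Q' *m fc Q u *m invmx Q.
  rewrite wE uE; apply/matrixP => i j; rewrite lE rE.
  have [->|M0] := eqVneq (M i j) 0; first by rewrite mul0r mulr0.
  by rewrite (wu _ _ M0) mulrC.
apply: (can_inj (mulKmx uQ')); apply: (can_inj (mulmxK _)); last exact: E.
by rewrite unitmx_inv.
Qed.

Lemma cvg_fc (Q' : 'M[R]_d) (u_ : nat -> 'I_d -> R) u :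
  (forall i, u_ n i @[n --> \oo] --> u i) -> fc Q' (u_ n) @[n --> \oo] --> fc Q' u.
Proof.
move=> uu; apply: cvg_mx_entry => i j; rewrite fc_entry.
under eq_cvg do rewrite fc_entry.
apply: cvg_sum_ord => k; apply: cvgMr_tmp; apply: cvgMl_tmp; exact: uu.
Qed.

Lemma mxexp_fc (Q' : 'M[R]_d) u : Q' \in unitmx ->
  mxexp (fc Q' u) = fc Q' (fun i => expR (u i)).
Proof.
move=> uQ'; apply/cvg_lim; first exact: norm_hausdorff.
have -> : series (fun k : nat => k`!%:R^-1 *: fc Q' u ^+ k) =
          (fun n => fc Q' (fun i => series (exp_coeff (u i)) n)).
  apply/funext; elim => [|n IHn].
    rewrite /series /= big_geq// (_ : (fun _ => _) = (fun=> 0)); last first.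
      by apply/funext => i; rewrite big_geq.
    by rewrite fc_const// raddf0.
  rewrite seriesSr IHn fcX// fcZ fcD; apply: eq_fc => i.
  by rewrite seriesSr /exp_coeff /=; congr (_ + _); rewrite mulrC.
apply: cvg_fc => i; exact: is_cvg_series_exp_coeff.
Qed.

(** Uniqueness of the logarithm: if [X] has eigenbasis [Q'] and [mxexp X = fc Q u],
    then by [fc_eqP] an eigenvector of [X] overlaps only eigenvectors of [fc Q u]
    whose eigenvalue is the exponential of its own, and [expR] is injective. *)
Lemma mxln_fc u : (forall i, 0 < u i) -> mxln (fc Q u) = fc Q (fun i => ln (u i)).
Proof.
move=> u0; apply: xget_unique => [|X /= []].
  split; last by rewrite mxexp_fc//; apply: eq_fc => i; rewrite lnK// posrE.
  exists Q => //; rewrite /similar_to conjumx// fcE !mulmxA mulmxV// mul1mx mulmxK//.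
move=> [Q' uQ' /diag_mxP[v]]; rewrite conjumx// => E.
have {E} XE : X = fc Q' (fun i => v 0 i).
  rewrite fcE (_ : \row_i _ = v); last by apply/rowP => i; rewrite !mxE.
  by rewrite -E -!mulmxA mulVmx// mulmx1 mulKmx.
rewrite XE mxexp_fc// => /(fc_eqP _ _ uQ') wu.
by apply/fc_eqP => // i j /wu <-; rewrite expRK.
Qed.

End matrix_functions.

(** * Affine changes of variables in the Lebesgue integral *)

Section affine_line.
Context (R : realType).
Local Notation mu := (@lebesgue_measure R).
Variables (a b : R).
Hypothesis a0 : a != 0.

Let phi (x : measurableTypeR R) : measurableTypeR R := a * x + b.

Let mphi : measurable_fun setT phi.
Proof. by apply: measurable_funD => //; exact: mulrl_measurable. Qed.

Let affine_pushforward : {nu : {measure set (measurableTypeR R) -> \bar R} |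
  forall A, nu A = (`|a|%:E * mu (phi @^-1` A))%E}.
Proof.
have abs_ge0 : 0 <= `|a| by [].
unshelve refine (exist _ (mscale (NngNum abs_ge0) (pushforward mu phi : {measure set _ -> \bar R}) : {measure set _ -> \bar R}) _).
  exact: mphi.
by [].
Qed.

Let affine_preimage (A : set R) : measurable A ->
  (`|a|%:E * mu (phi @^-1` A))%E = mu A.
Proof.
case: affine_pushforward => nu nuE mA; rewrite -nuE.
(* A measure on the line is determined by its values on half-open intervals. *)
apply/esym/lebesgue_measure_unique => //= _ [[u v]] _ <-; rewrite nuE.
have [a_gt0|a_lt0|/eqP] := ltgtP 0 a; last by rewrite eq_sym (negbTE a0).
- have -> : phi @^-1` [set` `]u, v]] = [set` `](u - b) / a, (v - b) / a]].
    apply/seteqP; split=> x /=; rewrite !in_itv /= /phi;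
      by rewrite ltr_pdivrMr// ler_pdivlMr// ltrBlDr lerBrDr mulrC.
  rewrite !lebesgue_measure_itv /= !lte_fin ltr_pM2r ?invr_gt0// ltrD2r.
  case: ifP => _; last by rewrite mule0.
  by rewrite -!EFinB -EFinM gtr0_norm//; congr EFin; field.
- have -> : phi @^-1` [set` `]u, v]] = [set` `[(v - b) / a, (u - b) / a[].
    apply/seteqP; split=> x /=; rewrite !in_itv /= /phi;
      by rewrite ler_ndivrMr// ltr_ndivlMr// ltrBlDr lerBrDr mulrC andbC.
  rewrite !lebesgue_measure_itv /= !lte_fin ltr_nM2r ?invr_lt0// ltrD2r.
  case: ifP => _; last by rewrite mule0.
  by rewrite -!EFinB -EFinM ltr0_norm//; congr EFin; field.
Qed.

Lemma ge0_integral_affine (f : R -> \bar R) :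
  measurable_fun setT f -> (forall x, (0 <= f x)%E) ->
  (\int[mu]_x f (a * x + b)%R = (`|a|^-1)%:E * \int[mu]_x f x)%E.
Proof.
move=> mf f0; have abs_ge0 : 0 <= `|a| by [].
have <- : (`|a|%:E * \int[pushforward mu phi]_x f x = \int[mu]_x f x)%E.
  rewrite -(@ge0_integral_mscale _ _ _ _ _ measurableT (NngNum abs_ge0))//.
  by apply: eq_measure_integral => A mA _; exact: affine_preimage.
rewrite ge0_integral_pushforward//=.
by rewrite preimage_setT muleA -EFinM mulVf ?normr_eq0// mul1e.
Qed.

End affine_line.

Section euclidean_integral.
Context (R : realType).
Local Notation mu := (@lebesgue_measure R).

Definition unvec d (x : 'cV[R]_d) : d.-tuple R := [tuple x i 0 | i < d].

Lemma vecK d : cancel (@unvec d) (@vec R d).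
Proof. by move=> x; apply/colP => i; rewrite mxE tnth_mktuple. Qed.

Lemma measurable_vec_entry d (i : 'I_d) :
  measurable_fun setT (fun t : d.-tuple R => vec t i 0).
Proof.
by under eq_fun do rewrite mxE; exact: measurable_tnth.
Qed.

Lemma measurable_affine d d' (F : 'cV[R]_d' -> \bar R) (M : 'M[R]_(d', d)) (v : 'cV[R]_d') :
  measurable_fun setT (F \o @vec R d') ->
  measurable_fun setT (fun t : d.-tuple R => F (M *m vec t + v)).
Proof.
move=> mF.
rewrite (_ : (fun t => _) = (F \o @vec R d') \o (fun t => unvec (M *m vec t + v))); last first.
  by apply/funext => t /=; rewrite vecK.
apply: measurableT_comp => //; apply/measurable_fun_tnthP => i.
rewrite (_ : _ \o _ = (fun t => (\sum_j M i j * vec t j 0) + v i 0)).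
  apply: measurable_realfun.measurable_funD => //; apply: measurable_sum => j.
  by apply: measurable_realfun.measurable_funM => //; exact: measurable_vec_entry.
by apply/funext => t /=; rewrite tnth_mktuple !mxE.
Qed.

Lemma vec_cons d (x : R) (t : d.-tuple R) :
  vec (cons_pair (x, t)) = col_mx x%:M (vec t).
Proof.
apply/colP => i; rewrite mxE; case: (split_ordP (i : 'I_(1 + d))) => j ->.
  by rewrite (col_mxEu x%:M (vec t)) !mxE !ord1 eqxx (tnth_nth 0).
by rewrite (col_mxEd x%:M (vec t)) mxE !(tnth_nth 0).
Qed.

Lemma measurable_cons_vec d (F : 'cV[R]_(1 + d) -> \bar R) :
  measurable_fun setT (F \o @vec R d.+1) ->
  measurable_fun setT (fun p : R * d.-tuple R => F (col_mx p.1%:M (vec p.2))).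
Proof.
move=> mF; rewrite (_ : (fun p => _) = (F \o @vec R d.+1) \o @cons_pair R d).
  by apply: measurableT_comp => //; exact: measurable_cons_pair.
by apply/funext => -[x t] /=; rewrite vec_cons.
Qed.

Lemma int_Rd_product d (F : 'cV[R]_(1 + d) -> \bar R) :
  measurable_fun setT (F \o @vec R d.+1) -> (forall x, (0 <= F x)%E) ->
  @int_Rd R d.+1 F = (\int[mu \x leb R d]_p F (col_mx p.1%:M (vec p.2)))%E.
Proof.
move=> mF F0; rewrite /int_Rd /=.
transitivity (\int[pushforward (mu \x leb R d) (@cons_pair R d)]_t F (vec t))%E.
  by [].
rewrite ge0_integral_pushforward//; last exact: measurable_cons_pair.
rewrite preimage_setT; apply: eq_integral => -[x t] _ /=.
by rewrite vec_cons.
Qed.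

Lemma int_Rd_head_first d (F : 'cV[R]_(1 + d) -> \bar R) :
  measurable_fun setT (F \o @vec R d.+1) -> (forall x, (0 <= F x)%E) ->
  @int_Rd R d.+1 F = (\int[mu]_x int_Rd (fun y : 'cV[R]_d => F (col_mx x%:M y)))%E.
Proof.
move=> mF F0; rewrite int_Rd_product// fubini_tonelli1//.
exact: measurable_cons_vec.
Qed.

Lemma int_Rd_tail_first d (F : 'cV[R]_(1 + d) -> \bar R) :
  measurable_fun setT (F \o @vec R d.+1) -> (forall x, (0 <= F x)%E) ->
  @int_Rd R d.+1 F = int_Rd (fun y : 'cV[R]_d => \int[mu]_x F (col_mx x%:M y))%E.
Proof.
move=> mF F0; rewrite int_Rd_head_first//.
exact: (@fubini_tonelli _ _ _ _ _ mu (leb R d) _ (measurable_cons_vec mF)).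
Qed.

Lemma ge0_int_RdZ d (k : R) (F : 'cV[R]_d -> \bar R) : 0 <= k ->
  measurable_fun setT (F \o @vec R d) -> (forall x, (0 <= F x)%E) ->
  int_Rd (fun x => k%:E * F x)%E = (k%:E * int_Rd F)%E.
Proof. by move=> k0 mF F0; rewrite /int_Rd ge0_integralZl_EFin. Qed.

Lemma eq_int_Rd d (F G : 'cV[R]_d -> \bar R) : F =1 G -> int_Rd F = int_Rd G.
Proof. by move=> /funext ->. Qed.

(** The change of variables formula as a property of the linear part, which is
    stable under products ([scales_mul]) and so can be proved factor by factor. *)
Definition scales d (M : 'M[R]_d) := forall (v : 'cV[R]_d) (F : 'cV[R]_d -> \bar R),
  measurable_fun setT (F \o @vec R d) -> (forall x, (0 <= F x)%E) ->
  int_Rd (fun x => F (M *m x + v)) = (`|\det M|^-1%:E * int_Rd F)%E.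

Lemma scales_mul d (M N : 'M[R]_d) : scales M -> scales N -> scales (M *m N).
Proof.
move=> sM sN v F mF F0.
transitivity (int_Rd (fun x => F (M *m (N *m x + 0) + v))).
  by apply: eq_int_Rd => x; rewrite addr0 mulmxA.
rewrite (sN 0 (fun y => F (M *m y + v)))//; last exact: measurable_affine.
by rewrite sM// muleA -EFinM det_mulmx normrM invfM mulrC.
Qed.

(** Here and below, [col_mx x%:M y] is the point of head [x] and tail [y], and
    both Tonelli orders are used: [scales_lower] integrates the tail first,
    [scales_upper] the head. *)
Lemma measurable_section_tail d (F : 'cV[R]_(1 + d) -> \bar R) (x : R) :
  measurable_fun setT (F \o @vec R d.+1) ->
  measurable_fun setT ((fun y : 'cV[R]_d => F (col_mx x%:M y)) \o @vec R d).
Proof.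
move=> /measurable_cons_vec mF.
exact: (measurableT_comp mF (measurable_pair1 x)).
Qed.

Lemma measurable_section_head d (F : 'cV[R]_(1 + d) -> \bar R) (y : 'cV[R]_d) :
  measurable_fun setT (F \o @vec R d.+1) ->
  measurable_fun setT (fun x : R => F (col_mx x%:M y)).
Proof.
move=> /measurable_cons_vec mF.
have := measurableT_comp mF (measurable_pair2 (unvec y)).
by congr measurable_fun; apply/funext => x /=; rewrite vecK.
Qed.

Lemma measurable_int_head d (F : 'cV[R]_(1 + d) -> \bar R) :
  measurable_fun setT (F \o @vec R d.+1) -> (forall x, (0 <= F x)%E) ->
  measurable_fun setT ((fun y : 'cV[R]_d => \int[mu]_x F (col_mx x%:M y))%E \o @vec R d).
Proof.
move=> /measurable_cons_vec mF F0.
exact: (@measurable_fun_fubini_tonelli_G _ _ _ _ _ mu _ mF (fun p => F0 _)).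
Qed.

Lemma measurable_int_tail d (F : 'cV[R]_(1 + d) -> \bar R) :
  measurable_fun setT (F \o @vec R d.+1) -> (forall x, (0 <= F x)%E) ->
  measurable_fun setT (fun x : R => int_Rd (fun y : 'cV[R]_d => F (col_mx x%:M y))).
Proof.
move=> /measurable_cons_vec mF F0.
exact: (@measurable_fun_fubini_tonelli_F _ _ _ _ _ (leb R d) _ mF (fun p => F0 _)).
Qed.

(** For a fixed head, the map is affine in the tail, of linear part [M]. *)
Lemma scales_lower d (a : R) (c : 'cV[R]_d) (M : 'M[R]_d) : a != 0 -> scales M ->
  @scales (1 + d) (block_mx a%:M 0 c M).
Proof.
move=> a0 sM v F mF F0.
rewrite -[v]vsubmxK; set p := usubmx v; set q := dsubmx v.
rewrite int_Rd_head_first//; last exact: measurable_affine.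
under eq_integral => x _.
  under eq_int_Rd => y.
    rewrite mul_block_col add_col_mx mul0mx addr0 -scalar_mxM [p]mx11_scalar -raddfD /=.
    rewrite [c *m _ + _]addrC -addrA.
    over.
  rewrite (sM _ (fun y => F (col_mx (a * x + p 0 0)%:M y)))//; last first.
    exact: measurable_section_tail.
  over.
rewrite ge0_integralZl_EFin//; last 2 first.
- by move=> x _; exact: integral_ge0.
- apply: (measurableT_comp (measurable_int_tail mF F0) (g := fun x : R => a * x + p 0 0)).
  by apply: measurable_realfun.measurable_funD => //; exact: mulrl_measurable.
rewrite (ge0_integral_affine _ a0 (measurable_int_tail mF F0)); last first.
  by move=> x; exact: integral_ge0.
rewrite -int_Rd_head_first// muleA -EFinM -invfM -normrM.
by rewrite det_lblock det_scalar1 mulrC.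
Qed.

(** For a fixed tail, the map is affine in the head, of slope [a]. *)
Lemma scales_upper d (a : R) (w : 'rV[R]_d) (M : 'M[R]_d) : a != 0 -> scales M ->
  @scales (1 + d) (block_mx a%:M w 0 M).
Proof.
move=> a0 sM v F mF F0.
rewrite -[v]vsubmxK; set p := usubmx v; set q := dsubmx v.
rewrite int_Rd_tail_first//; last exact: measurable_affine.
under eq_int_Rd => y.
  under eq_integral => x _.
    rewrite mul_block_col add_col_mx mul0mx add0r -scalar_mxM -addrA.
    rewrite [w *m y + p]mx11_scalar -raddfD /=.
    over.
  rewrite (ge0_integral_affine _ a0 (measurable_section_head (M *m y + q) mF))//.
  over.
have mG := measurable_int_head mF F0.
have G0 y : (0 <= \int[mu]_x F (col_mx x%:M y))%E by exact: integral_ge0.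
rewrite ge0_int_RdZ//; last first.
  exact: (measurable_affine (F := fun y => \int[mu]_x F (col_mx x%:M y))%E).
rewrite (sM q (fun y => \int[mu]_x F (col_mx x%:M y))%E)//.
rewrite -int_Rd_tail_first// muleA -EFinM -invfM -normrM.
by rewrite det_ublock det_scalar1.
Qed.

(** A shear makes the corner entry nonzero; the matrix then factors as a lower
    triangular shear times a block upper triangular matrix whose lower block is
    the Schur complement. *)
Lemma unitmx_scales d (M : 'M[R]_d) : M \in unitmx -> scales M.
Proof.
elim: d M => [M _ v F mF F0|d IHd M].
  rewrite det_mx00 normr1 invr1 mul1e; apply: eq_int_Rd => x; congr F.
  by rewrite [LHS]flatmx0 [RHS]flatmx0.
have id_scales : @scales d 1%:M by apply: IHd; exact: unitmx1.
have corner (N : 'M[R]_(1 + d)) : N 0 0 != 0 -> N \in unitmx -> @scales (1 + d) N.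
  move=> N00 uN; pose a := N 0 0; pose w : 'rV[R]_d := ursubmx N.
  pose c : 'cV[R]_d := a^-1 *: dlsubmx N.
  pose S : 'M[R]_d := drsubmx N - c *m w.
  have ulE : ulsubmx N = a%:M.
    by rewrite [LHS]mx11_scalar !mxE; congr (N _ _)%:M; apply/val_inj.
  have NE : N = block_mx 1%:M 0 c 1%:M *m block_mx a%:M w 0 S.
    rewrite mulmx_block !mul1mx !mul0mx !addr0 mul_mx_scalar addrC addrNK.
    by rewrite {1}/c scalerA divff// scale1r -ulE submxK.
  have uS : S \in unitmx.
    move: uN; rewrite NE unitmx_mul => /andP[_].
    by rewrite !unitmxE det_ublock unitrM => /andP[].
  rewrite NE; apply: scales_mul; first by apply: scales_lower => //; exact: oner_neq0.
  by apply: scales_upper => //; exact: IHd.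
move=> uM; have [M00|M00] := eqVneq (M 0 0) 0; last exact: corner.
have [i Mi0] : exists i : 'I_d, (dlsubmx (M : 'M[R]_(1 + d)) : 'cV[R]_d) i 0 != 0.
  apply/existsP; apply: contraT; rewrite negb_exists => /forallP M0.
  pose N : 'M[R]_(1 + d) := M.
  have dl0 : dlsubmx N = 0 by apply/colP => i; move: (M0 i); rewrite negbK => /eqP ->; rewrite mxE.
  have ul0 : ulsubmx N = 0.
    rewrite [LHS]mx11_scalar !mxE (_ : N _ _ = 0) ?raddf0// -[RHS]M00.
    by congr (M _ _); apply/val_inj.
  have : \det N = 0 by rewrite -(submxK N) dl0 ul0 det_ublock det0 mul0r.
  by move: uM; rewrite unitmxE => + N0; rewrite [\det M]N0 unitr0.
pose T s : 'M[R]_(1 + d) := block_mx 1%:M (s *: delta_mx 0 i) 0 1%:M.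
have TK : T (-1) *m T 1 = 1%:M.
  rewrite mulmx_block !mul1mx !mul0mx !mulmx0 !mulmx1 !addr0 add0r.
  by rewrite -scalerDl subrr scale0r -scalar_mx_block.
have uT s : T s \in unitmx by rewrite unitmxE det_ublock !det1 mulr1 unitr1.
rewrite -[M]mul1mx -TK -mulmxA; apply: scales_mul.
  by apply: scales_upper => //; exact: oner_neq0.
apply: corner; last by rewrite unitmx_mul uT.
suff -> : (T 1 *m M) 0 0 = (dlsubmx (M : 'M[R]_(1 + d)) : 'cV[R]_d) i 0 by [].
pose N : 'M[R]_(1 + d) := M.
have NE : T 1 *m N = block_mx (ulsubmx N + delta_mx 0 i *m dlsubmx N)
    (ursubmx N + delta_mx 0 i *m drsubmx N) (dlsubmx N) (drsubmx N).
  by rewrite -{1}(submxK N) mulmx_block scale1r !mul1mx !mul0mx !add0r.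
transitivity (ulsubmx (T 1 *m N) 0 0).
  by rewrite [RHS]mxE [RHS]mxE; congr ((T 1 *m N) _ _); apply/val_inj.
rewrite NE block_mxKul mxE -rowE [X in _ + X]mxE.
rewrite [X in X + _](_ : _ = 0) ?add0r// -[RHS]M00 !mxE.
by congr (M _ _); apply/val_inj.
Qed.

Lemma ge0_int_Rd_affine d (M : 'M[R]_d) (v : 'cV[R]_d) (F : 'cV[R]_d -> \bar R) :
  M \in unitmx -> measurable_fun setT (F \o @vec R d) -> (forall x, (0 <= F x)%E) ->
  int_Rd (fun x => `|\det M|%:E * F (M *m x + v)%R)%E = int_Rd F.
Proof.
move=> uM mF F0; rewrite ge0_int_RdZ//; last exact: measurable_affine.
rewrite (unitmx_scales uM)// muleA -EFinM divff ?mul1e//.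
by rewrite normr_eq0 -unitfE -unitmxE.
Qed.

Lemma int_Rd_affine d (M : 'M[R]_d) (v : 'cV[R]_d) (F : 'cV[R]_d -> R) :
  M \in unitmx -> measurable_fun setT (F \o @vec R d) ->
  int_Rd (fun x => (`|\det M| * F (M *m x + v))%:E) = int_Rd (EFin \o F).
Proof.
move=> uM mF; have mF' : measurable_fun setT (EFin \o (F \o @vec R d)).
  exact/measurable_EFinP.
have posE (x : R) : maxe (`|\det M| * x)%:E 0%E = (`|\det M|%:E * maxe x%:E 0)%E.
  by rewrite maxe_pMr// mule0 EFinM.
rewrite /int_Rd integralE [RHS]integralE; congr (_ - _)%E.
  transitivity (int_Rd (fun x => maxe (F x)%:E 0%E)); last first.
    by apply: eq_integral => t _; rewrite funeposE.
  rewrite -(ge0_int_Rd_affine v uM).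
  - by apply: eq_integral => t _; rewrite funeposE posE.
  - by have := measurable_funepos mF'; congr measurable_fun; apply/funext => t; rewrite funeposE.
  - by move=> x; rewrite le_max lexx orbT.
transitivity (int_Rd (fun x => maxe (- (F x)%:E)%E 0%E)); last first.
  by apply: eq_integral => t _; rewrite funenegE.
rewrite -(ge0_int_Rd_affine v uM).
- apply: eq_integral => t _.
  by rewrite funenegE -EFinN -mulrN posE.
- by have := measurable_funeneg mF'; congr measurable_fun; apply/funext => t; rewrite funenegE.
- by move=> x; rewrite le_max lexx orbT.
Qed.

End euclidean_integral.

(** * Partial derivatives and smooth functions *)

Section continuous_measurable.
Context (R : realType) (d : nat).

(** An open set is the union of the cubes of rational center and inverse integer
    radius that it contains, and these are countably many. *)
Lemma measurable_open_vec (U : set 'cV[R]_d) : open U -> measurable (@vec R d @^-1` U).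
Proof.
move=> oU.
pose box (p : d.-tuple rat * nat) : set 'cV[R]_d :=
  [set x | forall i, `|x i 0 - ratr (tnth p.1 i)| < p.2.+1%:R^-1].
have mbox p : measurable (@vec R d @^-1` box p).
  rewrite (_ : _ @^-1` _ = \bigcap_(i in [set: 'I_d])
      [set t : d.-tuple R | `|tnth t i - ratr (tnth p.1 i)| < p.2.+1%:R^-1]); last first.
    apply/seteqP; split=> [t /= bt i _|t /= bt i]; first by have := bt i; rewrite mxE.
    by rewrite mxE; exact: bt.
  apply: fin_bigcap_measurable => // i _.
  rewrite -[X in measurable X]setTI.
  apply: (measurable_fun_ltr (f := fun t : d.-tuple R => `|tnth t i - ratr (tnth p.1 i)|)) => //.
  apply: measurableT_comp => //; apply: measurable_funB => //; exact: measurable_tnth.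
rewrite (_ : _ @^-1` _ = \bigcup_p (if `[< box p `<=` U >] then @vec R d @^-1` box p else set0)).
  apply: countable_bigcupT_measurable; first exact: countableP.
  by move=> p; case: ifP.
apply/seteqP; split=> [t /= Ut|t [p _]]; last first.
  by case: asboolP => // pU /pU.
have /nbhs_ballP[e /= e0 eU] : nbhs (vec t) U by exact: open_nbhs_nbhs.
have e20 : 0 < e / 2 by rewrite divr_gt0.
have [n ne] : exists n : nat, n.+1%:R^-1 < e / 2.
  have [n _ /(_ n)] := near_infty_natSinv_lt (PosNum e20).
  by move=> /(_ (leqnn n)) ne; exists n.
have q_ex (i : 'I_d) : exists q : rat, `|vec t i 0 - ratr q| < n.+1%:R^-1.
  have [|q] := @rat_in_itvoo R (vec t i 0 - n.+1%:R^-1) (vec t i 0 + n.+1%:R^-1).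
    by rewrite ltrBlDr -addrA ltrDl addr_gt0 // invr_gt0.
  by rewrite in_itv /= => qi; exists q; rewrite distrC ltr_distl.
have [q qP] := choice q_ex.
exists ([tuple q i | i < d], n) => //=.
case: asboolP => [_ i|]; first by rewrite tnth_mktuple.
case=> y /= boxy; apply: eU; split => // i j.
rewrite (ord1 j) /ball /=; apply: (le_lt_trans (ler_distD (ratr (q i)) _ _)).
rewrite (splitr e) ltrD//; first exact: lt_trans (qP i) _.
by rewrite distrC; apply: lt_trans ne; have := boxy i; rewrite tnth_mktuple.
Qed.

Lemma continuous_measurable_vec (f : 'cV[R]_d -> R) :
  continuous f -> measurable_fun setT (f \o @vec R d).
Proof.
move=> cf; apply: (measurability _ (RGenOpens.measurableE R)).
move=> _ [_ [a [b ->] <-]]; rewrite setTI comp_preimage.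
apply: measurable_open_vec; move/continuousP : cf; apply.
exact: interval_open.
Qed.

End continuous_measurable.

Section partial_derivatives.
Context (R : realType) (d : nat).
Local Notation V := 'cV[R]_d.
Implicit Types (f g : V -> R) (x v : V).

Lemma differentiable_sumf n (h : 'I_n -> V -> R) x :
  (forall k, differentiable (h k) x) -> differentiable (fun y => \sum_k h k y) x.
Proof.
move=> dh; rewrite (_ : (fun y => _) = \sum_k h k); first exact: differentiable_sum.
by apply/funext => y; rewrite fct_sumE.
Qed.

Lemma derive_partial f x v : differentiable f x ->
  'D_v f x = \sum_i v i 0 * partial i f x.
Proof.
move=> df; rewrite deriveE// {1}[v](_ : _ = \sum_i v i 0 *: delta_mx i 0); last first.
  apply/colP => i; rewrite summxE (bigD1 i)//= big1 ?addr0 => [|j ji].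
    by rewrite !mxE !eqxx mulr1.
  by rewrite !mxE eq_sym (negbTE ji) mulr0.
rewrite linear_sum; apply: eq_bigr => i _.
by rewrite linearZ /partial deriveE.
Qed.

Lemma partial_cst i (c : R) x : partial i (fun=> c) x = 0.
Proof. exact: derive_cst. Qed.

Lemma partial_coord i j x : partial i (fun y : V => y j 0) x = (i == j)%:R.
Proof.
have := derive_mx (@derivable_id R V x (delta_mx i 0)).
rewrite derive_id => /matrixP/(_ j 0); rewrite !mxE /partial => <-.
by rewrite eqxx andbT eq_sym.
Qed.

Lemma partialD i f g x : differentiable f x -> differentiable g x ->
  partial i (fun y => f y + g y) x = partial i f x + partial i g x.
Proof. by move=> df dg; rewrite /partial deriveD//; exact: diff_derivable. Qed.

Lemma partialB i f g x : differentiable f x -> differentiable g x ->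
  partial i (fun y => f y - g y) x = partial i f x - partial i g x.
Proof. by move=> df dg; rewrite /partial deriveB//; exact: diff_derivable. Qed.

Lemma partialM i f g x : differentiable f x -> differentiable g x ->
  partial i (fun y => f y * g y) x = f x * partial i g x + g x * partial i f x.
Proof. by move=> df dg; rewrite /partial deriveM//; exact: diff_derivable. Qed.

Lemma partialZ i (c : R) f x : differentiable f x ->
  partial i (fun y => c * f y) x = c * partial i f x.
Proof. by move=> df; rewrite partialM// partial_cst mulr0 addr0. Qed.

Lemma partial_sum i n (h : 'I_n -> V -> R) x : (forall k, differentiable (h k) x) ->
  partial i (fun y => \sum_k h k y) x = \sum_k partial i (h k) x.
Proof.
move=> dh; rewrite /partial -derive_sum; last by move=> k; exact: diff_derivable.
by congr ('D_ _ _ _); apply/funext => y; rewrite fct_sumE.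
Qed.

Lemma continuous_affine m n (M : 'M[R]_(m, n)) (v : 'cV[R]_m) :
  continuous (fun x : 'cV[R]_n => M *m x + v).
Proof.
move=> x; apply: (@cvg_mx_entry _ _ (nbhs x)) => i j; rewrite !mxE.
under eq_cvg do rewrite !mxE.
apply: cvgD; last exact: cvg_cst.
apply: cvg_sum_ord => k; apply: cvgMl_tmp; exact: coord_continuous.
Qed.

Lemma differentiable_affine m n (M : 'M[R]_(m, n)) (v : 'cV[R]_m) (x : 'cV[R]_n) :
  differentiable (fun y : 'cV[R]_n => M *m y + v) x.
Proof.
apply: (@differentiableD _ _ _ (fun y => M *m y) (fun=> v)) => //.
apply: (@linear_differentiable _ _ _ (mulmx M)).
have /= := @continuous_affine m n M 0.
by under eq_fun do rewrite addr0.
Qed.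

(** Directional derivatives commute with affine maps already at the level of
    difference quotients. *)
Lemma derive_affine (f : V -> R) n (M : 'M[R]_(d, n)) v (x w : 'cV[R]_n) :
  'D_w (fun y => f (M *m y + v)) x = 'D_(M *m w) f (M *m x + v).
Proof.
rewrite /derive.
under [in LHS]eq_fun do rewrite /= mulmxDr -scalemxAr -addrA.
by [].
Qed.

Lemma partial_affine i f (M : 'M[R]_d) v x : differentiable f (M *m x + v) ->
  partial i (fun y => f (M *m y + v)) x = \sum_j M j i * partial j f (M *m x + v).
Proof.
move=> df; rewrite /partial derive_affine derive_partial//.
by apply: eq_bigr => j _; rewrite -colE mxE.
Qed.

(** Grading smoothness by the order of differentiation makes closure under
    products and affine substitutions an induction on that order. *)
Fixpoint Ck n f : Prop :=
  (forall x, differentiable f x) /\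
  (if n is n'.+1 then forall i, Ck n' (partial i f) else True).

Lemma smoothP f : smooth f <-> forall n, Ck n f.
Proof.
split=> [sf n|Cf].
  have : forall s, Ck n (foldr (@partial R d) f s).
    elim: n => [|n IHn] s /=; first by split=> // x; exact: sf.
    by split=> [x|i]; [exact: sf|exact: (IHn (i :: s))].
  by move=> /(_ [::]).
have : forall s n, Ck n (foldr (@partial R d) f s).
  by elim=> [|i s IHs] n /=; [exact: Cf|case: (IHs n.+1) => _; exact].
by move=> C s x; case: (C s 0%N).
Qed.

Lemma CkW n f : Ck n.+1 f -> Ck n f.
Proof.
elim: n f => [|n IHn] f /= [df Cf]; first by split.
by split=> // i; apply: IHn; exact: Cf.
Qed.

Lemma Ck_differentiable n f x : Ck n f -> differentiable f x.
Proof. by case: n => [|n] []. Qed.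

Lemma Ck_cst n c : Ck n (fun=> c).
Proof.
elim: n c => [|n IHn] c /=; split=> // i.
by rewrite (_ : partial i _ = fun=> 0)//; apply/funext => x; rewrite partial_cst.
Qed.

Lemma Ck_coord n j : Ck n (fun y : V => y j 0).
Proof.
have dc (x : V) : differentiable (fun y : V => y j 0) x by exact: differentiable_coord.
case: n => [|n]; split=> // i.
rewrite (_ : partial i _ = fun=> (i == j)%:R); first exact: Ck_cst.
by apply/funext => x; rewrite partial_coord.
Qed.

Lemma CkD n f g : Ck n f -> Ck n g -> Ck n (fun x => f x + g x).
Proof.
elim: n f g => [|n IHn] f g [df Cf] [dg Cg].
  by split=> // x; exact: differentiableD.
split=> [x|i]; first exact: differentiableD.
rewrite (_ : partial i _ = fun x => partial i f x + partial i g x).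
  by apply: IHn; [exact: Cf|exact: Cg].
by apply/funext => x; rewrite partialD.
Qed.

Lemma CkM n f g : Ck n f -> Ck n g -> Ck n (fun x => f x * g x).
Proof.
elim: n f g => [|n IHn] f g [df Cf] [dg Cg].
  by split=> // x; exact: differentiableM.
split=> [x|i]; first exact: differentiableM.
rewrite (_ : partial i _ = fun x => f x * partial i g x + g x * partial i f x).
  have [Cf' Cg'] := (CkW (conj df Cf), CkW (conj dg Cg)).
  by apply: CkD; apply: IHn => //; [exact: Cg|exact: Cf].
by apply/funext => x; rewrite partialM.
Qed.

Lemma Ck_sum n m (h : 'I_m -> V -> R) :
  (forall k, Ck n (h k)) -> Ck n (fun x => \sum_k h k x).
Proof.
elim: n h => [|n IHn] h Ch.
  by split=> // x; apply: differentiable_sumf => k; case: (Ch k).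
split=> [x|i]; first by apply: differentiable_sumf => k; case: (Ch k).
rewrite (_ : partial i _ = fun x => \sum_k partial i (h k) x).
  by apply: IHn => k; case: (Ch k) => _; exact.
by apply/funext => x; rewrite partial_sum// => k; case: (Ch k).
Qed.

Lemma Ck_affine n f (M : 'M[R]_d) v : Ck n f -> Ck n (fun x => f (M *m x + v)).
Proof.
elim: n f => [|n IHn] f [df Cf].
  split=> // x; apply: (@differentiable_comp _ _ _ _ _ f) => //.
  exact: differentiable_affine.
split=> [x|i].
  by apply: (@differentiable_comp _ _ _ _ _ f) => //; exact: differentiable_affine.
rewrite (_ : partial i _ = fun x => \sum_j M j i * partial j f (M *m x + v)).
  by apply: Ck_sum => j; apply: CkM; [exact: Ck_cst|apply: IHn; exact: Cf].
by apply/funext => x; rewrite partial_affine.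
Qed.

Lemma quad_potentialE B b : quad_potential B b =
  fun y : V => 2^-1 * (\sum_j (\sum_k B k j * y k 0) * y j 0) + \sum_j b j 0 * y j 0.
Proof.
apply/funext => y; rewrite /quad_potential !mxE; congr (_ * _ + _).
  apply: eq_bigr => j _; congr (_ * _); rewrite mxE; apply: eq_bigr => k _.
  by rewrite mxE mulrC.
by apply: eq_bigr => j _; rewrite mxE.
Qed.

Lemma smooth_quad_potential B b : smooth (quad_potential B b : V -> R).
Proof.
apply/smoothP => n; rewrite quad_potentialE; apply: CkD.
  apply: CkM; first exact: Ck_cst.
  apply: Ck_sum => j; apply: CkM; last exact: Ck_coord.
  by apply: Ck_sum => k; apply: CkM; [exact: Ck_cst|exact: Ck_coord].
by apply: Ck_sum => j; apply: CkM; [exact: Ck_cst|exact: Ck_coord].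
Qed.

Lemma grad_quad_potential (B : 'M[R]_d) b x : B^T = B ->
  grad (quad_potential B b) x = B *m x + b.
Proof.
move=> symB; have Bji j k : B j k = B k j by rewrite -{1}symB mxE.
have dc j y : differentiable (fun z : V => z j 0) y by exact: differentiable_coord.
have dl (c : 'I_d -> R) y : differentiable (fun z : V => \sum_k c k * z k 0) y.
  by apply: differentiable_sumf => k; apply: differentiableM.
have pl (c : 'I_d -> R) i y : partial i (fun z : V => \sum_k c k * z k 0) y = c i.
  rewrite partial_sum => [|k]; last exact: differentiableM.
  rewrite (bigD1 i)//= big1 ?addr0 => [|k ki].
    by rewrite partialZ// partial_coord eqxx mulr1.
  by rewrite partialZ// partial_coord eq_sym (negbTE ki) mulr0.
apply/colP => i; rewrite mxE quad_potentialE partialD//; last first.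
  apply: differentiableM => //; apply: differentiable_sumf => j.
  exact: differentiableM.
rewrite partialZ; last by apply: differentiable_sumf => j; exact: differentiableM.
rewrite partial_sum => [|j]; last exact: differentiableM.
rewrite !mxE pl; congr (_ + _).
under eq_bigr do rewrite partialM// partial_coord pl.
rewrite big_split /=.
have -> : \sum_j (\sum_k B k j * x k 0) * (i == j)%:R = \sum_k B i k * x k 0.
  rewrite (bigD1 i)//= eqxx mulr1 [X in _ + X]big1 ?addr0 => [|j ji].
    by apply: eq_bigr => k _; rewrite Bji.
  by rewrite eq_sym (negbTE ji) mulr0.
under [X in _ + X]eq_bigr do rewrite mulrC.
by field.
Qed.

Lemma smooth_differentiable f x : smooth f -> differentiable f x.
Proof. by move=> /(_ [::]); exact. Qed.

Lemma smooth_continuous f : smooth f -> continuous f.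
Proof. by move=> sf x; apply: differentiable_continuous; exact: smooth_differentiable. Qed.

Lemma smooth_partial i f : smooth f -> smooth (partial i f).
Proof. by move=> sf s x; have := sf (rcons s i) x; rewrite foldr_rcons. Qed.

End partial_derivatives.

(** * Integration by parts without boundary terms *)

Section integration_by_parts.
Context (R : realType).

Definition box d (r : R) : set 'cV[R]_d := [set x | forall i, `|x i 0| <= r].

Lemma measurable_box d (r : R) : measurable (@vec R d @^-1` box r).
Proof.
rewrite (_ : _ @^-1` _ = \bigcap_(i in [set: 'I_d])
    [set t : d.-tuple R | `|tnth t i| <= r]); last first.
  apply/seteqP; split=> [t /= bt i _|t /= bt i]; first by have := bt i; rewrite mxE.
  by rewrite mxE; exact: bt.
apply: fin_bigcap_measurable => // i _; rewrite -[X in measurable X]setTI.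
apply: (measurable_fun_ler (f := fun t : d.-tuple R => `|tnth t i|)) => //.
by apply: measurableT_comp => //; exact: measurable_tnth.
Qed.

Lemma leb_box_lty d (r : R) : (leb R d (@vec R d @^-1` box r) < +oo)%E.
Proof.
elim: d => [|d IHd]; first by rewrite /= /lebesgue_tuple0 diracE ltry.
rewrite /= /cons_measure /pushforward.
rewrite (_ : _ @^-1` _ = `[- r, r] `*` (@vec R d @^-1` box r)); last first.
  apply/seteqP; split=> [[x t] /= b|[x t] /= [xr b] i].
    rewrite in_itv /= -ler_norml; split; first by have := b ord0; rewrite mxE.
    by move=> i; have := b (lift ord0 i); rewrite !mxE tnthS.
  rewrite mxE; case: (unliftP ord0 i) => [j ->|->].
    by rewrite tnthS; have := b j; rewrite mxE.
  by rewrite [tnth _ _]/= ler_norml; move: xr; rewrite in_itv.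
rewrite product_measure1E//; last exact: measurable_box.
by rewrite lte_mul_pinfty// ge0_fin_numE//= lebesgue_measure_itv /=; case: ifP; rewrite ?ltry.
Qed.

Lemma continuous_bounded_box d (f : 'cV[R]_d -> R) r : continuous f ->
  exists M : R, 0 <= M /\ forall x, box r x -> `|f x| <= M.
Proof.
move=> cf; have [r0|r0] := ltP r 0.
  (* The box is empty, except in dimension 0, where it is the whole space. *)
  case: d f cf => [|d] f cf.
    by exists `|f 0|; split=> // x _; rewrite (flatmx0 x).
  by exists 0; split=> // x /(_ ord0) /(le_trans (normr_ge0 _)); rewrite leNgt r0.
pose A := [set v : 'rV[R]_d | forall i, `[- r, r]%classic (v ord0 i)].
have A0 : A !=set0.
  by exists 0 => i; rewrite /= mxE in_itv /= oppr_le0 r0.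
have cA : compact A.
  by apply: (rV_compact (A := fun=> `[- r, r]%classic)) => i; exact: segment_compact.
have cT : continuous (fun v : 'rV[R]_d => v^T).
  move=> v; apply: (@cvg_mx_entry _ _ (nbhs v)) => i j; rewrite mxE.
  by under eq_cvg do rewrite mxE; exact: coord_continuous.
have cg : continuous (fun v : 'rV[R]_d => `|f v^T|).
  move=> v; apply: (@continuous_comp _ _ _ _ (@Num.norm _ R)); last exact: norm_continuous.
  by apply: (@continuous_comp _ _ _ (fun v : 'rV[R]_d => v^T)); [exact: cT|exact: cf].
have [c cA' cmax] := EVT_max_rV A0 cA (continuous_subspaceT cg).
exists `|f c^T|; split=> // x bx.
have := cmax x^T; rewrite trmxK; apply.
rewrite inE => i /=; rewrite mxE in_itv /= -ler_norml; exact: bx.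
Qed.

(** Integrability is stated for functions of the column vector, so that the lemmas
    below combine with those on [int_Rd] without mention of tuples. *)
Definition integrable_Rd d (F : 'cV[R]_d -> R) :=
  (leb R d).-integrable setT (fun t => (F (vec t))%:E).

Lemma integrable_Rd_measurable d (F : 'cV[R]_d -> R) : integrable_Rd F ->
  measurable_fun setT (F \o @vec R d).
Proof. by move=> /measurable_int/measurable_EFinP. Qed.

Lemma integrable_RdD d (F G : 'cV[R]_d -> R) : integrable_Rd F -> integrable_Rd G ->
  integrable_Rd (fun x => F x + G x).
Proof. by move=> iF iG; exact: (integrableD measurableT iF iG). Qed.

Lemma integrable_RdZ d c (F : 'cV[R]_d -> R) : integrable_Rd F ->
  integrable_Rd (fun x => c * F x).
Proof. by move=> iF; exact: (integrableZl measurableT c iF). Qed.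

Lemma integrable_Rd_sum d n (F : 'I_n -> 'cV[R]_d -> R) :
  (forall k, integrable_Rd (F k)) -> integrable_Rd (fun x => \sum_k F k x).
Proof.
move=> iF; rewrite /integrable_Rd; under eq_fun do rewrite -sumEFin.
by apply: integrable_sum => // k _; exact: iF.
Qed.

Lemma integrable_Rd_le d (F G : 'cV[R]_d -> R) : measurable_fun setT (F \o @vec R d) ->
  (forall x, `|F x| <= G x) -> integrable_Rd G -> integrable_Rd F.
Proof.
move=> mF FG; apply: le_integrable => //; first exact/measurable_EFinP.
move=> t _; rewrite !abse_EFin lee_fin; apply: le_trans (FG _) _; exact: ler_norm.
Qed.

Lemma int_RdD d (F G : 'cV[R]_d -> R) : integrable_Rd F -> integrable_Rd G ->
  int_Rd (fun x => (F x + G x)%:E) =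
  (int_Rd (EFin \o F) + int_Rd (EFin \o G))%E.
Proof. by move=> iF iG; rewrite /int_Rd integralD_EFin. Qed.

Lemma int_RdZ d c (F : 'cV[R]_d -> R) : integrable_Rd F ->
  int_Rd (fun x => (c * F x)%:E) = (c%:E * int_Rd (EFin \o F))%E.
Proof. by move=> iF; rewrite /int_Rd -integralZl. Qed.

Lemma int_Rd_sum d n (F : 'I_n -> 'cV[R]_d -> R) : (forall k, integrable_Rd (F k)) ->
  int_Rd (fun x => (\sum_k F k x)%:E) = (\sum_k int_Rd (EFin \o F k))%E.
Proof.
move=> iF; rewrite /int_Rd; under eq_integral do rewrite -sumEFin.
by rewrite integral_sum// => k; exact: iF.
Qed.

Lemma int_Rd_fin_num d (F : 'cV[R]_d -> R) : integrable_Rd F ->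
  int_Rd (EFin \o F) \is a fin_num.
Proof. by move=> iF; exact: integrable_fin_num. Qed.

Lemma integrable_Rd_ge0 d (F : 'cV[R]_d -> R) : measurable_fun setT (F \o @vec R d) ->
  (forall x, 0 <= F x) -> (int_Rd (EFin \o F) < +oo)%E -> integrable_Rd F.
Proof.
move=> mF F0 iF; apply/integrableP; split; first exact/measurable_EFinP.
by under eq_integral do rewrite gee0_abs ?lee_fin//.
Qed.

Lemma integrable_Rd_affine d (F : 'cV[R]_d -> R) (M : 'M[R]_d) v : M \in unitmx ->
  integrable_Rd F -> integrable_Rd (fun x => `|\det M| * F (M *m x + v)).
Proof.
move=> uM iF; have mF := integrable_Rd_measurable iF; apply/integrableP; split.
  apply/measurable_EFinP; apply: measurable_realfun.measurable_funM => //.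
  apply/measurable_EFinP.
  by apply: (@measurable_affine _ _ _ (EFin \o F)); exact/measurable_EFinP.
under eq_integral do rewrite abse_EFin normrM normr_id.
have := int_Rd_affine v uM (F := fun x => `|F x|).
rewrite /int_Rd => ->; last exact: measurableT_comp.
by case/integrableP : iF.
Qed.

Lemma integrable_Rd_box d (F : 'cV[R]_d -> R) (M r : R) :
  measurable_fun setT (F \o @vec R d) ->
  (forall x, `|F x| <= M * \1_(box r) x) -> integrable_Rd F.
Proof.
move=> mF FM; apply: (integrable_Rd_le mF FM).
apply: (@integrable_RdZ _ M (fun x => \1_(box r) x)).
apply/integrableP; split.
  apply/measurable_EFinP.
  exact: (measurable_indic (measurable_box r)).
rewrite (eq_integral (fun t => (\1_(@vec R d @^-1` box r) t)%:E)); last first.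
  by move=> t _; rewrite gee0_abs// lee_fin.
by rewrite integral_indic ?setIT//; [exact: leb_box_lty|exact: measurable_box].
Qed.

Lemma derive_line d (F : 'cV[R]_d -> R) (x e : 'cV[R]_d) (s : R) :
  differentiable F (x + s *: e) ->
  is_derive s 1 (fun s => F (x + s *: e)) ('D_e F (x + s *: e)).
Proof.
move=> dF; have dFe : derivable F (x + s *: e) e by exact: diff_derivable.
have E : (fun h : R => h^-1 *: (((fun s => F (x + s *: e)) \o shift s) (h *: 1) - F (x + s *: e)))
       = (fun h : R => h^-1 *: ((F \o shift (x + s *: e)) (h *: e) - F (x + s *: e))).
  apply/funext => h /=; congr (_ *: (F _ - _)).
  by rewrite [h *: 1]mulr1 scalerDl addrCA addrA.
by apply: DeriveDef; rewrite /derivable /derive E.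
Qed.

(** Dominated convergence for the difference quotients
    [n * (F (x + e / n) - F x)], all of integral zero by translation invariance. *)
Lemma int_Rd_partial_eq0 d (F : 'cV[R]_d -> R) (i : 'I_d) r :
  (forall x, differentiable F x) -> continuous (partial i F) ->
  (forall x, ~ box r x -> F x = 0) ->
  int_Rd (EFin \o partial i F) = 0%E.
Proof.
move=> dF cF F0; pose e : 'cV[R]_d := delta_mx i 0.
have contF : continuous F by move=> x; exact: differentiable_continuous.
have [M [M0 leM]] := continuous_bounded_box (r + 1 + 1) cF.
have mF : measurable_fun setT (F \o @vec R d) by exact: continuous_measurable_vec.
have e_le j : `|e j 0| <= 1 by rewrite mxE; case: (_ && _); rewrite ?normr1 ?normr0.
have box_step (x : 'cV[R]_d) (r' s : R) : 0 <= s <= 1 -> box r' x -> box (r' + 1) (x + s *: e).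
  move=> /andP[s0 s1] bx j; rewrite mxE (le_trans (ler_normD _ _))// lerD//.
  by rewrite mxE normrM (ger0_norm s0) -[leRHS]mulr1 ler_pM// e_le.
have box_unstep (x : 'cV[R]_d) (s : R) : 0 <= s <= 1 -> ~ box (r + 1) x -> ~ box r (x + s *: e).
  move=> s01 nbx bx; apply: nbx => j; rewrite -[x j 0](addrK (s * e j 0)).
  rewrite (le_trans (ler_normB _ _))// lerD//; first by have := bx j; rewrite mxE [(s *: e) j 0]mxE.
  case/andP : s01 => s0 s1.
  by rewrite normrM (ger0_norm s0) -[leRHS]mulr1 ler_pM// e_le.
have segment (x : 'cV[R]_d) (h : R) : 0 <= h ->
    exists2 s : R, 0 <= s <= h & F (x + h *: e) - F x = partial i F (x + s *: e) * h.
  move=> h0.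
  have dphi (s : R) : is_derive s 1 (fun s => F (x + s *: e)) (partial i F (x + s *: e)).
    exact: derive_line.
  have [|s] := @MVT_segment R _ _ 0 h h0 (fun s _ => dphi s).
    by apply: derivable_within_continuous => s _; case: (dphi s).
  by rewrite in_itv /= scale0r addr0 subr0 => sh E; exists s.
have inv01 n : 0 <= (n.+1%:R^-1 : R) <= 1.
  by rewrite invr_ge0 ler0n invf_le1 ?ltr0n// ler1n.
pose f_ n (t : d.-tuple R) := (n.+1%:R * (F (vec t + n.+1%:R^-1 *: e) - F (vec t)))%:E.
have [N [N0 leN]] := continuous_bounded_box r contF.
have int_F : integrable_Rd F.
  apply: (@integrable_Rd_box _ _ N r) => // x; rewrite indicE.
  have [bx|nbx] := pselect (box r x); first by rewrite mem_set// mulr1 leN.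
  by rewrite memNset// mulr0 F0// normr0.
have shiftE v : (fun x : 'cV[R]_d => `|\det (1%:M : 'M[R]_d)| * F (1%:M *m x + v)) = fun x => F (x + v).
  by apply/funext => x; rewrite det1 normr1 mul1r mul1mx.
have int_F_shift v : integrable_Rd (fun x => F (x + v)).
  by rewrite -shiftE; apply: integrable_Rd_affine => //; exact: unitmx1.
have int_f n : (\int[leb R d]_t f_ n t = 0)%E.
  pose h : R := n.+1%:R^-1.
  have iB : integrable_Rd (fun x => F (x + h *: e) + (-1) * F x).
    by apply: integrable_RdD => //; exact: integrable_RdZ.
  transitivity (int_Rd (fun x => (n.+1%:R * (F (x + h *: e) + (-1) * F x))%:E)).
    by apply: eq_integral => t _; rewrite mulN1r.
  rewrite int_RdZ// [X in (_ * X)%E]int_RdD//; last exact: integrable_RdZ.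
  rewrite [X in (_ + X)%E]int_RdZ//.
  have -> : int_Rd (EFin \o fun x => F (x + h *: e)) = int_Rd (EFin \o F).
    rewrite -(int_Rd_affine (h *: e) (unitmx1 R d) (integrable_Rd_measurable int_F)).
    by apply: eq_int_Rd => x; rewrite /= det1 normr1 mul1r mul1mx.
  rewrite -[int_Rd (EFin \o F)](fineK (int_Rd_fin_num int_F)).
  by rewrite -[((-1)%:E * _)%E]EFinM -EFinD mulN1r subrr mule0.
have f_cvg t : f_ n t @[n --> \oo] --> (partial i F (vec t))%:E.
  have dFe : derivable F (vec t) e by exact: diff_derivable.
  apply: cvg_EFin; first exact: nearW.
  have /cvgr_dnbhsP/(_ harmonic) : (h^-1 *: (F (h *: e + vec t) - F (vec t))) @[h --> 0^'] --> partial i F (vec t).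
    exact: dFe.
  move=> /(_ (conj (fun n => lt0r_neq0 (harmonic_gt0 n)) cvg_harmonic)).
  apply: cvg_trans; apply: near_eq_cvg; apply: nearW => n /=.
  by rewrite invrK [_ *: e + _]addrC.
have f_bound n t : (`|f_ n t| <= (M * \1_(@vec R d @^-1` box (r + 1)) t)%:E)%E.
  rewrite /f_ abse_EFin lee_fin indicE.
  have [bx|nbx] := pselect ((@vec R d @^-1` box (r + 1)) t).
    rewrite mem_set// mulr1.
    have /andP[h0 h1] := inv01 n; have [s /andP[s0 sh] ->] := segment (vec t) _ h0.
    rewrite mulrCA mulfV ?mulr1; last by rewrite pnatr_eq0.
    apply: leM; apply: box_step => //; by rewrite s0 (le_trans sh).
  rewrite memNset// mulr0 !F0 ?subrr ?mulr0 ?normr0//.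
    by have := @box_unstep (vec t) 0; rewrite scale0r addr0; apply => //; rewrite lexx ler01.
  exact: box_unstep.
have [] := @dominated_convergence _ _ _ (leb R d) setT measurableT f_
  (fun t => (partial i F (vec t))%:E)
  (fun t => (M * \1_(@vec R d @^-1` box (r + 1)) t)%:E).
- move=> n; apply/measurable_EFinP; apply: measurable_realfun.measurable_funM => //.
  apply: measurable_funB => //.
  exact: (integrable_Rd_measurable (int_F_shift _)).
- by apply/measurable_EFinP; exact: continuous_measurable_vec.
- by apply: aeW => t _; exact: f_cvg.
- apply: (@integrable_Rd_box _ (fun x => M * \1_(box (r + 1)) x) M (r + 1)).
    apply: measurable_realfun.measurable_funM => //.
    exact: (measurable_indic (measurable_box (r + 1))).
  by move=> x; rewrite ger0_norm// mulr_ge0.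
- by apply: aeW => t n _; exact: f_bound.
move=> _ _ C; transitivity (\int[leb R d]_t (partial i F (vec t))%:E)%E => //.
rewrite -(cvg_lim _ C)//.
by rewrite (_ : (fun n => _) = fun=> 0%E) ?lim_cst//; apply/funext => n; rewrite int_f.
Qed.

End integration_by_parts.

(** * A continuously differentiable cutoff *)

Section square_of_positive_part.
Context (R : realType).

(** A [C^1] function that vanishes on the negative half-line; one continuous
    derivative is all that integration by parts requires. *)
Definition pospart_sq (u : R) : R := (Num.max 0 u) ^+ 2.

Lemma is_derive_pospart_sq (u : R) : is_derive u 1 pospart_sq (2 * Num.max 0 u).
Proof.
have [u_lt0|u_gt0|->] := ltgtP u 0.
- rewrite mulr0; apply: (near_eq_is_derive (f := cst 0)).
  near=> v; rewrite /pospart_sq max_l ?expr0n//=; apply/ltW; near: v.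
  exact: lt_nbhsl.
- have D : is_derive u 1 (fun v : R => v ^+ 2) (2 * u).
    apply: DeriveDef; first exact: exprn_derivable.
    by rewrite exp_derive /= expr1 /GRing.scale /= mulr1.
  apply: (near_eq_is_derive (f := fun v : R => v ^+ 2)).
  near=> v; rewrite /pospart_sq max_r//; apply/ltW; near: v.
  exact: lt_nbhsr.
rewrite mulr0.
have C : (h^-1 *: (pospart_sq (h *: 1 + 0) - pospart_sq 0)) @[h --> 0^'] --> (0 : R).
  apply/cvgrPdist_le => e e0; near=> h.
  rewrite addr0 [h *: 1]mulr1 /pospart_sq maxxx expr0n /= subr0 sub0r normrN.
  have h0 : h != 0 by near: h; exact: nbhs_dnbhs_neq.
  have he : `|h| <= e by near: h; exact: dnbhs0_le.
  rewrite normrM normfV normrX expr2 (le_trans _ he)//.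
  rewrite ler_pdivrMl ?normr_gt0//.
  by rewrite ler_pM// ger0_norm ?le_max ?lexx// ge_max normr_ge0 ler_norm.
by apply: DeriveDef; [apply/cvg_ex; exists 0|apply/cvg_lim].
Unshelve. all: by end_near. Qed.

Lemma pospart_sq_bound (u : R) : u <= 1 -> 0 <= pospart_sq u <= 1.
Proof.
move=> u1; rewrite sqr_ge0 /= -[leRHS](expr1n _ 2) lerXn2r ?nnegrE//.
  by rewrite le_max lexx.
by rewrite ge_max ler01 u1.
Qed.

End square_of_positive_part.

Section cutoff.
Context (R : realType) (d : nat).
Local Notation V := 'cV[R]_d.

Lemma sqnormE (x : V) : sqnorm x = \sum_k x k 0 * x k 0.
Proof. by rewrite /sqnorm mxE; apply: eq_bigr => k _; rewrite mxE. Qed.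

Lemma sqr_coord_le (x : V) i : x i 0 ^+ 2 <= sqnorm x.
Proof.
rewrite sqnormE (bigD1 i)//= -expr2 lerDl; apply: sumr_ge0 => k _.
by rewrite -expr2 sqr_ge0.
Qed.

Lemma Ck_sqnorm n : Ck n (@sqnorm R d).
Proof.
have -> : @sqnorm R d = fun x => \sum_k x k 0 * x k 0 by apply/funext => x; exact: sqnormE.
by apply: Ck_sum => k; apply: CkM; exact: Ck_coord.
Qed.

Lemma partial_sqnorm i (x : V) : partial i (@sqnorm R d) x = 2 * x i 0.
Proof.
have -> : @sqnorm R d = fun x => \sum_k x k 0 * x k 0 by apply/funext => y; exact: sqnormE.
have dc k y : differentiable (fun z : V => z k 0) y by exact: differentiable_coord.
rewrite partial_sum => [|k]; last exact: differentiableM.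
rewrite (bigD1 i)//= big1 ?addr0 => [|k ki].
  by rewrite partialM// partial_coord eqxx mulr1 -mulr2n mulr_natl.
by rewrite partialM// partial_coord eq_sym (negbTE ki) mulr0 addr0.
Qed.

Lemma differentiable_comp1 (phi : R -> R) a (f : V -> R) x :
  is_derive (f x) 1 phi a -> differentiable f x ->
  differentiable (fun y => phi (f y)) x.
Proof.
move=> [dphi _] df; apply: (@differentiable_comp _ _ _ _ f phi) => //.
exact/derivable1_diffP.
Qed.

Lemma partial_comp1 i (phi : R -> R) a (f : V -> R) x :
  is_derive (f x) 1 phi a -> differentiable f x ->
  partial i (fun y => phi (f y)) x = a * partial i f x.
Proof.
move=> dphi df; have dc := differentiable_comp1 dphi df.
case: dphi => dphi <-.
rewrite /partial deriveE// (@diff_comp _ _ _ _ f phi)//; last exact/derivable1_diffP.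
by rewrite /= deriv1E// derive1E -deriveE// mulrC.
Qed.

Definition cutoff (N : R) (x : V) : R := pospart_sq (1 - (N ^+ 2)^-1 * sqnorm x).

(** The derivative of [pospart_sq] at the argument of [cutoff]. *)
Definition cutoff' (N : R) (x : V) : R := 2 * Num.max 0 (1 - (N ^+ 2)^-1 * sqnorm x).

Let arg_differentiable N x : differentiable (fun y : V => 1 - (N ^+ 2)^-1 * sqnorm y) x.
Proof.
apply: (@Ck_differentiable _ _ 0).
rewrite (_ : (fun y => _) = fun y => 1 + (- (N ^+ 2)^-1) * sqnorm y).
  by apply: CkD; [exact: Ck_cst|apply: CkM; [exact: Ck_cst|exact: Ck_sqnorm]].
by apply/funext => y; rewrite mulNr.
Qed.

Lemma cutoff_differentiable N x : differentiable (cutoff N) x.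
Proof. exact: (differentiable_comp1 (is_derive_pospart_sq _)). Qed.

Lemma partial_cutoff i N x :
  partial i (cutoff N) x = - (cutoff' N x * ((N ^+ 2)^-1 * (2 * x i 0))).
Proof.
rewrite (partial_comp1 _ (is_derive_pospart_sq _))//.
rewrite partialB//; last first.
  by apply: differentiableM => //; exact: (Ck_differentiable _ (Ck_sqnorm 0)).
rewrite partial_cst sub0r partialZ; last exact: (Ck_differentiable _ (Ck_sqnorm 0)).
by rewrite partial_sqnorm mulrN.
Qed.

Lemma cutoff'_continuous N : continuous (cutoff' N).
Proof.
have -> : cutoff' N = cst 2 \* ((cst 0 : V -> R^o) \max (fun y => 1 - (N ^+ 2)^-1 * sqnorm y)) by [].
move=> x; apply: continuousM; first exact: cst_continuous.
apply: continuous_max; first exact: cst_continuous.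
exact: differentiable_continuous.
Qed.

Lemma cutoff_out N x : 0 < N -> ~ box N x -> cutoff N x = 0 /\ cutoff' N x = 0.
Proof.
move=> N0 /existsNP[i /negP]; rewrite -ltNge => Nx.
have : 1 - (N ^+ 2)^-1 * sqnorm x <= 0.
  rewrite subr_le0 -ler_pdivrMl ?invr_gt0 ?exprn_gt0// invrK mulr1.
  apply: le_trans (sqr_coord_le x i); rewrite -[leRHS]real_normK ?num_real//.
  rewrite lerXn2r// ?nnegrE ?normr_ge0//; exact/ltW.
by move=> u0; rewrite /cutoff /cutoff' /pospart_sq max_l// expr0n mulr0.
Qed.

Lemma cutoff_bound N x : 0 <= cutoff N x <= 1.
Proof.
apply: pospart_sq_bound; rewrite gerBl mulr_ge0// ?invr_ge0 ?sqr_ge0//.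
exact: sqnorm_ge0.
Qed.

(** The factor [cutoff'] confines [x] to the ball of radius [N], where
    [1 + sqnorm x] is at most [2 N^2]; this absorbs the quadratic growth of the
    test function. *)
Lemma partial_cutoff_bound i N x : 1 <= N ->
  (1 + sqnorm x) * `|partial i (cutoff N) x| <= 8 * `|x i 0|.
Proof.
move=> N1; have N0 : 0 < N by exact: lt_le_trans N1.
have N20 : 0 < N ^+ 2 by rewrite exprn_gt0.
have s0 := sqnorm_ge0 x.
rewrite partial_cutoff normrN !normrM /cutoff'.
have [out|inn] := leP (1 - (N ^+ 2)^-1 * sqnorm x) 0.
  by rewrite normr0 mulr0 mul0r mulr0 mulr_ge0.
have sN : sqnorm x <= N ^+ 2.
  by move: inn; rewrite subr_gt0 -ltr_pdivlMl ?invr_gt0// invrK mulr1 => /ltW.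
rewrite [`|2|]ger0_norm// [`|_^-1|]ger0_norm ?invr_ge0 ?(ltW N20)// (ger0_norm (ltW inn)).
have N21 : 1 <= N ^+ 2 by rewrite exprn_ege1.
set c := (N ^+ 2)^-1 in inn *; set s := sqnorm x in s0 sN inn *.
have c0 : 0 <= c by rewrite invr_ge0 ltW.
have c1 : c <= 1 by rewrite invf_le1.
have cs1 : c * s <= 1 by rewrite -subr_ge0 ltW.
have cs0 : 0 <= c * s by rewrite mulr_ge0.
have u0 : 0 <= 1 - c * s by exact: ltW.
have u2 : (1 - c * s) * (c * (1 + s)) <= 1 * 2.
  apply: ler_pM => //; first by rewrite mulr_ge0// addr_ge0.
    by rewrite gerBl.
  by rewrite mulrDr mulr1 -[leRHS]/(1 + 1) lerD.
have -> : (1 + s) * (2 * (1 - c * s) * (c * (2 * `|x i 0|))) =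
    4 * ((1 - c * s) * (c * (1 + s))) * `|x i 0| by ring.
rewrite ler_wpM2r// (_ : 8 = 4 * (1 * 2)) ?ler_wpM2l//; ring.
Qed.

Lemma inv_sqr_cvg0 : (n.+1%:R ^+ 2 : R)^-1 @[n --> \oo] --> (0 : R).
Proof.
rewrite -[X in _ --> X](mulr0 0).
under eq_cvg do rewrite -exprVn expr2.
by apply: cvgM; exact: cvg_harmonic.
Qed.

Lemma cutoff_arg_cvg (x : V) :
  1 - (n.+1%:R ^+ 2)^-1 * sqnorm x @[n --> \oo] --> (1 : R).
Proof.
rewrite -[X in _ --> X]subr0 -[X in _ --> _ - X](mul0r (sqnorm x)).
by apply: cvgB; [exact: cvg_cst|apply: cvgMr_tmp; exact: inv_sqr_cvg0].
Qed.

Lemma cutoff_cvg (x : V) : cutoff n.+1%:R x @[n --> \oo] --> (1 : R).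
Proof.
have E : pospart_sq 1 = 1 :> R by rewrite /pospart_sq max_r ?expr1n.
have c1 : {for 1, continuous (@pospart_sq R)}.
  apply: differentiable_continuous; apply/derivable1_diffP.
  by case: (is_derive_pospart_sq (1 : R)).
by rewrite -[X in _ --> X]E; exact: (continuous_cvg _ c1 (cutoff_arg_cvg x)).
Qed.

Lemma partial_cutoff_cvg i (x : V) : partial i (cutoff n.+1%:R) x @[n --> \oo] --> (0 : R).
Proof.
rewrite -[X in _ --> X]oppr0 -[X in _ --> - X](mulr0 (2 * Num.max 0 1)).
under eq_cvg do rewrite partial_cutoff.
apply: cvgN; apply: cvgM; last first.
  by rewrite -[X in _ --> X](mul0r (2 * x i 0)); apply: cvgMr_tmp; exact: inv_sqr_cvg0.
have c1 : {for 1, continuous ((cst 0 : R -> R^o) \max id)}.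
  by apply: continuous_max; [exact: cst_continuous|].
by apply: cvgMl_tmp; exact: (continuous_cvg _ c1 (cutoff_arg_cvg x)).
Qed.

End cutoff.

(** * The quadratic potential has least energy *)

Section square_integrable.
Context (R : realType) (d : nat) (rho : 'cV[R]_d -> R).
Local Notation V := 'cV[R]_d.
Hypotheses (rho_smooth : smooth rho) (rho_gt0 : forall x, 0 < rho x).

Let rho_continuous : continuous rho. Proof. exact: smooth_continuous. Qed.

(** Square integrability against [rho]; continuity is part of the notion because it
    provides measurability and is stable under all operations used. *)
Definition L2 (a : V -> R) :=
  continuous a /\ integrable_Rd (fun x => rho x * a x ^+ 2).

Lemma continuous_mul (a b : V -> R) : continuous a -> continuous b ->
  continuous (fun x => a x * b x).
Proof. by move=> ca cb x; apply: (continuousM (ca x) (cb x)). Qed.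

Lemma continuous_add (a b : V -> R) : continuous a -> continuous b ->
  continuous (fun x => a x + b x).
Proof. by move=> ca cb x; apply: (continuousD (ca x) (cb x)). Qed.

Lemma continuous_abs (a : V -> R) : continuous a -> continuous (fun x => `|a x|).
Proof. by move=> ca x; exact: (continuous_comp (ca x) (@norm_continuous _ _ _)). Qed.

Lemma L2_abs a : L2 a -> L2 (fun x => `|a x|).
Proof.
move=> [ca ia]; split; first exact: continuous_abs.
by under eq_fun do rewrite -normrX ger0_norm ?sqr_ge0//.
Qed.

Lemma L2_mul a b : L2 a -> L2 b -> integrable_Rd (fun x => rho x * (a x * b x)).
Proof.
move=> [ca ia] [cb ib].
apply: (@integrable_Rd_le _ _ _ (fun x => rho x * a x ^+ 2 + rho x * b x ^+ 2)).
- apply: continuous_measurable_vec; apply: continuous_mul => //.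
  exact: continuous_mul.
- move=> x; rewrite -mulrDr normrM (gtr0_norm (rho_gt0 x)) ler_pM2l//.
  rewrite normrM; have := normr_ge0 (a x); have := normr_ge0 (b x).
  rewrite -[X in _ <= X + _](real_normK (num_real _)) -[X in _ <= _ + X](real_normK (num_real _)).
  by nra.
- exact: integrable_RdD.
Qed.

Lemma L2D a b : L2 a -> L2 b -> L2 (fun x => a x + b x).
Proof.
move=> La Lb; split; first by case: La Lb => ca _ [cb _]; exact: continuous_add.
rewrite (_ : (fun x => _) = (fun x => (rho x * a x ^+ 2 + rho x * b x ^+ 2) +
    2 * (rho x * (a x * b x)))); last by apply/funext => x; ring.
case: (La) (Lb) => _ ia [_ ib]; apply: integrable_RdD; first exact: integrable_RdD.
by apply: integrable_RdZ; exact: L2_mul.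
Qed.

Lemma L2Z c a : L2 a -> L2 (fun x => c * a x).
Proof.
move=> [ca ia]; split.
  by apply: continuous_mul => //; exact: cst_continuous.
rewrite (_ : (fun x => _) = (fun x => c ^+ 2 * (rho x * a x ^+ 2))).
  exact: integrable_RdZ.
by apply/funext => x; ring.
Qed.

Lemma L2_0 : L2 (fun=> 0).
Proof.
split; first exact: cst_continuous.
rewrite (_ : (fun x => _) = fun=> 0); last by apply/funext => x; rewrite expr0n mulr0.
exact: integrable0.
Qed.

Lemma L2_sum n (a : 'I_n -> V -> R) : (forall k, L2 (a k)) -> L2 (fun x => \sum_k a k x).
Proof.
elim: n a => [|n IHn] a La.
  by under eq_fun do rewrite big_ord0; exact: L2_0.
by under eq_fun do rewrite big_ord_recr /=; apply: L2D => //; exact: IHn.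
Qed.

Hypothesis (rho1 : int_Rd (fun x => (rho x)%:E) = 1%E).
Hypothesis (rho2 : finite_second_moment rho).

Lemma integrable_rho : integrable_Rd rho.
Proof.
apply: integrable_Rd_ge0; first exact: continuous_measurable_vec.
- by move=> x; exact: ltW.
- by rewrite [int_Rd _]rho1 ltry.
Qed.

Lemma L2_cst c : L2 (fun=> c).
Proof.
split; first exact: cst_continuous.
under eq_fun do rewrite mulrC.
by apply: integrable_RdZ; exact: integrable_rho.
Qed.

Lemma coord_continuousV i : continuous (fun x : V => x i 0).
Proof. exact: coord_continuous. Qed.

Lemma L2_coord i : L2 (fun x => x i 0).
Proof.
split; first exact: coord_continuousV.
apply: (@integrable_Rd_le _ _ _ (fun x => sqnorm x * rho x)).
- apply: continuous_measurable_vec; apply: continuous_mul => //.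
  by under eq_fun do rewrite expr2; apply: continuous_mul; exact: coord_continuousV.
- move=> x; rewrite normrM (gtr0_norm (rho_gt0 x)) mulrC ler_pM2r//.
  by rewrite ger0_norm ?sqr_ge0// sqr_coord_le.
- apply: integrable_Rd_ge0 => //.
  apply: continuous_measurable_vec; apply: continuous_mul => // x.
  exact: (differentiable_continuous (Ck_differentiable x (Ck_sqnorm R d 0))).
  by move=> x; rewrite mulr_ge0 ?sqnorm_ge0// ltW.
Qed.

Lemma L2_linear (B : 'M[R]_d) b i : L2 (fun x => (B *m x + b) i 0).
Proof.
rewrite (_ : (fun x => _) = fun x : V => (\sum_k B i k * x k 0) + b i 0); last first.
  by apply/funext => x; rewrite !mxE.
by apply: L2D; [apply: L2_sum => k; apply: L2Z; exact: L2_coord|exact: L2_cst].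
Qed.

End square_integrable.

Section dirichlet_principle.
Context (R : realType) (d : nat) (rho : 'cV[R]_d -> R).
Local Notation V := 'cV[R]_d.
Hypotheses (rho_smooth : smooth rho) (rho_gt0 : forall x, 0 < rho x).
Hypothesis (rho1 : int_Rd (fun x => (rho x)%:E) = 1%E).
Hypothesis (rho2 : finite_second_moment rho).
Variable (A : 'M[R]_d).

Lemma quad_potential_growth (B : 'M[R]_d) b : exists K, 0 <= K /\
  forall x : V, `|quad_potential B b x| <= K * (1 + sqnorm x).
Proof.
exists ((\sum_j \sum_k `|B k j|) + \sum_j `|b j 0|); split.
  by rewrite addr_ge0 ?sumr_ge0// => j _; rewrite sumr_ge0.
move=> x; have s0 := sqnorm_ge0 x.
have coord_le k : `|x k 0| <= 1 + sqnorm x.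
  have := sqr_coord_le x k; rewrite -[X in X <= _](real_normK (num_real _)).
  by have := normr_ge0 (x k 0); nra.
have coord2_le k j : `|x k 0| * `|x j 0| <= 1 + sqnorm x.
  have := sqr_coord_le x k; rewrite -[X in X <= _](real_normK (num_real _)).
  have := sqr_coord_le x j; rewrite -[X in X <= _](real_normK (num_real _)).
  by have := normr_ge0 (x k 0); have := normr_ge0 (x j 0); nra.
rewrite quad_potentialE mulrDl (le_trans (ler_normD _ _))// lerD//.
  rewrite normrM ger0_norm ?invr_ge0//.
  have le1 : `|\sum_j (\sum_k B k j * x k 0) * x j 0| <= (\sum_j \sum_k `|B k j|) * (1 + sqnorm x).
    rewrite mulr_suml (le_trans (ler_norm_sum _ _ _))//; apply: ler_sum => j _.
    rewrite normrM mulr_suml.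
    apply: (@le_trans _ _ ((\sum_k `|B k j| * `|x k 0|) * `|x j 0|)).
      rewrite ler_wpM2r// (le_trans (ler_norm_sum _ _ _))//.
      by apply: ler_sum => k _; rewrite normrM.
    rewrite mulr_suml; apply: ler_sum => k _.
    by rewrite -mulrA ler_wpM2l.
  by rewrite (le_trans _ le1)// ler_piMl// invf_le1 ?ler1n ?ltr0n.
rewrite mulr_suml (le_trans (ler_norm_sum _ _ _))//; apply: ler_sum => j _.
by rewrite normrM ler_wpM2l.
Qed.

Variables (B : 'M[R]_d) (b : V) (f : V -> R).
Hypotheses (symB : B^T = B) (f_smooth : smooth f).
Let f0 : V -> R := quad_potential B b.

Let U j (x : V) := rho x * (A *m (grad f x - grad f0 x)) j 0.

Hypothesis divU : forall x, \sum_j partial j (U j) x = 0.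
Hypothesis L2f : forall j, L2 rho (partial j f).

Let f0_smooth : smooth f0. Proof. exact: smooth_quad_potential. Qed.

Let L2f0 j : L2 rho (partial j f0).
Proof.
rewrite (_ : partial j f0 = fun x : V => (B *m x + b) j 0); first exact: L2_linear.
by apply/funext => x; rewrite -grad_quad_potential// mxE.
Qed.

Let UE j : U j = fun x => rho x * (\sum_k A j k * (partial k f x + (-1) * partial k f0 x)).
Proof.
apply/funext => x; rewrite /U mxE; congr (_ * _); apply: eq_bigr => k _.
by rewrite !mxE mulN1r.
Qed.

Let smooth_Ck n (g : V -> R) : smooth g -> Ck n g.
Proof. by move=> /smoothP; exact. Qed.

Let CkU n j : Ck n (U j).
Proof.
rewrite UE; apply: CkM; first exact: smooth_Ck.
apply: Ck_sum => k; apply: CkM; first exact: Ck_cst.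
apply: CkD; first by apply: smooth_Ck; exact: smooth_partial.
apply: CkM; first exact: Ck_cst.
by apply: smooth_Ck; exact: smooth_partial.
Qed.

Let L2V j : L2 rho (fun x => \sum_k A j k * (partial k f x + (-1) * partial k f0 x)).
Proof.
apply: L2_sum => // k; apply: L2Z => //; apply: L2D => //; exact: L2Z.
Qed.

(** [U] is the difference of the fluxes of two potentials with the same tangent
    vector.  Being divergence free, it is orthogonal to the gradient of the
    quadratic potential times a cutoff at distance [n]; the domination [D] below
    is uniform in [n] since the growth of the potential is compensated by the
    decay of the gradient of the cutoff ([partial_cutoff_bound]). *)
Lemma flux_orthogonal :
  integrable_Rd (fun x => \sum_j U j x * partial j f0 x) /\
  int_Rd (fun x => (\sum_j U j x * partial j f0 x)%:E) = 0%E.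
Proof.
have [K [K0 growth]] := quad_potential_growth B b.
pose G n (x : V) := \sum_j U j x * (cutoff n.+1%:R x * partial j f0 x + f0 x * partial j (cutoff n.+1%:R) x).
pose F n j (x : V) := cutoff n.+1%:R x * f0 x * U j x.
pose D (x : V) := \sum_j `|U j x| * (`|partial j f0 x| + 8 * K * `|x j 0|).
have dU j x : differentiable (U j) x by exact: (Ck_differentiable _ (CkU 0 j)).
have df0 x : differentiable f0 x by exact: smooth_differentiable.
have dcut n x : differentiable (cutoff n.+1%:R : V -> R) x by exact: cutoff_differentiable.
have ccut n : continuous (cutoff n.+1%:R : V -> R).
  by move=> x; exact: differentiable_continuous.
have cU j : continuous (U j) by move=> x; exact: differentiable_continuous.
have cf0 : continuous f0 by exact: smooth_continuous.
have cf0' j : continuous (partial j f0).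
  by apply: smooth_continuous; exact: smooth_partial.
have cU' j : continuous (partial j (U j)).
  by move=> x; apply: differentiable_continuous; case: (CkU 1 j) => _ /(_ j) [].
have ccut' n j : continuous (partial j (cutoff n.+1%:R : V -> R)).
  have -> : partial j (cutoff n.+1%:R : V -> R) =
      fun x => (-1) * (cutoff' n.+1%:R x * (((n.+1%:R ^+ 2)^-1 * 2) * x j 0)).
    by apply/funext => x; rewrite partial_cutoff mulN1r -mulrA.
  apply: continuous_mul; first exact: cst_continuous.
  apply: continuous_mul; first exact: cutoff'_continuous.
  by apply: continuous_mul; [exact: cst_continuous|exact: coord_continuousV].
have dpsi n x : differentiable (fun y => cutoff n.+1%:R y * f0 y) x.
  exact: (differentiableM (dcut n x) (df0 x)).
have dF n j x : differentiable (F n j) x by exact: (differentiableM (dpsi n x) (dU j x)).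
have partialF n j x : partial j (F n j) x = cutoff n.+1%:R x * f0 x * partial j (U j) x +
    U j x * (cutoff n.+1%:R x * partial j f0 x + f0 x * partial j (cutoff n.+1%:R) x).
  by rewrite (partialM _ (dpsi n x) (dU j x)) (partialM _ (dcut n x) (df0 x)).
have cF n j : continuous (partial j (F n j)).
  rewrite (_ : partial j _ = fun x => cutoff n.+1%:R x * f0 x * partial j (U j) x +
    U j x * (cutoff n.+1%:R x * partial j f0 x + f0 x * partial j (cutoff n.+1%:R) x)).
    apply: continuous_add.
      by apply: continuous_mul => //; exact: continuous_mul.
    apply: continuous_mul => //; apply: continuous_add; exact: continuous_mul.
  by apply/funext => x; rewrite partialF.
have n0 n : 0 < n.+1%:R :> R by rewrite ltr0n.
have F_out n j x : ~ box n.+1%:R x -> F n j x = 0.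
  by move=> /(cutoff_out (n0 n)) [c0 _]; rewrite /F c0 !mul0r.
have F'_out n j x : ~ box n.+1%:R x -> partial j (F n j) x = 0.
  move=> /(cutoff_out (n0 n)) [c0 c'0].
  by rewrite partialF partial_cutoff c0 c'0 !mul0r oppr0 mulr0 addr0 mulr0 addr0.
have iF n j : integrable_Rd (partial j (F n j)).
  have [M [M0 leM]] := continuous_bounded_box n.+1%:R (cF n j).
  apply: (@integrable_Rd_box _ _ _ M n.+1%:R); first exact: continuous_measurable_vec.
  move=> x; rewrite indicE; have [bx|nbx] := pselect (box n.+1%:R x).
    by rewrite mem_set// mulr1 leM.
  by rewrite memNset// mulr0 F'_out// normr0.
have GE n x : G n x = \sum_j partial j (F n j) x.
  under eq_bigr do rewrite partialF.
  by rewrite big_split /= -mulr_sumr divU mulr0 add0r.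
have intG n : int_Rd (fun x => (G n x)%:E) = 0%E.
  under eq_int_Rd do rewrite GE.
  rewrite int_Rd_sum// big1// => j _.
  exact: (int_Rd_partial_eq0 (dF n j) (cF n j) (F_out n j)).
have iD : integrable_Rd D.
  apply: integrable_Rd_sum => j.
  rewrite (_ : (fun x => _) = fun x : V => rho x *
      (`|\sum_k A j k * (partial k f x + (-1) * partial k f0 x)| *
       (`|partial j f0 x| + 8 * K * `|x j 0|))); last first.
    by apply/funext => x; rewrite UE normrM (gtr0_norm (rho_gt0 x)) mulrA.
  apply: L2_mul => //; first exact: L2_abs.
  apply: L2D => //; first exact: L2_abs.
  by apply: L2Z => //; apply: L2_abs; exact: L2_coord.
have leD n x : `|G n x| <= D x.
  rewrite (le_trans (ler_norm_sum _ _ _))//; apply: ler_sum => j _.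
  rewrite normrM ler_wpM2l// (le_trans (ler_normD _ _))// lerD// normrM.
    have /andP[c0 c1] := cutoff_bound n.+1%:R x.
    by rewrite (ger0_norm c0) ler_piMl.
  apply: (@le_trans _ _ (K * (1 + sqnorm x) * `|partial j (cutoff n.+1%:R) x|)).
    by rewrite ler_wpM2r// growth.
  rewrite -mulrA [8 * K]mulrC -mulrA ler_wpM2l//.
  by apply: partial_cutoff_bound; rewrite ler1n.
have cvgG x : G n x @[n --> \oo] --> \sum_j U j x * partial j f0 x.
  apply: cvg_sum_ord => j; apply: cvgMl_tmp.
  rewrite -[X in _ --> X]addr0 -[X in _ --> X + _]mul1r -[X in _ --> _ + X](mulr0 (f0 x)).
  apply: cvgD; first by apply: cvgMr_tmp; exact: cutoff_cvg.
  by apply: cvgMl_tmp; exact: partial_cutoff_cvg.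
have mG n : measurable_fun setT (G n \o @vec R d).
  rewrite (_ : G n = fun x => \sum_j partial j (F n j) x); last exact/funext/GE.
  by apply: integrable_Rd_measurable; apply: integrable_Rd_sum.
have mlim : measurable_fun setT ((fun x => \sum_j U j x * partial j f0 x) \o @vec R d).
  by apply: measurable_sum => j; exact: (continuous_measurable_vec (continuous_mul (cU j) (cf0' j))).
have [] := @dominated_convergence _ _ _ (leb R d) setT measurableT
  (fun n t => (G n (vec t))%:E) (fun t => (\sum_j U j (vec t) * partial j f0 (vec t))%:E)
  (fun t => (D (vec t))%:E).
- by move=> n; apply/measurable_EFinP; exact: mG.
- by apply/measurable_EFinP; exact: mlim.
- apply: aeW => t _; apply: cvg_EFin; first exact: nearW.
  exact: cvgG.
- exact: iD.
- by apply: aeW => t n _; rewrite abse_EFin lee_fin.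
move=> ilim _ C; split; first exact: ilim.
transitivity (\int[leb R d]_t (\sum_j U j (vec t) * partial j f0 (vec t))%:E)%E => //.
rewrite -(cvg_lim _ C)//.
by rewrite (_ : (fun n => _) = fun=> 0%E) ?lim_cst//; apply/funext => n; exact: intG.
Qed.

End dirichlet_principle.

Section action_minimality.
Context (R : realType) (d : nat).
Local Notation V := 'cV[R]_d.

Lemma flux_Ck (rho f : V -> R) (A : 'M[R]_d) n j : smooth rho -> smooth f ->
  Ck n (fun y => (rho y *: (A *m grad f y)) j 0).
Proof.
move=> srho sf.
rewrite (_ : (fun y => _) = fun y : V => rho y * (\sum_k A j k * partial k f y)); last first.
  by apply/funext => y; rewrite !mxE; congr (_ * _); apply: eq_bigr => k _; rewrite mxE.
apply: CkM; first by move/smoothP : srho; exact.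
apply: Ck_sum => k; apply: CkM; first exact: Ck_cst.
by have /smoothP := smooth_partial k sf; exact.
Qed.

Lemma continuous_sumf n (h : 'I_n -> V -> R) :
  (forall k, continuous (h k)) -> continuous (fun x => \sum_k h k x).
Proof.
elim: n h => [|n IHn] h ch.
  by under eq_fun do rewrite big_ord0; exact: cst_continuous.
by under eq_fun do rewrite big_ord_recr /=; apply: continuous_add => //; exact: IHn.
Qed.

Lemma mx_formE (A : 'M[R]_d) (v w : V) :
  (v^T *m A *m w) 0 0 = \sum_j \sum_k A k j * (v k 0 * w j 0).
Proof.
rewrite mxE; apply: eq_bigr => j _; rewrite mxE mulr_suml; apply: eq_bigr => k _.
by rewrite mxE; ring.
Qed.

Lemma mx_form_add (A : 'M[R]_d) (v w : V) : A^T = A ->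
  ((w + v)^T *m A *m (w + v)) 0 0 =
  (w^T *m A *m w) 0 0 + 2 * (w^T *m A *m v) 0 0 + (v^T *m A *m v) 0 0.
Proof.
move=> symA.
have symvw : (v^T *m A *m w) 0 0 = (w^T *m A *m v) 0 0.
  transitivity ((v^T *m A *m w)^T 0 0); first by rewrite [RHS]mxE.
  by rewrite !trmx_mul trmxK symA mulmxA.
have addE (M N : 'M[R]_1) : (M + N) 0 0 = M 0 0 + N 0 0 by rewrite mxE.
rewrite [(w + v)^T]raddfD /= 2!mulmxDl !mulmxDr !addE symvw; ring.
Qed.

(** Write [grad f = w + v] with [w] the gradient of the quadratic potential.  The
    cross term of [q f = q f0 + 2 G + q v] integrates to zero by
    [flux_orthogonal], and the last term is nonnegative. *)
Lemma sqnorm_KW_min (lam : R) (rho f : V -> R) (B : 'M[R]_d) b :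
  0 < lam -> smooth_positive_density rho -> finite_second_moment rho ->
  sym_possemidef (cov rho) -> B^T = B -> smooth f ->
  (forall x, phi_KW lam rho f x = phi_KW lam rho (quad_potential B b) x) ->
  (sqnorm_KW lam rho (quad_potential B b) <= sqnorm_KW lam rho f)%E.
Proof.
move=> lam0 [srho rho0 rho1] rho2 [sC pC] symB sf phiE.
set f0 := quad_potential B b; pose A := cov rho + lam%:M.
have sf0 : smooth f0 by exact: smooth_quad_potential.
have symA : A^T = A by rewrite linearD /= sC tr_scalar_mx.
have coercive (v : V) : lam * sqnorm v <= (v^T *m A *m v) 0 0.
  rewrite mulmxDr mulmxDl [leRHS]mxE mul_mx_scalar -scalemxAl [X in _ + X]mxE.
  by rewrite lerDr pC.
have q0 (v : V) : 0 <= (v^T *m A *m v) 0 0.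
  by apply: le_trans (coercive v); rewrite mulr_ge0 ?sqnorm_ge0// ltW.
pose q (g : V -> R) (x : V) := ((grad g x)^T *m A *m grad g x) 0 0 * rho x.
have [->|fin] := eqVneq (sqnorm_KW lam rho f) +oo%E; first exact: leey.
have cgrad g : smooth g -> forall k, continuous (partial k g).
  by move=> sg k; apply: smooth_continuous; exact: smooth_partial.
have crho : continuous rho by exact: smooth_continuous.
have qE g : q g = fun x => \sum_j \sum_k A k j * (rho x * (partial k g x * partial j g x)).
  apply/funext => x; rewrite /q mx_formE mulr_suml; apply: eq_bigr => j _.
  by rewrite mulr_suml; apply: eq_bigr => k _; rewrite !mxE; ring.
have cq g : smooth g -> continuous (q g).
  move=> sg; rewrite qE; apply: continuous_sumf => j; apply: continuous_sumf => k.
  apply: continuous_mul; first exact: cst_continuous.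
  by apply: continuous_mul => //; apply: continuous_mul; exact: cgrad.
have iq : integrable_Rd (q f).
  apply: integrable_Rd_ge0; first by apply: continuous_measurable_vec; exact: cq.
    by move=> x; rewrite mulr_ge0// ltW.
  by rewrite ltey.
have L2f j : L2 rho (partial j f).
  split; first exact: cgrad.
  apply: (@integrable_Rd_le _ _ _ (fun x => lam^-1 * q f x)).
  - apply: continuous_measurable_vec; apply: continuous_mul => //.
    by under eq_fun do rewrite expr2; apply: continuous_mul; exact: cgrad.
  - move=> x; rewrite ger0_norm; last by rewrite mulr_ge0 ?sqr_ge0// ltW.
    rewrite ler_pdivlMl// mulrCA mulrC ler_pM2r//.
    apply: le_trans (coercive _); rewrite ler_pM2l//.
    by have := sqr_coord_le (grad f x) j; rewrite mxE.
  - exact: integrable_RdZ.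
have fluxB j x : rho x * (A *m (grad f x - grad f0 x)) j 0 =
    (rho x *: (A *m grad f x)) j 0 - (rho x *: (A *m grad f0 x)) j 0.
  by rewrite mulmxBr [X in _ * X]mxE [X in _ * (_ + X)]mxE mulrBr; congr (_ - _); rewrite [RHS]mxE.
have divU x : \sum_j partial j (fun x => rho x * (A *m (grad f x - grad f0 x)) j 0) x = 0.
  transitivity (phi_KW lam rho f0 x - phi_KW lam rho f x); last by rewrite phiE subrr.
  rewrite /phi_KW opprK addrC -sumrB; apply: eq_bigr => j _.
  rewrite -partialB; last 2 first.
  - exact: (Ck_differentiable _ (flux_Ck _ 0 j srho sf)).
  - exact: (Ck_differentiable _ (flux_Ck _ 0 j srho sf0)).
  by congr partial; apply/funext => y; rewrite fluxB.
have [iG G0] := flux_orthogonal srho rho0 rho1 rho2 symB sf divU L2f.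
have L2f0 j : L2 rho (partial j f0).
  rewrite (_ : partial j f0 = fun x : V => (B *m x + b) j 0); first exact: L2_linear.
  by apply/funext => x; rewrite -grad_quad_potential// mxE.
have iq0 : integrable_Rd (q f0).
  rewrite qE; apply: integrable_Rd_sum => j; apply: integrable_Rd_sum => k.
  by apply: integrable_RdZ; exact: L2_mul.
pose G x := \sum_j (rho x * (A *m (grad f x - grad f0 x)) j 0) * partial j f0 x.
have le_q x : q f0 x + 2 * G x <= q f x.
  pose v := grad f x - grad f0 x; pose w := grad f0 x.
  have GE : G x = (w^T *m A *m v) 0 0 * rho x.
    rewrite -mulmxA [in RHS]mxE mulr_suml; apply: eq_bigr => j _.
    by rewrite [w^T _ _]mxE [w _ _]mxE; ring.
  have -> : q f x = q f0 x + 2 * G x + (v^T *m A *m v) 0 0 * rho x.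
    have fE : grad f x = w + v by rewrite addrC subrK.
    by rewrite GE /q fE mx_form_add// -/w; ring.
  by rewrite lerDl mulr_ge0// ltW.
have iqG : integrable_Rd (fun x => q f0 x + 2 * G x).
  by apply: integrable_RdD => //; exact: integrable_RdZ.
have int_qG : int_Rd (fun x => (q f0 x + 2 * G x)%:E) = sqnorm_KW lam rho f0.
  rewrite int_RdD//; last exact: integrable_RdZ.
  by rewrite [X in (_ + X)%E]int_RdZ// [X in (_ * X)%E]G0 mule0 adde0.
rewrite -int_qG; apply: le_integral => // t _.
by rewrite lee_fin; exact: le_q.
Qed.

End action_minimality.

(** * Moments of affine images, radial and elliptic densities *)

Section moments.
Context (R : realType) (d : nat) (rho : 'cV[R]_d -> R).
Local Notation V := 'cV[R]_d.
Hypotheses (rho_dens : smooth_positive_density rho) (rho2 : finite_second_moment rho).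

Let rho_smooth : smooth rho. Proof. by case: rho_dens. Qed.
Let rho_gt0 : forall x, 0 < rho x. Proof. by case: rho_dens. Qed.
Let rho1 : int_Rd (fun x => (rho x)%:E) = 1%E. Proof. by case: rho_dens. Qed.
Let irho : integrable_Rd rho. Proof. exact: integrable_rho. Qed.

Definition centered (k : 'I_d) (x : V) := x k 0 - mean rho k 0.

Lemma L2_integrable a : L2 rho a -> integrable_Rd (fun x => rho x * a x).
Proof.
move=> La; under eq_fun do rewrite -[X in _ * X]mulr1.
by apply: L2_mul => //; exact: L2_cst.
Qed.

Let L2_centered k : L2 rho (centered k).
Proof. by apply: L2D => //; [exact: L2_coord|exact: L2_cst]. Qed.

Lemma int_coord k : int_Rd (fun x => (rho x * x k 0)%:E) = (mean rho k 0)%:E.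
Proof.
rewrite mxE -[LHS]fineK; last by apply: int_Rd_fin_num; apply: L2_integrable; exact: L2_coord.
by congr (fine _)%:E; apply: eq_int_Rd => x; rewrite mulrC.
Qed.

Lemma int_centered k : int_Rd (fun x => (rho x * centered k x)%:E) = 0%E.
Proof.
under eq_int_Rd do rewrite mulrDr [_ * - _]mulrC.
rewrite int_RdD; last 2 first.
- by apply: L2_integrable; exact: L2_coord.
- exact: integrable_RdZ.
rewrite [X in (X + _)%E]int_coord [X in (_ + X)%E]int_RdZ//.
by rewrite [X in (_ * X)%E]rho1 mule1 -EFinD subrr.
Qed.

Lemma int_centered2 k l :
  int_Rd (fun x => (rho x * (centered k x * centered l x))%:E) = (cov rho k l)%:E.
Proof.
rewrite mxE -[LHS]fineK; last by apply: int_Rd_fin_num; exact: L2_mul.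
by congr (fine _)%:E; apply: eq_int_Rd => x; rewrite mulrC.
Qed.

Lemma affine_centered (B : 'M[R]_d) b i x :
  (B *m x + b) i 0 = (\sum_k B i k * centered k x) + (B *m mean rho + b) i 0.
Proof.
rewrite [LHS]mxE [X in _ = _ + X]mxE addrA; congr (_ + _).
rewrite [LHS]mxE [X in _ = _ + X]mxE -big_split; apply: eq_bigr => k _ /=.
by rewrite /centered; ring.
Qed.

Lemma int_affine (B : 'M[R]_d) b i :
  int_Rd (fun x => (rho x * (B *m x + b) i 0)%:E) = ((B *m mean rho + b) i 0)%:E.
Proof.
have E x : rho x * (B *m x + b) i 0 =
    (\sum_k B i k * (rho x * centered k x)) + (B *m mean rho + b) i 0 * rho x.
  rewrite affine_centered mulrDr mulr_sumr; congr (_ + _).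
    by apply: eq_bigr => k _; ring.
  exact: mulrC.
have iC k : integrable_Rd (fun x => B i k * (rho x * centered k x)).
  by apply: integrable_RdZ; exact: L2_integrable.
under eq_int_Rd do rewrite E.
rewrite int_RdD; last 2 first.
- exact: integrable_Rd_sum.
- exact: integrable_RdZ.
rewrite [X in (_ + X)%E]int_RdZ// [X in (_ * X)%E]rho1 mule1.
rewrite [X in (X + _)%E]int_Rd_sum// big1 ?add0e// => k _.
rewrite [LHS]int_RdZ; last exact: L2_integrable.
by rewrite [X in (_ * X)%E]int_centered mule0.
Qed.

Lemma int_affine2 (B B' : 'M[R]_d) b b' i j :
  int_Rd (fun x => (rho x * ((B *m x + b) i 0 * (B' *m x + b') j 0))%:E) =
  ((B *m cov rho *m B'^T) i j +
   (B *m mean rho + b) i 0 * (B' *m mean rho + b') j 0)%:E.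
Proof.
pose beta := (B' *m mean rho + b') j 0; pose alpha := (B *m mean rho + b) i 0.
pose F x := \sum_k \sum_l (B i k * B' j l) * (rho x * (centered k x * centered l x)).
have E x : rho x * ((B *m x + b) i 0 * (B' *m x + b') j 0) =
    F x + alpha * (rho x * (B' *m x + b') j 0) +
    (beta * (rho x * (B *m x + b) i 0) + (- (alpha * beta)) * rho x).
  rewrite (affine_centered B b i x) (affine_centered B' b' j x) -/alpha -/beta.
  have -> : F x = rho x * ((\sum_k B i k * centered k x) * (\sum_l B' j l * centered l x)).
    rewrite mulr_suml mulr_sumr; apply: eq_bigr => k _.
    by rewrite !mulr_sumr; apply: eq_bigr => l _; ring.
  by ring.
under eq_int_Rd do rewrite E.
have iF : integrable_Rd F.
  apply: integrable_Rd_sum => k; apply: integrable_Rd_sum => l.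
  by apply: integrable_RdZ; exact: L2_mul.
have iA C c m : integrable_Rd (fun x => rho x * ((C : 'M[R]_d) *m x + c) m 0).
  by apply: L2_integrable; exact: L2_linear.
have intF : int_Rd (EFin \o F) = ((B *m cov rho *m B'^T) i j)%:E.
  have term k l : int_Rd (fun x => (B i k * B' j l * (rho x * (centered k x * centered l x)))%:E)
      = (B i k * B' j l * cov rho k l)%:E.
    rewrite [LHS]int_RdZ; last exact: L2_mul.
    by rewrite [X in (_ * X)%E]int_centered2 EFinM.
  have iF2 k l : integrable_Rd (fun x => B i k * B' j l * (rho x * (centered k x * centered l x))).
    by apply: integrable_RdZ; exact: L2_mul.
  transitivity (\sum_k \sum_l (B i k * B' j l * cov rho k l)%:E)%E.
    rewrite [LHS]int_Rd_sum => [|k]; last exact: integrable_Rd_sum.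
    apply: eq_bigr => k _; rewrite [LHS]int_Rd_sum//.
    by apply: eq_bigr => l _; exact: term.
  transitivity ((\sum_k \sum_l B i k * B' j l * cov rho k l)%:E).
    by rewrite -sumEFin; apply: eq_bigr => k _; rewrite sumEFin.
  congr EFin; rewrite [RHS]mxE exchange_big /=; apply: eq_bigr => l _.
  rewrite [X in _ = X * _]mxE mulr_suml; apply: eq_bigr => k _.
  by rewrite [X in _ = _ * X]mxE mulrAC.
rewrite int_RdD; last 2 first.
- by apply: integrable_RdD => //; exact: integrable_RdZ.
- by apply: integrable_RdD; exact: integrable_RdZ.
rewrite [X in (X + _)%E]int_RdD//; last exact: integrable_RdZ.
rewrite [X in (_ + X)%E]int_RdD; last 2 first.
- exact: integrable_RdZ.
- exact: integrable_RdZ.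
rewrite intF [X in (_ + X + _)%E]int_RdZ// [X in (_ + (X + _))%E]int_RdZ//.
rewrite [X in (_ + (_ + X))%E]int_RdZ//.
rewrite [X in (_ + _ * X + _)%E]int_affine [X in (_ + (_ * X + _))%E]int_affine.
rewrite [X in (_ + (_ + _ * X))%E]rho1 -!EFinM -!EFinD; congr EFin.
by rewrite -/alpha -/beta; ring.
Qed.

End moments.

Section affine_image.
Context (R : realType) (d : nat) (rho : 'cV[R]_d -> R).
Local Notation V := 'cV[R]_d.
Hypotheses (rho_dens : smooth_positive_density rho) (rho2 : finite_second_moment rho).
Variables (M : 'M[R]_d) (v : V).
Hypothesis uM : M \in unitmx.

Let rho_smooth : smooth rho. Proof. by case: rho_dens. Qed.
Let rho_gt0 : forall x, 0 < rho x. Proof. by case: rho_dens. Qed.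
Let rho1 : int_Rd (fun x => (rho x)%:E) = 1%E. Proof. by case: rho_dens. Qed.

(** The density of [N *m X + w] when [X] has density [rho] and [M = invmx N]. *)
Definition affine_density (x : V) := `|\det M| * rho (M *m x + v).
Let rho' := affine_density.
Let N := invmx M.
Let w := - (N *m v).

Let detM_gt0 : 0 < `|\det M|.
Proof. by rewrite normr_gt0 -unitfE -unitmxE. Qed.

Let backK x : N *m (M *m x + v) + w = x.
Proof. by rewrite mulmxDr mulKmx// addrK. Qed.

(** The defining property of an image density, from which its moments follow. *)
Lemma int_affine_density (F : V -> R) : continuous F ->
  int_Rd (fun x => (F x * rho' x)%:E) =
  int_Rd (fun y => (rho y * F (N *m y + w))%:E).
Proof.
move=> cF; pose G y := rho y * F (N *m y + w).
have cG : continuous G.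
  apply: continuous_mul; first exact: smooth_continuous.
  by move=> y; apply: continuous_comp; [exact: continuous_affine|exact: cF].
rewrite -[RHS](int_Rd_affine v uM (continuous_measurable_vec cG)).
by apply: eq_int_Rd => x; rewrite /G backK /rho' /affine_density; congr EFin; ring.
Qed.

Lemma affine_density_smooth_positive : smooth_positive_density rho'.
Proof.
split.
- apply/smoothP => n; apply: CkM; first exact: Ck_cst.
  by apply: Ck_affine; move/smoothP : rho_smooth; exact.
- by move=> x; rewrite mulr_gt0.
- transitivity (int_Rd (fun x => (1 * rho' x)%:E)).
    by apply: eq_int_Rd => x; rewrite mul1r.
  rewrite (int_affine_density (F := fun=> 1)); last exact: cst_continuous.
  by under eq_int_Rd do rewrite mulr1.
Qed.

Let csq : continuous (@sqnorm R d).
Proof. by move=> x; exact: (differentiable_continuous (Ck_differentiable x (Ck_sqnorm R d 0))). Qed.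

Lemma affine_density_second_moment : finite_second_moment rho'.
Proof.
rewrite /finite_second_moment int_affine_density//.
have i2 : integrable_Rd (fun y => rho y * sqnorm (N *m y + w)).
  under eq_fun do rewrite sqnormE mulr_sumr.
  apply: integrable_Rd_sum => k.
  by apply: L2_mul => //; exact: L2_linear.
by rewrite ltey_eq int_Rd_fin_num.
Qed.

Lemma mean_affine_density : mean rho' = N *m (mean rho - v).
Proof.
rewrite mulmxBr; apply/colP => i; rewrite mxE.
rewrite (int_affine_density (F := fun x => x i 0)); last exact: coord_continuousV.
by rewrite int_affine.
Qed.

Lemma cov_affine_density : cov rho' = N *m cov rho *m N^T.
Proof.
apply/matrixP => i j; rewrite mxE.
rewrite (int_affine_density (F := fun x => (x i 0 - mean rho' i 0) * (x j 0 - mean rho' j 0))); last first.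
  by apply: continuous_mul; apply: continuous_add;
    [exact: coord_continuousV|exact: cst_continuous|exact: coord_continuousV|exact: cst_continuous].
have E k y : (N *m y + w) k 0 - mean rho' k 0 = (N *m y + (w - mean rho')) k 0.
  by rewrite addrA [RHS]mxE [X in _ = _ + X]mxE.
under eq_int_Rd do rewrite !E.
rewrite int_affine2//=.
have Z : N *m mean rho + (w - mean rho') = 0.
  by rewrite mean_affine_density /w mulmxBr; apply/eqP; rewrite addrA subr_eq0.
by rewrite Z [X in _ + X * _]mxE mul0r addr0.
Qed.

End affine_image.

Section radial_density.
Context (R : realType) (d : nat) (g : R -> R).
Local Notation V := 'cV[R]_d.
Let p (y : V) := g (sqnorm y).
Hypotheses (p_dens : smooth_positive_density p) (p2 : finite_second_moment p).
Hypothesis d_gt0 : (0 < d)%N.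

Let p_smooth : smooth p. Proof. by case: p_dens. Qed.
Let p_gt0 : forall x, 0 < p x. Proof. by case: p_dens. Qed.
Let p1 : int_Rd (fun x => (p x)%:E) = 1%E. Proof. by case: p_dens. Qed.
Let p_continuous : continuous p. Proof. exact: smooth_continuous. Qed.

Let isometry_density (O : 'M[R]_d) : O^T *m O = 1%:M -> affine_density p O 0 = p.
Proof.
move=> OO; apply/funext => y; rewrite /affine_density addr0.
have detO : `|\det O| = 1.
  have : `|\det O| ^+ 2 = 1 by rewrite -normrX expr2 -{1}det_tr -det_mulmx OO det1 normr1.
  by move=> /eqP; rewrite sqrp_eq1// => /eqP.
by rewrite detO mul1r /p /sqnorm trmx_mul -mulmxA [(_^T *m (_ *m y))%R]mulmxA OO mul1mx.
Qed.

Let isometry_unit (O : 'M[R]_d) : O^T *m O = 1%:M -> O \in unitmx.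
Proof. by move=> /mulmx1_unit[]. Qed.

Let isometry_inv (O : 'M[R]_d) : O^T *m O = 1%:M -> invmx O = O^T.
Proof. by move=> OO; rewrite -[RHS](mulmxK (isometry_unit OO)) OO mul1mx. Qed.

Lemma radial_mean : mean p = 0.
Proof.
have trN1 : (- 1%:M : 'M[R]_d)^T = - 1%:M.
  by apply/matrixP => i j; rewrite !mxE eq_sym.
have OO : (- 1%:M : 'M[R]_d)^T *m (- 1%:M) = 1%:M.
  by rewrite trN1 mulmxN mulNmx opprK mulmx1.
have := mean_affine_density p_dens p2 0 (isometry_unit OO).
rewrite isometry_density// isometry_inv// subr0 trN1 mulNmx mul1mx => /eqP.
by rewrite -subr_eq0 opprK -mulr2n -scaler_nat scaler_eq0 pnatr_eq0 => /eqP.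
Qed.

Let cov_isometry (O : 'M[R]_d) : O^T *m O = 1%:M -> cov p = O^T *m cov p *m O.
Proof.
move=> OO; have := cov_affine_density p_dens p2 0 (isometry_unit OO).
by rewrite isometry_density// isometry_inv// trmxK.
Qed.

(** Reflections kill the off-diagonal covariances, transpositions make the
    diagonal constant, and its trace is [d * kappa d g] by definition. *)
Lemma radial_cov : cov p = (kappa d g)%:M.
Proof.
have off i j : i != j -> cov p i j = 0.
  move=> ij; pose s : 'rV[R]_d := \row_k (if k == i then -1 else 1).
  have OO : (diag_mx s)^T *m diag_mx s = 1%:M.
    rewrite tr_diag_mx mulmx_diag -diag_const_mx; congr diag_mx; apply/rowP => k.
    by rewrite !mxE; case: ifP => _; rewrite ?mulrNN mulr1.
  have /matrixP/(_ i j) := cov_isometry OO.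
  rewrite tr_diag_mx mul_diag_mx mul_mx_diag 2![in RHS]mxE [s _ _]mxE [s _ _]mxE eqxx.
  rewrite eq_sym (negbTE ij) mulr1 mulN1r => /eqP.
  by rewrite -subr_eq0 opprK -mulr2n -mulr_natl mulf_eq0 pnatr_eq0 => /eqP.
have diag i j : cov p i i = cov p j j.
  have OO : (tperm_mx i j : 'M[R]_d)^T *m tperm_mx i j = 1%:M.
    by rewrite tr_tperm_mx -perm_mxM tperm2 perm_mx1.
  have /matrixP/(_ i i) := cov_isometry OO.
  rewrite tr_tperm_mx -xrowE -xcolE => ->.
  by rewrite [LHS]mxE [LHS]mxE tpermL.
have tr_cov : \sum_i (cov p i i)%:E = (d%:R * kappa d g)%:E.
  rewrite /kappa mulrA divff ?pnatr_eq0 -?lt0n// mul1r fineK; last first.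
    apply: int_Rd_fin_num; apply: integrable_Rd_ge0.
    - apply: continuous_measurable_vec; apply: continuous_mul => //.
      by move=> x; exact: (differentiable_continuous (Ck_differentiable x (Ck_sqnorm R d 0))).
    - by move=> y; rewrite mulr_ge0 ?sqnorm_ge0//; exact: ltW (p_gt0 y).
    - exact: p2.
  transitivity (int_Rd (fun x => (\sum_i p x * (x i 0 * x i 0))%:E)).
    rewrite int_Rd_sum => [|i]; last by apply: L2_mul => //; exact: L2_coord.
    apply: eq_bigr => i _; rewrite -int_centered2//; apply: eq_int_Rd => x.
    by rewrite /centered radial_mean mxE subr0.
  by apply: eq_int_Rd => x; rewrite -mulr_sumr -sqnormE mulrC.
apply/matrixP => i j; rewrite [RHS]mxE; have [->|ij] := eqVneq i j; last by rewrite off.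
rewrite mulr1n; have /eqP := tr_cov.
under eq_bigr do rewrite (diag _ j).
rewrite sumEFin sumr_const card_ord eqe -[cov p j j *+ d]mulr_natl => /eqP.
by apply: mulfI; rewrite pnatr_eq0 -lt0n.
Qed.

(** Otherwise [p] would be concentrated on the hyperplane [y 0 = 0], and, by
    translation invariance of the Lebesgue measure, on a disjoint parallel
    hyperplane as well. *)
Lemma kappa_gt0 : 0 < kappa d g.
Proof.
pose i : 'I_d := Ordinal d_gt0.
have covE : (kappa d g)%:E = int_Rd (fun x => (p x * (x i 0 * x i 0))%:E).
  have := int_centered2 p_dens p2 i i; rewrite radial_cov mxE eqxx mulr1n => <-.
  by apply: eq_int_Rd => x; rewrite /centered radial_mean mxE subr0.
have F0 (x : V) : 0 <= p x * (x i 0 * x i 0).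
  by rewrite mulr_ge0 ?(ltW (p_gt0 x))// -expr2 sqr_ge0.
have k0 : 0 <= kappa d g.
  by rewrite -lee_fin covE; apply: integral_ge0 => t _; rewrite lee_fin.
rewrite lt_def k0 andbT; apply/eqP => kE; move: covE; rewrite kE => /esym int0.
have mF : measurable_fun setT (fun t : d.-tuple R => (p (vec t) * (vec t i 0 * vec t i 0))%:E).
  apply/measurable_EFinP.
  apply: (continuous_measurable_vec (f := fun x => p x * (x i 0 * x i 0))).
  by apply: continuous_mul => //; apply: continuous_mul; exact: coord_continuousV.
have ae0 : {ae leb R d, forall t, vec t i 0 = 0}.
  have /(ae_eq_integral_abs (leb R d) measurableT mF) :
    (\int[leb R d]_t `|(p (vec t) * (vec t i 0 * vec t i 0))%:E| = 0)%E.
    rewrite -[RHS]int0; apply: eq_integral => t _.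
    by rewrite gee0_abs// lee_fin F0.
  apply: filterS => t /(_ I) /= [Fz]; apply/eqP.
  by have /eqP := Fz; rewrite mulf_eq0 (gt_eqF (p_gt0 _)) mulf_eq0 orbb.
pose H : set V := [set x | x i 0 = 0].
pose F (x : V) := p x * \1_H x.
have mH : measurable_fun setT (F \o @vec R d).
  apply: measurable_realfun.measurable_funM; first exact: continuous_measurable_vec.
  have mHs : measurable (@vec R d @^-1` H).
    rewrite -[X in measurable X]setTI.
    by apply: (measurable_vec_entry i measurableT (Y := [set 0])); exact: measurable_set1.
  exact: (measurable_indic mHs).
have := int_Rd_affine (delta_mx i 0) (unitmx1 R d) mH.
have -> : int_Rd (EFin \o F) = 1%E.
  rewrite -p1; apply: ae_eq_integral => //.
  - exact/measurable_EFinP.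
  - by apply/measurable_EFinP; exact: continuous_measurable_vec.
  - apply: filterS ae0 => t t0 _.
    by rewrite /F /= indicE mem_set// mulr1.
have -> : int_Rd (fun x => (`|\det (1%:M : 'M[R]_d)| * F (1%:M *m x + delta_mx i 0))%:E) = 0%E.
  rewrite -[RHS](integral0 (leb R d) setT); apply: ae_eq_integral => //.
  - apply/measurable_EFinP; apply: measurable_realfun.measurable_funM => //.
    by apply/measurable_EFinP; apply: (@measurable_affine _ _ _ (EFin \o F)); exact/measurable_EFinP.
  - apply: filterS ae0 => t t0 _ /=.
    rewrite /F indicE memNset ?mulr0// /H /= mul1mx mxE t0 add0r mxE !eqxx.
    by apply/eqP; exact: oner_neq0.
by move=> [E]; have := oner_neq0 R; rewrite -E eqxx.
Qed.

End radial_density.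

Section elliptic_moments.
Context (R : realType) (d : nat) (g : R -> R) (rho : 'cV[R]_d -> R).
Variables (m : 'cV[R]_d) (S T : 'M[R]_d).
Hypotheses (d_gt0 : (0 < d)%N) (rhoE : elliptic rho m S g).
Hypotheses (rho_dens : smooth_positive_density rho) (rho2 : finite_second_moment rho).
Hypotheses (uT : T \in unitmx) (TT : T *m T^T = S).

(** [T] is a square root of the scale matrix: the standardized vector
    [invmx T *m (X - m)] is radial. *)
Let standardized : affine_density rho T m = fun y => g (sqnorm y).
Proof.
have detT0 : `|\det T| != 0 by rewrite normr_eq0 -unitfE -unitmxE.
have detS : Num.sqrt (\det S) = `|\det T|.
  by rewrite -TT det_mulmx det_tr -expr2 sqrtr_sqr.
have uTT : T^T \in unitmx by rewrite unitmx_tr.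
apply/funext => y; rewrite /affine_density; case: rhoE => _ _ ->.
rewrite detS mulrA divff// mul1r addrK; congr g; rewrite /sqnorm.
have uS : S \in unitmx by rewrite -TT unitmx_mul uT.
have invS : invmx S = invmx T^T *m invmx T.
  by rewrite -[RHS](mulKmx uS) -{3}TT !mulmxA mulmxK// mulmxK.
by rewrite invS trmx_mul -!mulmxA (mulKmx uT) (mulKVmx uTT).
Qed.

Let p_dens : smooth_positive_density (fun y : 'cV[R]_d => g (sqnorm y)).
Proof. by rewrite -standardized; exact: affine_density_smooth_positive. Qed.

Let p2 : finite_second_moment (fun y : 'cV[R]_d => g (sqnorm y)).
Proof. by rewrite -standardized; exact: affine_density_second_moment. Qed.

Lemma elliptic_kappa_gt0 : 0 < kappa d g.
Proof. exact: kappa_gt0. Qed.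

Lemma elliptic_mean : mean rho = m.
Proof.
have := mean_affine_density rho_dens rho2 m uT.
rewrite standardized (radial_mean p_dens p2) => /(congr1 (mulmx T)).
by rewrite mulmx0 mulKVmx// => /esym/eqP; rewrite subr_eq0 => /eqP.
Qed.

Lemma elliptic_cov : cov rho = kappa d g *: S.
Proof.
have := cov_affine_density rho_dens rho2 m uT.
rewrite standardized (radial_cov p_dens p2 d_gt0) => /(congr1 (fun X => T *m X *m T^T)).
rewrite !mulmxA mulmxV// mul1mx trmx_inv mulmxKV ?unitmx_tr// => <-.
by rewrite mul_mx_scalar -scalemxAl TT.
Qed.

End elliptic_moments.

(** * The scalar flow of the eigenvalues *)

Section derivative_rules.
Context (R : realType).
Implicit Types (f g : R -> R) (t a b c : R).

(** The usual rules for functions given pointwise, with the value of the derivative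
    as a real expression. *)
Lemma der_id t : is_derive t 1 (fun s : R => s) 1.
Proof. exact: is_derive_id. Qed.

Lemma der_cst t c : is_derive t 1 (fun _ : R => c) 0.
Proof. exact: is_derive_cst. Qed.

Lemma derD t f g a b : is_derive t 1 f a -> is_derive t 1 g b ->
  is_derive t 1 (fun s => f s + g s) (a + b).
Proof. by move=> df dg; exact: is_deriveD. Qed.

Lemma derN t f a : is_derive t 1 f a -> is_derive t 1 (fun s => - f s) (- a).
Proof. by move=> df; exact: is_deriveN. Qed.

Lemma derB t f g a b : is_derive t 1 f a -> is_derive t 1 g b ->
  is_derive t 1 (fun s => f s - g s) (a - b).
Proof. by move=> df dg; exact: is_deriveB. Qed.

Lemma derM t f g a b : is_derive t 1 f a -> is_derive t 1 g b ->
  is_derive t 1 (fun s => f s * g s) (a * g t + f t * b).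
Proof.
move=> df dg; apply: (is_derive_eq (is_deriveM df dg)).
by rewrite addrC; congr (_ + _); exact: mulrC.
Qed.

Lemma derZ t c f a : is_derive t 1 f a -> is_derive t 1 (fun s => c * f s) (c * a).
Proof.
by move=> df; apply: (is_derive_eq (derM (der_cst t c) df)); rewrite mul0r add0r.
Qed.

Lemma derV t f a : is_derive t 1 f a -> f t != 0 ->
  is_derive t 1 (fun s => (f s)^-1) (- a / f t ^+ 2).
Proof.
move=> df f0; apply: (is_derive_eq (is_deriveV f0 df)).
by rewrite /GRing.scale /= mulNr mulNr mulrC.
Qed.

Lemma der_exp t f a : is_derive t 1 f a ->
  is_derive t 1 (fun s => expR (f s)) (expR (f t) * a).
Proof. by move=> df; exact: (is_derive1_comp (f := expR)). Qed.

Lemma der_ln t f a : is_derive t 1 f a -> 0 < f t ->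
  is_derive t 1 (fun s => ln (f s)) (a / f t).
Proof.
move=> df f0; rewrite mulrC; apply: (is_derive1_comp (f := @ln R)).
exact: is_derive1_ln.
Qed.

End derivative_rules.

Section eigenvalue_flow.
Context (R : realType).
Variables (k lam s0 s1 : R).
Hypotheses (k_gt0 : 0 < k) (lam_gt0 : 0 < lam) (s0_gt0 : 0 < s0) (s1_gt0 : 0 < s1).

(** For one eigenvalue [s0] to be moved to [s1], with [k] for [kappa]:
    [h = halflog] solves [h' = (k * s0 * expR (2 * h) + lam) * rate], [h 0 = 0],
    and [conduct = k * eigen + lam] is the right-hand factor.  The unknown
    [wgt = lam / conduct] satisfies the linear equation
    [wgt' = 2 * lam * rate * (wgt - 1)], whence the closed formula for [wgt], and
    [rate] is the solution of [wgt 1 = lam / (k * s1 + lam)]. *)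
Definition logratio : R :=
  ln (s1 / s0) - ln ((k * s1 + lam) / (k * s0 + lam)).
Definition rate : R := (2 * lam)^-1 * logratio.
Definition wgt (t : R) : R := 1 - k * s0 / (k * s0 + lam) * expR (2 * lam * rate * t).
Definition conduct (t : R) : R := lam / wgt t.
Definition halflog (t : R) : R :=
  lam * rate * t - 2^-1 * ln (wgt t * ((k * s0 + lam) / lam)).
Definition eigen (t : R) : R := s0 * expR (halflog t) ^+ 2.

Let A0 : 0 < k * s0 + lam. Proof. by rewrite addr_gt0 ?mulr_gt0. Qed.
Let A1 : 0 < k * s1 + lam. Proof. by rewrite addr_gt0 ?mulr_gt0. Qed.

Lemma rate2E : 2 * lam * rate = logratio.
Proof. by rewrite /rate mulrA divff ?mul1r// mulf_neq0// gt_eqF. Qed.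

Lemma exp_logratio : expR logratio = s1 / s0 * ((k * s0 + lam) / (k * s1 + lam)).
Proof.
rewrite /logratio expRD expRN !lnK ?posrE ?divr_gt0//.
by rewrite invf_div.
Qed.

Lemma wgt0 : wgt 0 = lam / (k * s0 + lam).
Proof. by rewrite /wgt mulr0 expR0 mulr1; field; rewrite gt_eqF. Qed.

Lemma wgt1 : wgt 1 = lam / (k * s1 + lam).
Proof.
rewrite /wgt mulr1 rate2E exp_logratio; field.
by rewrite !gt_eqF.
Qed.

(** [wgt] is monotone, with positive values at both ends. *)
Lemma wgt_gt0 t : 0 <= t <= 1 -> 0 < wgt t.
Proof.
move=> /andP[t0 t1]; have q0 : 0 < k * s0 / (k * s0 + lam) by rewrite divr_gt0 ?mulr_gt0.
have [r0|r0] := leP 0 (2 * lam * rate).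
  have : wgt 1 <= wgt t.
    by rewrite lerD2l lerN2 ler_pM2l// ler_expR ler_wpM2l.
  by apply: lt_le_trans; rewrite wgt1 divr_gt0.
have : wgt 0 <= wgt t.
  by rewrite lerD2l lerN2 ler_pM2l// ler_expR mulr0 mulr_le0_ge0// ltW.
by apply: lt_le_trans; rewrite wgt0 divr_gt0.
Qed.

Lemma halflog0 : halflog 0 = 0.
Proof.
have E : wgt 0 * ((k * s0 + lam) / lam) = 1 by rewrite wgt0; field; rewrite !gt_eqF.
by rewrite /halflog E ln1 !mulr0 subrr.
Qed.

Lemma conductE t : 0 <= t <= 1 -> conduct t = k * eigen t + lam.
Proof.
move=> t01; have w0 := wgt_gt0 t01; rewrite /eigen /halflog -expRM_natl.
rewrite mulrBr [2 * (2^-1 * _)]mulrA divff// mul1r expRD expRN lnK; last first.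
  by rewrite posrE mulr_gt0// divr_gt0.
have E : expR (2 * (lam * rate * t)) = (1 - wgt t) * ((k * s0 + lam) / (k * s0)).
  rewrite /wgt !mulrA; set e := expR _; field.
  by rewrite !gt_eqF.
rewrite E /conduct; field.
by rewrite !gt_eqF.
Qed.

Lemma conduct0 : conduct 0 = k * s0 + lam.
Proof. by rewrite /conduct wgt0; field; rewrite !gt_eqF. Qed.

Lemma conduct1 : conduct 1 = k * s1 + lam.
Proof. by rewrite /conduct wgt1; field; rewrite !gt_eqF. Qed.

Lemma eigen1 : eigen 1 = s1.
Proof.
have := conductE (t := 1); rewrite ler01 lexx => /(_ isT).
by rewrite conduct1 => /addIr/mulfI ->//; rewrite gt_eqF.
Qed.

Lemma expR_halflog1 : expR (halflog 1) = Num.sqrt s1 / Num.sqrt s0.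
Proof.
have /(congr1 Num.sqrt) := eigen1; rewrite /eigen sqrtrM ?ltW// sqrtr_sqr => <-.
rewrite ger0_norm ?expR_ge0// mulrAC divff ?mul1r//.
by rewrite gt_eqF// sqrtr_gt0.
Qed.

Lemma halflog1 : halflog 1 = 2^-1 * ln (s1 / s0).
Proof.
have <- : expR (halflog 1) ^+ 2 = s1 / s0.
  by rewrite -eigen1 /eigen mulrAC divff ?mul1r// gt_eqF.
by rewrite -expRM_natl expRK mulrA mulVf ?mul1r.
Qed.

Lemma is_derive_wgt (t : R) : is_derive t 1 wgt (2 * lam * rate * (wgt t - 1)).
Proof.
have de := derB (der_cst t 1) (derZ (k * s0 / (k * s0 + lam))
  (der_exp (derZ (2 * lam * rate) (der_id t)))).
by apply: (is_derive_eq de); rewrite /wgt; ring.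
Qed.

Lemma is_derive_halflog (t : R) : 0 <= t <= 1 -> is_derive t 1 halflog (conduct t * rate).
Proof.
move=> t01; have w0 := wgt_gt0 t01.
have c0 : 0 < (k * s0 + lam) / lam by rewrite divr_gt0.
have dw := derM (is_derive_wgt t) (der_cst t ((k * s0 + lam) / lam)).
have dl := der_ln dw (mulr_gt0 w0 c0).
apply: (is_derive_eq (derB (derZ (lam * rate) (der_id t)) (derZ 2^-1 dl))).
rewrite /conduct; field.
by rewrite !gt_eqF.
Qed.

Lemma is_derive_conduct (t : R) : 0 <= t <= 1 ->
  is_derive t 1 conduct (2 * rate * conduct t * (conduct t - lam)).
Proof.
move=> t01; have w0 := wgt_gt0 t01.
apply: (is_derive_eq (derZ lam (derV (is_derive_wgt t) (lt0r_neq0 w0)))).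
rewrite /conduct; field.
by rewrite !gt_eqF.
Qed.

(** The mean at time [t] moves along the eigenvector by the fraction [mean_coef t] of
    its total displacement, and [slope t] is the corresponding coordinate of
    [B m + b].  As [slope' = rate * mean_coef' = rate * conduct * slope] it is
    proportional to [expR halflog]; if [s0 = s1] then [rate = 0] and [slope] is
    constant. *)
Definition mean_coef (t : R) : R :=
  if s0 == s1 then t else (expR (halflog t) - 1) / (expR (halflog 1) - 1).

Definition slope (t : R) : R :=
  if s0 == s1 then (k * s0 + lam)^-1
  else rate * expR (halflog t) / (expR (halflog 1) - 1).

Lemma rate_eq0 : s0 = s1 -> rate = 0.
Proof. by move=> s01; rewrite /rate /logratio s01 !divff ?gt_eqF// ln1 subrr mulr0. Qed.

Lemma conduct_cst t : s0 = s1 -> conduct t = k * s0 + lam.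
Proof.
by move=> s01; rewrite -conduct0 /conduct /wgt rate_eq0// mulr0 !mul0r.
Qed.

Lemma sqrt_diff_neq0 : s0 != s1 -> Num.sqrt s1 - Num.sqrt s0 != 0.
Proof.
apply: contra_neq => /eqP; rewrite subr_eq0 => /eqP.
by move=> /(congr1 (fun x => x ^+ 2)); rewrite !sqr_sqrtr ?ltW.
Qed.

Lemma expR_halflog1_neq1 : s0 != s1 -> expR (halflog 1) - 1 != 0.
Proof.
have q0 : Num.sqrt s0 != 0 by rewrite gt_eqF// sqrtr_gt0.
move=> /sqrt_diff_neq0; rewrite expR_halflog1 -[X in _ / _ - X](divff q0) -mulrBl.
by move=> n; rewrite mulf_neq0// invr_neq0.
Qed.

Lemma mean_coef0 : mean_coef 0 = 0.
Proof. by rewrite /mean_coef halflog0 expR0 subrr mul0r; case: ifP. Qed.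

Lemma mean_coef1 : mean_coef 1 = 1.
Proof.
rewrite /mean_coef; case: eqVneq => // s01.
by rewrite divff// expR_halflog1_neq1.
Qed.

Lemma slopeE t : slope t = rate * mean_coef t + slope 0.
Proof.
rewrite /slope /mean_coef; case: eqVneq => [s01|s01].
  by rewrite rate_eq0// mul0r add0r.
by rewrite halflog0 expR0 mulr1 [rate * (_ / _)]mulrA -mulrDl mulrBr mulr1 subrK.
Qed.

Lemma is_derive_mean_coef (t : R) : 0 <= t <= 1 ->
  is_derive t 1 mean_coef (conduct t * slope t).
Proof.
move=> t01; rewrite /mean_coef /slope; case: eqVneq => [s01|s01].
  by rewrite conduct_cst// divff ?gt_eqF//; exact: der_id.
have de := derB (der_exp (is_derive_halflog t01)) (der_cst t 1).
apply: (is_derive_eq (derM de (der_cst t (expR (halflog 1) - 1)^-1))).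
by ring.
Qed.

(** Half of [t h' - h] with [h = halflog], whose derivative is [t h'' / 2]. *)
Definition primitive_cov (t : R) : R := 2^-1 * (t * (conduct t * rate) - halflog t).

(** If [s0 != s1], the squares of [slope] and [rate] differ by the factor
    [expR (2 * halflog t) / (expR (halflog 1) - 1) ^+ 2], in which the numerator is
    [(conduct - lam) / (k * s0)]; this makes the integrand of the mean a constant
    multiple of that of the covariance. *)
Definition primitive_mean (t : R) : R :=
  if s0 == s1 then 2^-1 * t ^+ 2 / (k * s0 + lam)
  else primitive_cov t / (k * (Num.sqrt s1 - Num.sqrt s0) ^+ 2).

Lemma is_derive_primitive_cov (t : R) : 0 <= t <= 1 ->
  is_derive t 1 primitive_cov (t * (rate ^+ 2 * conduct t * (conduct t - lam))).
Proof.
move=> t01; have dc := derM (is_derive_conduct t01) (der_cst t rate).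
apply: (is_derive_eq (derZ 2^-1 (derB (derM (der_id t) dc) (is_derive_halflog t01)))).
by field.
Qed.

Lemma is_derive_primitive_mean (t : R) : 0 <= t <= 1 ->
  is_derive t 1 primitive_mean (t * (conduct t * slope t ^+ 2)).
Proof.
move=> t01; rewrite /primitive_mean /slope; case: eqVneq => [s01|s01].
  have d2 := derM (derZ 2^-1 (derM (der_id t) (der_id t))) (der_cst t (k * s0 + lam)^-1).
  have -> : (fun t : R => 2^-1 * t ^+ 2 / (k * s0 + lam)) =
      (fun t : R => 2^-1 * (t * t) / (k * s0 + lam)) by apply/funext => u; rewrite expr2.
  apply: (is_derive_eq d2); rewrite conduct_cst//; field.
  by rewrite gt_eqF.
apply: (is_derive_eq (derM (is_derive_primitive_cov t01) (der_cst t _))).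
have q0 : 0 < Num.sqrt s0 by rewrite sqrtr_gt0.
have cE : conduct t - lam = k * Num.sqrt s0 ^+ 2 * expR (halflog t) ^+ 2.
  by rewrite conductE// addrK /eigen sqr_sqrtr ?ltW// mulrA.
have n1 := expR_halflog1_neq1 s01; rewrite expR_halflog1 in n1 *.
have n2 := sqrt_diff_neq0 s01.
rewrite cE; field.
by rewrite mulN1r n2 !gt_eqF.
Qed.

(** The eigenvalue of the matrix called Xi in the theorem. *)
Definition xi : R := s1 * ln (s1 / s0) +
  k^-1 * ((k * s1 + lam) * ln ((k * s0 + lam) / (k * s1 + lam))).

Lemma primitive_cov_diff : primitive_cov 1 - primitive_cov 0 = k / (4 * lam) * xi.
Proof.
rewrite /primitive_cov conduct1 halflog1 halflog0 /rate /logratio /xi.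
rewrite -[(k * s0 + lam) / _]invf_div lnV ?posrE ?divr_gt0//; field.
by rewrite !gt_eqF.
Qed.

Lemma primitive_mean_diff : primitive_mean 1 - primitive_mean 0 =
  if s0 == s1 then 2^-1 * (k * s0 + lam)^-1
  else (4 * lam)^-1 * (xi * ((Num.sqrt s1 - Num.sqrt s0)^-1) ^+ 2).
Proof.
rewrite /primitive_mean; case: eqVneq => [s01|s01].
  by rewrite expr1n expr0n mulr0 mul0r subr0 mulr1.
rewrite -mulrBl primitive_cov_diff; field.
by rewrite ?mulN1r sqrt_diff_neq0// !gt_eqF.
Qed.

End eigenvalue_flow.

(** * The elliptic dual geodesic and its action *)

Section one_sided_derivatives.
Context (R : realType).

Lemma is_derive_within_of (D : set R) (u : R -> R) (t l : R) :
  is_derive t 1 u l -> is_derive_within D u t l.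
Proof.
move=> [du <-]; have : (h^-1 *: (u (h *: 1 + t) - u t)) @[h --> 0^'] --> 'D_1 u t by exact: du.
move=> /cvgrPdist_le C; apply/cvgrPdist_le => e e0.
have /nbhs_ballP[r /= r0 rP] := C e e0.
apply/nbhs_ballP; exists r => // s ts; rewrite /= => st Ds.
have := rP (s - t); rewrite /ball /= sub0r normrN distrC => /(_ ts).
by rewrite subr_eq0 => /(_ st); rewrite [(s - t) *: 1]mulr1 subrK.
Qed.

Lemma within_itv_proper (t : R) : t \in `[0, 1] ->
  ProperFilter (within `[0, 1] t^').
Proof.
rewrite in_itv /= => /andP[t0 t1]; split; last exact: within_filter.
rewrite /within /= => /nbhs_ballP[r /= r0 rP].
pose e := Num.min r 1 / 2.
have e0 : 0 < e by rewrite divr_gt0// lt_min r0 ltr01.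
have er : e < r.
  rewrite /e ltr_pdivrMr// (le_lt_trans (_ : _ <= r)) ?ge_min ?lexx//.
  by rewrite ltr_pMr// ltr1n.
have e1 : e <= 2^-1 by rewrite /e ler_pdivrMr// mulVf// ge_min lexx orbT.
have [th|th] := leP t 2^-1.
  apply: (rP (t + e)); rewrite /= ?in_itv /= ?addr_ge0 ?(ltW e0)//.
  - by rewrite /ball /= opprD addNKr normrN gtr0_norm.
  - by rewrite -subr_eq0 addrC addKr gt_eqF.
  - by rewrite (le_trans (lerD th e1))// -[X in X + _]mul1r -[X in _ + X]mul1r -splitr.
apply: (rP (t - e)); rewrite /= ?in_itv /=.
- by rewrite /ball /= opprB addrC subrK gtr0_norm.
- by rewrite -subr_eq0 addrC addKr oppr_eq0 gt_eqF.
- by rewrite subr_ge0 (le_trans e1 (ltW th)) lerBlDr (le_trans t1)// lerDl ltW.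
Qed.

Lemma is_derive_within_unique (u v : R -> R) (t l l' : R) : t \in `[0, 1] ->
  (forall s, s \in `[0, 1] -> u s = v s) ->
  is_derive_within `[0, 1] u t l -> is_derive_within `[0, 1] v t l' -> l = l'.
Proof.
move=> t01 uv ul vl; have PF := within_itv_proper t01.
have ul' : is_derive_within `[0, 1] u t l'.
  apply: cvg_trans vl; apply: near_eq_cvg; near=> s.
  by rewrite !uv//; near: s; exact: withinT.
exact: (cvg_unique _ ul ul').
Unshelve. all: by end_near. Qed.

Lemma chain_rule d (F : 'cV[R]_d -> R) (y : R -> 'cV[R]_d) (y' : 'cV[R]_d) (t : R) :
  differentiable F (y t) ->
  (forall i, is_derive t 1 (fun s => y s i 0) (y' i 0)) ->
  is_derive t 1 (fun s => F (y s)) (\sum_i y' i 0 * partial i F (y t)).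
Proof.
move=> dF dy.
have dy1 : derivable y t 1.
  by apply/derivable_mxP => i j; rewrite (ord1 j); case: (dy i).
have ydiff : differentiable y t by exact/derivable1_diffP.
have y'E : 'D_1 y t = y'.
  rewrite derive_mx//; apply/matrixP => i j; rewrite mxE (ord1 j).
  by case: (dy i) => _ <-.
have Fy : differentiable (F \o y) t by exact: differentiable_comp.
apply: DeriveDef; first exact: diff_derivable.
rewrite [LHS](deriveE (f := F \o y))// diff_comp// /= -(deriveE _ ydiff) y'E.
by rewrite -deriveE// derive_partial.
Qed.

End one_sided_derivatives.

Section diagonal_coordinates.
Context (R : realType) (d : nat) (Q : 'M[R]_d).
Hypothesis uQ : Q \in unitmx.

Lemma fc_coord (u : 'I_d -> R) (v : 'cV[R]_d) k : (Q *m (fc Q u *m v)) k 0 = u k * (Q *m v) k 0.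
Proof.
rewrite fcE !mulmxA mulmxV// mul1mx -mulmxA mul_diag_mx mxE.
by rewrite [X in X * _]mxE.
Qed.

Lemma fc_apply (u : 'I_d -> R) (v : 'cV[R]_d) i :
  (fc Q u *m v) i 0 = \sum_k invmx Q i k * (u k * (Q *m v) k 0).
Proof.
rewrite -[fc Q u *m v](mulKmx uQ) [LHS]mxE; apply: eq_bigr => k _.
by rewrite fc_coord.
Qed.

End diagonal_coordinates.

Section elliptic_curve.
Context (R : realType) (d : nat) (Q : 'M[R]_d) (a c : 'I_d -> R) (k lam : R).
Variables (rho : 'cV[R]_d -> R) (m0 Dm : 'cV[R]_d).
Local Notation V := 'cV[R]_d.
Hypotheses (uQ : Q \in unitmx) (k_gt0 : 0 < k) (lam_gt0 : 0 < lam).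
Hypotheses (a_gt0 : forall i, 0 < a i) (c_gt0 : forall i, 0 < c i).
Hypotheses (sym0 : (fc Q a)^T = fc Q a) (sym1 : (fc Q c)^T = fc Q c).
Hypotheses (rho_dens : smooth_positive_density rho) (rho2 : finite_second_moment rho).
Hypotheses (rho_mean : mean rho = m0) (rho_cov : cov rho = k *: fc Q a).

Let h t i := halflog k lam (a i) (c i) t.
Let r i := rate k lam (a i) (c i).
Let A t i := conduct k lam (a i) (c i) t.
Let f t i := mean_coef k lam (a i) (c i) t.
Let e t i := slope k lam (a i) (c i) t.

(** Any function of the two spectra is symmetric, because both eigenvalues agree on
    overlapping eigenvectors ([fc_symP]). *)
Lemma spectral_sym (F : R -> R -> R) :
  (fc Q (fun i => F (a i) (c i)))^T = fc Q (fun i => F (a i) (c i)).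
Proof.
apply/fc_symP => // i j M0.
by rewrite ((fc_symP uQ a).1 sym0 i j M0) ((fc_symP uQ c).1 sym1 i j M0).
Qed.

(** [geo_curve t] is the law of [geo_mean t + invmx (geo_scaling t) *m (X - m0)] for
    [X] of density [rho]; [geo_B] and [geo_b] are the coefficients of the potential
    that generates it. *)
Definition geo_scaling t : 'M[R]_d := fc Q (fun i => expR (- h t i)).
Definition geo_mean t : V := m0 + fc Q (f t) *m Dm.
Definition geo_B : 'M[R]_d := fc Q r.
Definition geo_b : V := fc Q (e 0) *m Dm - geo_B *m m0.
Definition geo_curve t : V -> R :=
  affine_density rho (geo_scaling t) (m0 - geo_scaling t *m geo_mean t).

Let L_unit t : geo_scaling t \in unitmx.
Proof. by apply: fc_unit => // i; rewrite gt_eqF// expR_gt0. Qed.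

Let L_inv t : invmx (geo_scaling t) = fc Q (fun i => expR (h t i)).
Proof.
rewrite fc_inv// => [|i]; last by rewrite gt_eqF// expR_gt0.
by apply: eq_fc => i; rewrite expRN invrK.
Qed.

Lemma geo_curve_mean t : mean (geo_curve t) = geo_mean t.
Proof.
rewrite mean_affine_density// rho_mean opprB addrC subrK.
by rewrite mulKmx.
Qed.

Lemma geo_curve_cov t : 0 <= t <= 1 ->
  cov (geo_curve t) + lam%:M = fc Q (A t).
Proof.
move=> t01; rewrite cov_affine_density// rho_cov L_inv.
rewrite (spectral_sym (fun x y => expR (halflog k lam x y t))).
rewrite -scalemxAr -scalemxAl !fcM// fcZ -(fc_const uQ) fcD.
by apply: eq_fc => i; rewrite /A conductE// /eigen /h; congr (_ + _); ring.
Qed.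

Lemma geo_curve_cov_fc t : 0 <= t <= 1 -> cov (geo_curve t) = fc Q (fun i => A t i - lam).
Proof.
move=> /geo_curve_cov; rewrite -(fc_const uQ) => /(canRL (addrK _)) ->.
by rewrite fcB.
Qed.

Lemma geo_potential_mean t : geo_B *m geo_mean t + geo_b = fc Q (e t) *m Dm.
Proof.
rewrite /geo_mean /geo_b mulmxDr mulmxA [geo_B *m fc Q _]fcM// addrC subrKA.
rewrite -mulmxDl fcD; congr (_ *m _); apply: eq_fc => i.
by rewrite [RHS]slopeE //; exact: addrC.
Qed.

(** With [u = A_t (B x + b)] and [L = geo_scaling t], the two terms of the
    divergence match the two factors of [geo_curve t x = |det L| * rho (y t)]: the
    trace of [A_t B] is minus the logarithmic derivative of [|det L|], and
    [y' = - L u] is the transport of the argument. *)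
Lemma geo_curve_derivative (t : R) x : 0 <= t <= 1 ->
  is_derive t 1 (geo_curve ^~ x)
    (phi_KW lam (geo_curve t) (quad_potential geo_B geo_b) x).
Proof.
move=> t01; set At := fc Q (A t); set L := geo_scaling t.
have [rho_smooth rho_gt0 rho1] := rho_dens.
have drho y : differentiable rho y by exact: smooth_differentiable.
have symB : geo_B^T = geo_B by exact: (spectral_sym (rate k lam)).
have symL : L^T = L by exact: (spectral_sym (fun x y => expR (- halflog k lam x y t))).
pose u := At *m (geo_B *m x + geo_b).
pose y s : V := geo_scaling s *m x + (m0 - geo_scaling s *m geo_mean s).
pose T := \sum_i A t i * r i.
have detE s : `|\det (geo_scaling s)| = expR (- \sum_i h s i).
  rewrite det_fc// ger0_norm; last by apply: prodr_ge0 => i _; exact: expR_ge0.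
  by rewrite -sumrN; elim/big_rec2 : _ => [|i p q _ ->]; rewrite ?expR0// expRD.
have dh i : is_derive t 1 (fun s => h s i) (A t i * r i) by exact: is_derive_halflog.
have df i : is_derive t 1 (fun s => f s i) (A t i * e t i) by exact: is_derive_mean_coef.
have d_det : is_derive t 1 (fun s => `|\det (geo_scaling s)|) (- (T * `|\det L|)).
  rewrite (_ : (fun s => _) = fun s => expR (- \sum_i h s i)); last exact/funext/detE.
  have ds : is_derive t 1 (fun s => \sum_i h s i) T.
    rewrite (_ : (fun s => _) = \sum_i h ^~ i); first exact: is_derive_sum.
    by apply/funext => s; rewrite fct_sumE.
  by apply: (is_derive_eq (der_exp (derN ds))); rewrite detE mulrN mulrC.
have yE s i : y s i 0 = m0 i 0 + \sum_j invmx Q i j *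
    (expR (- h s j) * ((Q *m (x - m0)) j 0 - f s j * (Q *m Dm) j 0)).
  have -> : y s = m0 + geo_scaling s *m (x - geo_mean s).
    by rewrite /y mulmxBr addrCA.
  rewrite mxE fc_apply//; congr (_ + _); apply: eq_bigr => j _; congr (_ * (_ * _)).
  rewrite /geo_mean opprD addrA mulmxDr mulmxN [LHS]mxE; congr (_ + _).
  by rewrite [LHS]mxE fc_coord.
have QuE j : (Q *m u) j 0 = A t j * (r j * (Q *m (x - m0)) j 0 + e 0 j * (Q *m Dm) j 0).
  rewrite fc_coord//; congr (_ * _).
  rewrite /geo_b addrCA -mulmxBr mulmxDr addrC [LHS]mxE; congr (_ + _); exact: fc_coord.
have dy i : is_derive t 1 (fun s => y s i 0) ((- (L *m u)) i 0).
  pose z s j := invmx Q i j *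
    (expR (- h s j) * ((Q *m (x - m0)) j 0 - f s j * (Q *m Dm) j 0)).
  have dz j : is_derive t 1 (z ^~ j) (- (invmx Q i j * (expR (- h t j) * (Q *m u) j 0))).
    have dD := derB (der_cst t ((Q *m (x - m0)) j 0)) (derM (df j) (der_cst t ((Q *m Dm) j 0))).
    apply: (is_derive_eq (derZ (invmx Q i j) (derM (der_exp (derN (dh j))) dD))).
    rewrite QuE [e t j]slopeE// -/(r j) -/(f t j) -/(e 0 j); ring.
  rewrite (_ : (fun s => y s i 0) = fun s => m0 i 0 + (\sum_j z ^~ j) s); last first.
    by apply/funext => s; rewrite fct_sumE yE.
  apply: (is_derive_eq (derD (der_cst t (m0 i 0)) (is_derive_sum dz))).
  by rewrite add0r [RHS]mxE fc_apply// sumrN.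
have d_rho := chain_rule (drho (y t)) dy.
apply: (is_derive_eq (derM d_det d_rho)).
have partial_curve i : partial i (geo_curve t) x =
    `|\det L| * \sum_j L j i * partial j rho (y t).
  rewrite /geo_curve /affine_density partialZ ?partial_affine//.
  apply: (@differentiable_comp _ _ _ _ _ rho) => //; exact: differentiable_affine.
have dcurve : differentiable (geo_curve t) x.
  apply: smooth_differentiable.
  by case: (affine_density_smooth_positive rho_dens (m0 - L *m geo_mean t) (L_unit t)).
have fluxE i : (fun z => (geo_curve t z *: ((cov (geo_curve t) + lam%:M) *m
      grad (quad_potential geo_B geo_b) z)) i 0) =
    fun z => geo_curve t z * (At *m geo_B *m z + At *m geo_b) i 0.
  apply/funext => z; rewrite geo_curve_cov// grad_quad_potential// mulmxDr mulmxA.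
  by rewrite [LHS]mxE.
have dcoord i (v : V) : differentiable (fun z : V => z i 0) v by exact: differentiable_coord.
have partial_lin i : partial i (fun z : V => (At *m geo_B *m z + At *m geo_b) i 0) x =
    (At *m geo_B) i i.
  rewrite (@partial_affine _ _ i (fun z => z i 0))//.
  rewrite (bigD1 i)//= big1 ?addr0 => [|j ji]; first by rewrite partial_coord eqxx mulr1.
  by rewrite partial_coord (negbTE ji) mulr0.
have dlin i : differentiable (fun z : V => (At *m geo_B *m z + At *m geo_b) i 0) x.
  apply: (@differentiable_comp _ _ _ _ _ (fun z : V => z i 0)) => //.
  exact: differentiable_affine.
have divE : divergence (fun z => geo_curve t z *: ((cov (geo_curve t) + lam%:M) *m
      grad (quad_potential geo_B geo_b) z)) x =
    geo_curve t x * T + \sum_i u i 0 * partial i (geo_curve t) x.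
  rewrite /divergence; under eq_bigr do rewrite fluxE partialM// partial_lin.
  rewrite big_split /= -mulr_sumr; congr (_ * _ + _).
    transitivity (\tr (At *m geo_B)) => //.
    by rewrite fcM// tr_fc.
  by apply: eq_bigr => i _; rewrite /u mulmxDr mulmxA.
have E : \sum_i u i 0 * partial i (geo_curve t) x =
    `|\det L| * \sum_j (L *m u) j 0 * partial j rho (y t).
  under eq_bigr do rewrite partial_curve mulrCA mulr_sumr.
  rewrite -mulr_sumr; congr (_ * _); rewrite exchange_big /=.
  apply: eq_bigr => j _; rewrite [in RHS]mxE mulr_suml; apply: eq_bigr => i _.
  by ring.
rewrite /phi_KW divE E /geo_curve /affine_density -/L -[L *m x + _]/(y t).
under eq_bigr do rewrite [(- (L *m u)) _ _]mxE mulNr.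
rewrite sumrN; ring.
Qed.

Let curve_dens t : smooth_positive_density (geo_curve t).
Proof. exact: affine_density_smooth_positive. Qed.

Let curve2 t : finite_second_moment (geo_curve t).
Proof. exact: affine_density_second_moment. Qed.

Lemma geo_generates : KW_generates lam (quad_potential geo_B geo_b) geo_curve.
Proof.
split.
- exact: smooth_quad_potential.
- by move=> t _; split; [exact: curve_dens|exact: curve2].
- move=> t; rewrite in_itv /= => t01 x; apply: is_derive_within_of.
  exact: geo_curve_derivative.
Qed.

(** The coefficient of [u i] in the quadratic form of [fc Q u] at [Dm] ([fc_form]);
    for an orthogonal [Q] it is the square of a coordinate. *)
Definition mean_weight i : R := (Dm^T *m invmx Q) 0 i * (Q *m Dm) i 0.

Lemma geo_sqnorm t : 0 <= t <= 1 ->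
  sqnorm_KW lam (geo_curve t) (quad_potential geo_B geo_b) =
  (\sum_i (r i ^+ 2 * A t i * (A t i - lam)) +
   \sum_i mean_weight i * (A t i * e t i ^+ 2))%:E.
Proof.
move=> t01; set At := fc Q (A t); pose mu := fc Q (e t) *m Dm.
have symA : At^T = At by exact: (spectral_sym (fun x y => conduct k lam x y t)).
have symB : geo_B^T = geo_B by exact: (spectral_sym (rate k lam)).
have symE : (fc Q (e t))^T = fc Q (e t) by exact: (spectral_sym (fun x y => slope k lam x y t)).
have [crho c0 c1] := curve_dens t.
have L2l i : L2 (geo_curve t) (fun x => (geo_B *m x + geo_b) i 0) by exact: L2_linear.
pose I l j x := At l j * (geo_curve t x * ((geo_B *m x + geo_b) l 0 * (geo_B *m x + geo_b) j 0)).
have iI l j : integrable_Rd (I l j) by apply: integrable_RdZ; exact: L2_mul.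
have intI l j : int_Rd (EFin \o I l j) = (At l j * ((geo_B *m cov (geo_curve t) *m geo_B^T) l j +
    mu l 0 * mu j 0))%:E.
  rewrite [LHS]int_RdZ; last exact: L2_mul.
  by rewrite [X in (_ * X)%E]int_affine2// geo_curve_mean geo_potential_mean EFinM.
transitivity (int_Rd (fun x => (\sum_j \sum_l I l j x)%:E)).
  apply: eq_int_Rd => x; congr EFin; rewrite geo_curve_cov// grad_quad_potential//.
  rewrite mx_formE mulr_suml; apply: eq_bigr => j _; rewrite mulr_suml.
  by apply: eq_bigr => l _; rewrite /I -/At; ring.
rewrite int_Rd_sum => [|j]; last exact: integrable_Rd_sum.
transitivity (\sum_j (\sum_l At l j * ((geo_B *m cov (geo_curve t) *m geo_B^T) l j +
    mu l 0 * mu j 0))%:E)%E.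
  apply: eq_bigr => j _; rewrite [LHS]int_Rd_sum// -sumEFin.
  by apply: eq_bigr => l _; exact: intI.
rewrite sumEFin; congr EFin.
under eq_bigr => j _ do (under eq_bigr do rewrite mulrDr; rewrite big_split /=).
rewrite big_split /=; congr (_ + _).
  transitivity (\tr (At *m (geo_B *m cov (geo_curve t) *m geo_B^T))).
    apply: eq_bigr => j _; rewrite [RHS]mxE; apply: eq_bigr => l _.
    by rewrite -{1}symA mxE.
  rewrite symB geo_curve_cov_fc// !fcM// tr_fc//.
  by apply: eq_bigr => i _; ring.
transitivity ((mu^T *m At *m mu) 0 0); first by rewrite mx_formE.
rewrite /mu trmx_mul symE !mulmxA -2!(mulmxA Dm^T) !fcM// fc_form.
by apply: eq_bigr => i _; rewrite /mean_weight; congr (_ * _); ring.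
Qed.

Definition geo_primitive t : R :=
  \sum_i primitive_cov k lam (a i) (c i) t +
  \sum_i mean_weight i * primitive_mean k lam (a i) (c i) t.

Lemma is_derive_geo_primitive (t : R) : 0 <= t <= 1 ->
  is_derive t 1 geo_primitive
    (t * (\sum_i (r i ^+ 2 * A t i * (A t i - lam)) +
          \sum_i mean_weight i * (A t i * e t i ^+ 2))).
Proof.
move=> t01.
have d1 i : is_derive t 1 (primitive_cov k lam (a i) (c i))
    (t * (r i ^+ 2 * A t i * (A t i - lam))) by exact: is_derive_primitive_cov.
have d2 i : is_derive t 1 (fun s => mean_weight i * primitive_mean k lam (a i) (c i) s)
    (mean_weight i * (t * (A t i * e t i ^+ 2))).
  by apply: derZ; exact: is_derive_primitive_mean.
rewrite (_ : geo_primitive = fun s => (\sum_i primitive_cov k lam (a i) (c i)) s +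
    (\sum_i (fun s => mean_weight i * primitive_mean k lam (a i) (c i) s)) s); last first.
  by apply/funext => s; rewrite !fct_sumE.
apply: (is_derive_eq (derD (is_derive_sum d1) (is_derive_sum d2))).
rewrite mulrDr !mulr_sumr; congr (_ + _).
by apply: eq_bigr => i _; rewrite mulrCA.
Qed.

(** Fundamental theorem of calculus for [geo_primitive]. *)
Lemma geo_action : KW_action lam (quad_potential geo_B geo_b) geo_curve =
  (k / (4 * lam) * (\sum_i xi k lam (a i) (c i)) +
   \sum_i mean_weight i *
     (if a i == c i then 2^-1 * (k * a i + lam)^-1
      else (4 * lam)^-1 *
        (xi k lam (a i) (c i) * ((Num.sqrt (c i) - Num.sqrt (a i))^-1) ^+ 2)))%:E.
Proof.
pose E t := \sum_i (r i ^+ 2 * A t i * (A t i - lam)) +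
            \sum_i mean_weight i * (A t i * e t i ^+ 2).
transitivity (\int[lebesgue_measure]_(t in `[0%R, 1%R]) (t * E t)%:E)%E.
  apply: eq_integral => t; rewrite inE /= in_itv /= => t01.
  by rewrite geo_sqnorm// EFinM.
have dG (t : R) : 0 <= t <= 1 -> is_derive t 1 geo_primitive (t * E t).
  exact: is_derive_geo_primitive.
rewrite (@continuous_FTC2 _ _ geo_primitive)//.
- rewrite -EFinB /geo_primitive; congr EFin.
  rewrite opprD addrACA -!sumrB; congr (_ + _).
    rewrite mulr_sumr; apply: eq_bigr => i _; exact: primitive_cov_diff.
  by apply: eq_bigr => i _; rewrite -mulrBr primitive_mean_diff.
- apply: derivable_within_continuous => t; rewrite in_itv /= => t01.
  have dA i := is_derive_conduct k_gt0 lam_gt0 (a_gt0 i) (c_gt0 i) t01.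
  have de i : is_derive t 1 (e ^~ i) (r i * (A t i * e t i) + 0).
    rewrite (_ : e ^~ i = fun s => r i * f s i + e 0 i); last first.
      by apply/funext => s; exact: slopeE.
    have df := is_derive_mean_coef k_gt0 lam_gt0 (a_gt0 i) (c_gt0 i) t01.
    exact: (derD (derZ (r i) df) (der_cst t (e 0 i))).
  have d1 i := derM (derZ (r i ^+ 2) (dA i)) (derB (dA i) (der_cst t lam)).
  have d2 i := derZ (mean_weight i) (derM (dA i) (derM (de i) (de i))).
  rewrite (_ : (fun t => t * E t) = fun s => s *
     ((\sum_i (fun s => r i ^+ 2 * A s i * (A s i - lam))) s +
      (\sum_i (fun s => mean_weight i * (A s i * (e s i * e s i)))) s)).
    by case: (derM (der_id t) (derD (is_derive_sum d1) (is_derive_sum d2))).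
  apply/funext => s; rewrite !fct_sumE; congr (_ * (_ + _)).
- have dG' (t : R) : 0 <= t <= 1 -> {for t, continuous geo_primitive}.
    move=> t01; apply: differentiable_continuous; apply/derivable1_diffP.
    by case: (dG _ t01).
  split.
  + by move=> t; rewrite in_itv /= => /andP[t0 t1]; case: (dG t); rewrite // !ltW.
  + by apply: cvg_at_right_filter; apply: dG'; rewrite lexx ler01.
  + by apply: cvg_at_left_filter; apply: dG'; rewrite lexx ler01.
- move=> t; rewrite in_itv /= => /andP[t0 t1]; rewrite derive1E.
  by case: (dG t); rewrite // !ltW.
Qed.

End elliptic_curve.

(** * The value of the divergence *)

Section nonmeasurable_monotonicity.
Local Open Scope ereal_scope.
Context (R : realType).

(** The integral of a nonnegative function is a supremum over the simple functions
    below it, hence monotone without any measurability.  This is needed for the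
    norm of an arbitrary potential as a function of time. *)
Lemma ge0_le_integral_nonmeasurable (D : set R) (f g : R -> \bar R) :
  (forall t, D t -> 0 <= f t) -> (forall t, D t -> f t <= g t) ->
  \int[@lebesgue_measure R]_(t in D) f t <= \int[@lebesgue_measure R]_(t in D) g t.
Proof.
move=> f0 fg; rewrite !ge0_integralE//; last first.
  by move=> t Dt; exact: le_trans (f0 t Dt) (fg t Dt).
apply: le_ereal_sup => _ [h /= hf <-]; exists h => //= t; apply: le_trans (hf t) _.
by rewrite !patchE; case: ifPn => // /set_mem /fg.
Qed.

End nonmeasurable_monotonicity.

Section divergence_value.
Context (R : realType) (d : nat) (Q : 'M[R]_d) (a c : 'I_d -> R) (lam : R) (g : R -> R).
Variables (rho nu : 'cV[R]_d -> R) (m0 m1 : 'cV[R]_d).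
Local Notation V := 'cV[R]_d.
Hypotheses (d_gt0 : (0 < d)%N) (uQ : Q \in unitmx) (lam_gt0 : 0 < lam).
Hypotheses (rhoE : elliptic rho m0 (fc Q a) g) (nuE : elliptic nu m1 (fc Q c) g).
Hypothesis uniq_geo : unique_quad_dual_geodesic lam rho nu.
Let k := kappa d g.
Let Dm := m1 - m0.

Let pos0 : sym_posdef (fc Q a). Proof. by case: rhoE. Qed.
Let pos1 : sym_posdef (fc Q c). Proof. by case: nuE. Qed.
Let a_gt0 : forall i, 0 < a i. Proof. exact: (fc_posdef_gt0 uQ pos0). Qed.
Let c_gt0 : forall i, 0 < c i. Proof. exact: (fc_posdef_gt0 uQ pos1). Qed.
Let sym0 : (fc Q a)^T = fc Q a. Proof. by case: pos0. Qed.
Let sym1 : (fc Q c)^T = fc Q c. Proof. by case: pos1. Qed.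

Let rho_dens : smooth_positive_density rho /\ finite_second_moment rho.
Proof.
have [gam [B [b [_ [_ dens _] [g0 _] _]]]] := uniq_geo.
by have := dens 0; rewrite in_itv /= lexx ler01 g0; apply.
Qed.

Let T := fc Q (fun i => Num.sqrt (a i)).
Let uT : T \in unitmx.
Proof. by apply: fc_unit => // i; rewrite gt_eqF// sqrtr_gt0. Qed.
Let TT : T *m T^T = fc Q a.
Proof.
rewrite (spectral_sym uQ sym0 sym1 (fun x _ => Num.sqrt x)) fcM//.
by apply: eq_fc => i; rewrite -expr2 sqr_sqrtr// ltW.
Qed.

Let k_gt0 : 0 < k.
Proof. by have [rd r2] := rho_dens; exact: (elliptic_kappa_gt0 d_gt0 rhoE rd r2 uT TT). Qed.
Let rho_mean : mean rho = m0.
Proof. by have [rd r2] := rho_dens; exact: (elliptic_mean rhoE rd r2 uT TT). Qed.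
Let rho_cov : cov rho = k *: fc Q a.
Proof. by have [rd r2] := rho_dens; exact: (elliptic_cov d_gt0 rhoE rd r2 uT TT). Qed.

Let curve := geo_curve Q a c k lam rho m0 Dm.
Let f0 := quad_potential (geo_B Q a c k lam) (geo_b Q a c k lam m0 Dm).

Let curve0 : curve 0 = rho.
Proof.
have L0 : geo_scaling Q a c k lam 0 = 1%:M.
  rewrite -(fc_const uQ); apply: eq_fc => i.
  by rewrite halflog0// oppr0 expR0.
have M0 : geo_mean Q a c k lam m0 Dm 0 = m0.
  rewrite /geo_mean (eq_fc _ (v := fun=> 0)); last by move=> i; exact: mean_coef0.
  by rewrite fc_const// raddf0 mul0mx addr0.
rewrite /curve /geo_curve L0 M0 mul1mx subrr; apply/funext => x.
by rewrite /affine_density det1 normr1 mul1r mul1mx addr0.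
Qed.

Let curve1 : curve 1 = nu.
Proof.
have M1 : geo_mean Q a c k lam m0 Dm 1 = m1.
  rewrite /geo_mean (eq_fc _ (v := fun=> 1)); last by move=> i; exact: mean_coef1.
  by rewrite fc_const// mul1mx addrC subrK.
set L := geo_scaling Q a c k lam 1.
have symL : L^T = L by exact: (spectral_sym uQ sym0 sym1 (fun x y => expR (- halflog k lam x y 1))).
have LSL : L *m invmx (fc Q a) *m L = invmx (fc Q c).
  rewrite !fc_inv// => [|i|i]; rewrite ?gt_eqF// !fcM//; apply: eq_fc => i.
  rewrite -[X in _ = X^-1](eigen1 k_gt0 lam_gt0 (a_gt0 i) (c_gt0 i)) /eigen expRN; field.
  by rewrite !gt_eqF// expR_gt0.
have detL : `|\det L| / Num.sqrt (\det (fc Q a)) = (Num.sqrt (\det (fc Q c)))^-1.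
  have -> : \det (fc Q c) = \det (fc Q a) * (\prod_i expR (halflog k lam (a i) (c i) 1)) ^+ 2.
    rewrite !det_fc// -prodrXl -big_split; apply: eq_bigr => i _ /=.
    by rewrite -[LHS](eigen1 k_gt0 lam_gt0 (a_gt0 i) (c_gt0 i)).
  have p0 : 0 < \prod_i expR (halflog k lam (a i) (c i) 1) by apply: prodr_gt0 => i _; exact: expR_gt0.
  rewrite sqrtrM; last by rewrite det_fc//; apply: prodr_ge0 => i _; exact: ltW.
  rewrite sqrtr_sqr (gtr0_norm p0) invfM mulrC; congr (_ * _).
  rewrite det_fc// ger0_norm; last by apply: prodr_ge0 => i _; exact: expR_ge0.
  by rewrite -prodfV; apply: eq_bigr => i _; rewrite expRN.
have [_ _ rE] := rhoE; have [_ _ nE] := nuE.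
apply/funext => x; rewrite /curve /geo_curve M1 -/L /affine_density rE nE.
rewrite mulrA detL; congr (_ * g _).
have -> : L *m x + (m0 - L *m m1) - m0 = L *m (x - m1)
  by rewrite mulmxBr [in LHS]addrCA [LHS]addrC addKr.
by rewrite trmx_mul symL -LSL !mulmxA.
Qed.

Let curve_generates : KW_generates lam f0 curve.
Proof. by have [rd r2] := rho_dens; exact: geo_generates. Qed.

(** Every dual geodesic from [rho] to [nu] is the curve; among the potentials
    generating it, the quadratic one has least energy at each time. *)
Lemma D_KW_geo : D_KW lam rho nu = KW_action lam f0 curve.
Proof.
have [gam0 [B0 [b0 [_ _ _ uniq]]]] := uniq_geo.
have cg : KW_dual_geodesic lam curve by exists f0; exact: curve_generates.
have cj : joins curve rho nu by exact: (conj curve0 curve1).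
have curveE gam t : KW_dual_geodesic lam gam -> joins gam rho nu -> t \in `[0, 1] ->
    gam t = curve t.
  move=> dg jg t01; rewrite (uniq _ dg jg t t01).
  exact: (esym (uniq _ cg cj t t01)).
apply/eqP; rewrite eq_le; apply/andP; split.
  by apply: ereal_inf_lbound; exists f0, curve; split; [exact: curve_generates|exact: cj|].
apply: le_ereal_inf_tmp => _ [f [gam [fg jg ->]]].
have gamE t : t \in `[0, 1] -> gam t = curve t.
  by move=> t01; apply: (curveE _ _ _ jg t01); exists f.
have [rd r2] := rho_dens; have [sf dens der] := fg; have [sf0 cdens cder] := curve_generates.
have sym_r : (geo_B Q a c k lam)^T = geo_B Q a c k lam.
  exact: (spectral_sym uQ sym0 sym1 (rate k lam)).
have psd t : 0 <= t <= 1 -> sym_possemidef (cov (curve t)).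
  move=> t01; have eE i := conductE k_gt0 lam_gt0 (a_gt0 i) (c_gt0 i) t01.
  rewrite /curve geo_curve_cov_fc//; apply: fc_possemidef => //.
    by move=> i; rewrite eE addrK mulr_ge0 ?(ltW k_gt0)// mulr_ge0 ?sqr_ge0// ltW.
  exact: (spectral_sym uQ sym0 sym1 (fun x y => conduct k lam x y t - lam)).
apply: ge0_le_integral_nonmeasurable => t /= t01.
  have [/andP[t0 _]] : 0 <= t <= 1 /\ True by move: t01; rewrite in_itv.
  have [cd c2] := cdens t t01; have [_ c0 _] := cd.
  rewrite mule_ge0 ?lee_fin//; apply: integral_ge0 => x _; rewrite lee_fin.
  rewrite mulr_ge0 ?(ltW (c0 _))//.
  have [|_ pC] := psd t; first by move: t01; rewrite in_itv.
  rewrite mulmxDr mulmxDl mxE addr_ge0//.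
  by rewrite mul_mx_scalar -scalemxAl mxE mulr_ge0 ?(ltW lam_gt0)// sqnorm_ge0.
rewrite lee_wpmul2l//; first by move: t01; rewrite in_itv /= lee_fin => /andP[].
have [cd c2] := cdens t t01.
rewrite (gamE t t01); apply: (sqnorm_KW_min lam_gt0 cd c2 _ sym_r sf).
  by apply: psd; move: t01; rewrite in_itv.
move=> x; have := der t t01 x; rewrite (gamE t t01) => dx.
apply: (is_derive_within_unique t01 _ dx (cder t t01 x)) => s s01.
by rewrite (gamE s s01).
Qed.

Lemma elliptic_geo_kappa_gt0 : 0 < k. Proof. exact: k_gt0. Qed.

Lemma D_KW_spectral : D_KW lam rho nu =
  (k / (4 * lam) * (\sum_i xi k lam (a i) (c i)) +
   \sum_i mean_weight Q Dm i *
     (if a i == c i then 2^-1 * (k * a i + lam)^-1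
      else (4 * lam)^-1 *
        (xi k lam (a i) (c i) * ((Num.sqrt (c i) - Num.sqrt (a i))^-1) ^+ 2)))%:E.
Proof.
rewrite D_KW_geo; have [rd r2] := rho_dens.
exact: geo_action.
Qed.

End divergence_value.

Section formula.
Context (R : realType) (d : nat) (Q : 'M[R]_d) (a c : 'I_d -> R) (k lam : R).
Variable Dm : 'cV[R]_d.
Hypotheses (uQ : Q \in unitmx) (k_gt0 : 0 < k) (lam_gt0 : 0 < lam).
Hypotheses (pos0 : sym_posdef (fc Q a)) (pos1 : sym_posdef (fc Q c)).

Let a_gt0 : forall i, 0 < a i. Proof. exact: (fc_posdef_gt0 uQ pos0). Qed.
Let c_gt0 : forall i, 0 < c i. Proof. exact: (fc_posdef_gt0 uQ pos1). Qed.
Let sym0 : (fc Q a)^T = fc Q a. Proof. by case: pos0. Qed.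
Let sym1 : (fc Q c)^T = fc Q c. Proof. by case: pos1. Qed.

(** On the indices with [a i = c i] the matrix P vanishes and its complement is the
    identity; on the others it is the reverse.  Each index thus contributes to
    exactly one of the two terms in [Dm]. *)
Lemma spectral_value :
  let S0 := fc Q a in let S1 := fc Q c in
  let DS := S1 - S0 in
  let S0l := k *: S0 + lam%:M in
  let S1l := k *: S1 + lam%:M in
  let P := DS *m mxpinv DS in
  let DSperp := 1%:M - DS *m mxpinv DS in
  let Xi := S1 *m mxln (S1 *m invmx S0) +
            k^-1 *: (S1l *m mxln (S0l *m invmx S1l)) in
  let W := mxpinv (mxsqrt S1 - mxsqrt S0) in
  k / (4 * lam) * \tr Xi
     + 2^-1 * (Dm^T *m (DSperp *m invmx S0l *m DSperp) *m Dm) 0 0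
     + (4 * lam)^-1 * (Dm^T *m P *m Xi *m P *m (W *m W) *m Dm) 0 0 =
  k / (4 * lam) * (\sum_i xi k lam (a i) (c i)) +
   \sum_i mean_weight Q Dm i *
     (if a i == c i then 2^-1 * (k * a i + lam)^-1
      else (4 * lam)^-1 *
        (xi k lam (a i) (c i) * ((Num.sqrt (c i) - Num.sqrt (a i))^-1) ^+ 2)).
Proof.
move=> S0 S1 DS S0l S1l P DSperp Xi W.
have DSE : DS = fc Q (fun i => c i - a i) by rewrite /DS fcB.
have S0lE : S0l = fc Q (fun i => k * a i + lam) by rewrite /S0l fcZ -(fc_const uQ) fcD.
have S1lE : S1l = fc Q (fun i => k * c i + lam) by rewrite /S1l fcZ -(fc_const uQ) fcD.
have l0 i : 0 < k * a i + lam by rewrite addr_gt0 ?mulr_gt0.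
have l1 i : 0 < k * c i + lam by rewrite addr_gt0 ?mulr_gt0.
have PE : P = fc Q (fun i => (c i - a i) / (c i - a i)).
  rewrite /P DSE mxpinv_fc ?fcM//.
  exact: (spectral_sym uQ sym0 sym1 (fun x y => y - x)).
have DSperpE : DSperp = fc Q (fun i => 1 - (c i - a i) / (c i - a i)).
  by rewrite /DSperp -/P PE -(fc_const uQ) fcB.
have XiE : Xi = fc Q (fun i => xi k lam (a i) (c i)).
  rewrite /Xi S0lE S1lE !fc_inv// => [|i|i]; rewrite ?gt_eqF//.
  rewrite !fcM// !mxln_fc// => [|i|i]; rewrite ?divr_gt0//.
  by rewrite !fcM// fcZ fcD; apply: eq_fc.
have WE : W = fc Q (fun i => (Num.sqrt (c i) - Num.sqrt (a i))^-1).
  rewrite /W !mxsqrt_fc// fcB mxpinv_fc//.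
  exact: (spectral_sym uQ sym0 sym1 (fun x y => Num.sqrt y - Num.sqrt x)).
rewrite XiE tr_fc// -addrA; congr (_ + _).
have -> : DSperp *m invmx S0l *m DSperp =
    fc Q (fun i => (1 - (c i - a i) / (c i - a i)) ^+ 2 / (k * a i + lam)).
  rewrite S0lE fc_inv// => [|i]; rewrite ?gt_eqF// DSperpE !fcM//.
  by apply: eq_fc => i; ring.
have -> : Dm^T *m P *m fc Q (fun i => xi k lam (a i) (c i)) *m P *m (W *m W) *m Dm =
    Dm^T *m fc Q (fun i => ((c i - a i) / (c i - a i)) ^+ 2 *
      (xi k lam (a i) (c i) * (Num.sqrt (c i) - Num.sqrt (a i))^-1 ^+ 2)) *m Dm.
  rewrite WE PE -!(mulmxA Dm^T) !fcM//; congr (_ *m (_ *m _)).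
  by apply: eq_fc => i; ring.
rewrite !fc_form !mulr_sumr -big_split; apply: eq_bigr => i _ /=.
rewrite -/(mean_weight Q Dm i); case: eqVneq => [->|ac].
  by rewrite subrr mul0r subr0 expr1n expr0n !mul0r !mulr0 addr0 mul1r mulrCA.
rewrite divff ?subr_eq0 1?eq_sym// subrr expr0n expr1n mul0r !mulr0 add0r mul1r.
by rewrite mulrCA.
Qed.

End formula.

Theorem theorem4p11 (R : realType) (d : nat) (lam : R) (g : R -> R)
    (m0 m1 : 'cV[R]_d) (S0 S1 : 'M[R]_d) (rho nu : 'cV[R]_d -> R)
    (d_gt0 : (0 < d)%N) (lam_gt0 : 0 < lam)
    (rhoE : elliptic rho m0 S0 g) (nuE : elliptic nu m1 S1 g)
    (S01 : codiagonalizable [:: S0; S1])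
    (uniq_geo : unique_quad_dual_geodesic lam rho nu) :
  let k := kappa d g in
  let Dm := m1 - m0 in
  let DS := S1 - S0 in
  let S0l := k *: S0 + lam%:M in
  let S1l := k *: S1 + lam%:M in
  let P := DS *m mxpinv DS in
  let DSperp := 1%:M - DS *m mxpinv DS in
  let Xi := S1 *m mxln (S1 *m invmx S0) +
            k^-1 *: (S1l *m mxln (S0l *m invmx S1l)) in
  let W := mxpinv (mxsqrt S1 - mxsqrt S0) in
  D_KW lam rho nu =
    (k / (4 * lam) * \tr Xi
     + 2^-1 * (Dm^T *m (DSperp *m invmx S0l *m DSperp) *m Dm) 0 0
     + (4 * lam)^-1 * (Dm^T *m P *m Xi *m P *m (W *m W) *m Dm) 0 0)%:E.
Proof.
have [Q uQ diagQ] := S01.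
have [D0 [D1 [E0 E1]]] : exists D0 D1 : 'rV[R]_d,
    Q *m S0 *m invmx Q = diag_mx D0 /\ Q *m S1 *m invmx Q = diag_mx D1.
  move: diagQ => /= /and3P[/diag_mxP[D0] + /diag_mxP[D1] + _].
  by rewrite !conjumx// => E0 E1; exists D0, D1.
have specE S D : Q *m S *m invmx Q = diag_mx D -> S = fc Q (fun i => D 0 i).
  move=> E; rewrite fcE (_ : \row_i _ = D); last by apply/rowP => i; rewrite mxE.
  by rewrite -E -!mulmxA mulVmx// mulmx1 mulKmx.
have {E0} S0E := specE _ _ E0; have {E1} S1E := specE _ _ E1.
clear S01 diagQ; subst S0 S1.
move=> k Dm DS S0l S1l P DSperp Xi W.
have [pos0 _ _] := rhoE; have [pos1 _ _] := nuE.
have k_gt0 := elliptic_geo_kappa_gt0 d_gt0 uQ rhoE nuE uniq_geo.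
rewrite (D_KW_spectral d_gt0 uQ lam_gt0 rhoE nuE uniq_geo).
by congr EFin; exact: (esym (spectral_value Dm uQ k_gt0 lam_gt0 pos0 pos1)).
Qed.
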